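(* Let $k,l\in\mathbb{Z}$ be weights, $d,e\geq0$ integers (depths), and $n\geq0$ an integer. Exclude the case in which both $d-k$ and $e-l$ are non-negative integers and $n$ is larger than both $d-k$ and $e-l$ but $n\leq d+e-k-l+1$. Then, up to multiplication by a global scalar, there is exactly one (nonzero) linear combination $[f,g]_{n;k,d;l,e}=\sum_{r=0}^{n}c_{r}\,\partial_{\tau}^{r}f\otimes\partial_{\tau}^{n-r}g$ with constant coefficients $c_{r}\in\mathbb{C}$ having the property that whenever $\Gamma$ is a Fuchsian group, $\rho,\eta$ are finite-dimensional representations of $\Gamma$, $f\in\widetilde{\mathcal{M}}_{k}^{*,\leq d}(\rho)$ and $g\in\widetilde{\mathcal{M}}_{l}^{*,\leq e}(\eta)$, one has $[f,g]_{n;k,d;l,e}\in\widetilde{\mathcal{M}}_{k+l+2n}^{*,\leq d+e}(\rho\otimes\eta)$. One normalization is $c_{r}=(-1)^{r}\binom{n}{r}\prod_{j=r}^{n-1}(k-d+j)\prod_{q=n-r}^{n-1}(l-e+q)$ (empty products equal $1$). Here $*$ can be any of $an$, $sing$, $mer$, $hol$, and, if $\Gamma$ has cusps, also $cusp$ or $wh$. Moreover, if $\Gamma$ has cusps, $n\geq1$ and $*=hol$, then $[f,g]_{n;k,d;l,e}\in\widetilde{\mathcal{M}}_{k+l+2n}^{cusp,\leq d+e}(\rho\otimes\eta)$.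
   Context: $\mathcal{H}$ is the upper half-plane, $\tau=x+iy$, $SL_{2}(\mathbb{R})$ acts by fractional linear transformations, $j_{\gamma}(\tau)=c\tau+d$ and $j_{\gamma}'=c$ for $\gamma=\begin{pmatrix}a&b\\c&d\end{pmatrix}$. A Fuchsian group is a discrete subgroup $\Gamma\leq SL_{2}(\mathbb{R})$ of finite covolume. For a finite-dimensional representation $\rho$ of $\Gamma$ on $V_{\rho}$, a quasi-modular form of weight $k$ and depth at most $d$ is a function $f:\mathcal{H}\to V_{\rho}$ with functions $f_{0}=f,\ldots,f_{d}$ such that $f(\gamma\tau)=\sum_{r=0}^{d}j_{\gamma}(\tau)^{k-r}(j_{\gamma}')^{r}\rho(\gamma)f_{r}(\tau)$ for all $\gamma\in\Gamma$. The space $\widetilde{\mathcal{M}}_{k}^{*,\leq d}(\rho)$ consists of such $f$ with regularity $*$: $an$ = real-analytic, $sing$ = real-analytic outside a discrete set, $hol$ = holomorphic, $mer$ = meromorphic; when $\Gamma$ has cusps, $cusp$ and $wh$ denote the cusp forms and weakly holomorphic forms (holomorphic on $\mathcal{H}$ with the usual respective conditions at the cusps). Tensor products of quasi-modular forms take values in $V_{\rho}\otimes V_{\eta}$ with representation $\rho\otimes\eta$. *)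

(* Defs.v *)
From HB Require Import structures.
From mathcomp Require Import all_boot all_order all_algebra.
From mathcomp Require Import complex mxtens.
From mathcomp Require Import all_classical all_reals all_analysis.
Import Order.TTheory GRing.Theory Num.Theory.
Import numFieldNormedType.Exports.

Set Implicit Arguments.
Unset Strict Implicit.
Unset Printing Implicit Defensive.

Local Open Scope classical_set_scope.
Local Open Scope ring_scope.
Local Open Scope complex_scope.

(* The topology of the complex numbers is that of R[i]^o, hence the casts to
   R[i]^o below.  All functions are total on R[i]; only their values on the
   upper half-plane (and off the singular set, if there is one) matter. *)

Definition upper_half_plane {R : realType} : set R[i] :=
  [set z | 0 < complex.Im z].

Definition mobius {R : realType} (g : 'M[R]_2) (z : R[i]) : R[i] :=
  ((g 0 0)%:C * z + (g 0 1)%:C) / ((g 1 0)%:C * z + (g 1 1)%:C).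

Definition autj {R : realType} (g : 'M[R]_2) (z : R[i]) : R[i] :=
  (g 1 0)%:C * z + (g 1 1)%:C.

Definition autj' {R : realType} (g : 'M[R]_2) : R[i] := (g 1 0)%:C.

(** Fuchsian groups, cusps, representations *)

Definition SL2_subgroup {R : realType} (Gamma : set 'M[R]_2) : Prop :=
  [/\ forall g, Gamma g -> \det g = 1,
      Gamma 1%:M,
      forall g h, Gamma g -> Gamma h -> Gamma (g *m h)
    & forall g, Gamma g -> Gamma (invmx g)].

(* A point (x, y) of R * R stands for x + i y; the hyperbolic area is
   dx dy / y^2. *)
Definition fundamental_set {R : realType} (Gamma : set 'M[R]_2)
    (D : set (R * R)) : Prop :=
  [/\ measurable D,
      forall p, D p -> 0 < p.2
    & forall z, upper_half_plane z ->
        exists! p, D p /\ exists2 g, Gamma g & p.1 +i* p.2 = mobius g z].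

Definition finite_covolume {R : realType} (Gamma : set 'M[R]_2) : Prop :=
  exists2 D : set (R * R), fundamental_set Gamma D &
    (\int[lebesgue_measure \x lebesgue_measure]_(p in D)
        (((p.2 : R) ^- 2)%:E) < +oo)%E.

Definition fuchsian {R : realType} (Gamma : set 'M[R]_2) : Prop :=
  [/\ SL2_subgroup Gamma, Gamma `<=` isolated Gamma & finite_covolume Gamma].

Definition parabolic {R : realType} (g : 'M[R]_2) : Prop :=
  [/\ g <> 1%:M, g <> - 1%:M & (\tr g) ^+ 2 = 4].

(* The cusps of Gamma are the points sigma(oo), for s = sigma in SL_2(R), that
   are fixed by some parabolic element of Gamma. *)
Definition cusp_at {R : realType} (Gamma : set 'M[R]_2) (s : 'M[R]_2) : Prop :=
  \det s = 1 /\
  exists g, [/\ Gamma g, parabolic g & (invmx s *m g *m s) 1 0 = 0].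

Definition has_cusps {R : realType} (Gamma : set 'M[R]_2) : Prop :=
  exists s, cusp_at Gamma s.

Definition representation {R : realType} (Gamma : set 'M[R]_2) (m : nat)
    (rho : 'M[R]_2 -> 'M[R[i]]_m) : Prop :=
  rho 1%:M = 1%:M /\
  forall g h, Gamma g -> Gamma h -> rho (g *m h) = rho g *m rho h.

Definition tensor_rep {R : realType} (m p : nat)
    (rho : 'M[R]_2 -> 'M[R[i]]_m) (eta : 'M[R]_2 -> 'M[R[i]]_p)
    (g : 'M[R]_2) : 'M[R[i]]_(m * p) := rho g *t eta g.

(** Regularity of functions *)

(* Absolutely convergent power series in x - Re a and y - Im a on a closed box
   around a. *)
Definition real_analytic_at {R : realType} (h : R[i] -> R[i]) (a : R[i]) :
    Prop :=
  exists (A : nat -> nat -> R[i]) (eps M : R),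
  [/\ 0 < eps,
      forall n, \sum_(i < n) \sum_(j < n) `|A i j| * eps%:C ^+ (i + j) <= M%:C
    & forall u v : R, `|u| <= eps -> `|v| <= eps ->
        ((fun n => \sum_(i < n) \sum_(j < n) A i j * u%:C ^+ i * v%:C ^+ j)
          : nat -> R[i]^o) @ \oo --> (h (a + (u +i* v)) : R[i]^o)].

Definition holomorphic_at {R : realType} (h : R[i] -> R[i]) (a : R[i]) : Prop :=
  exists (A : nat -> R[i]) (eps : R), 0 < eps /\
  forall z, `|z - a| < eps%:C ->
    ((fun n => \sum_(i < n) A i * (z - a) ^+ i) : nat -> R[i]^o)
      @ \oo --> (h z : R[i]^o).

(* Pole of order at most N at a; the value at a itself is irrelevant. *)
Definition meromorphic_at {R : realType} (h : R[i] -> R[i]) (a : R[i]) : Prop :=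
  exists (N : nat) (h0 : R[i] -> R[i]) (eps : R),
  [/\ 0 < eps, holomorphic_at h0 a
    & forall z, z != a -> `|z - a| < eps%:C -> h z = h0 z / (z - a) ^+ N].

Definition coordwise {R : realType} (m : nat)
    (P : (R[i] -> R[i]) -> R[i] -> Prop) (f : R[i] -> 'cV[R[i]]_m)
    (a : R[i]) : Prop :=
  forall i, P (fun z => f z i 0) a.

Definition discrete_in_H {R : realType} (S : set R[i]) : Prop :=
  forall a, upper_half_plane a -> ~ limit_point (S : set R[i]^o) a.

(** The operator d/dtau = (d/dx - i d/dy) / 2 *)

Definition derive_line {R : realType} (h : R -> R[i]) (t : R) : R[i] :=
  derive1 (fun s => complex.Re (h s) : R^o) t +i*
  derive1 (fun s => complex.Im (h s) : R^o) t.

Definition dtau_scalar {R : realType} (h : R[i] -> R[i]) (z : R[i]) : R[i] :=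
  (derive_line (fun x => h (x +i* complex.Im z)) (complex.Re z)
   - (0 +i* 1) * derive_line (fun y => h (complex.Re z +i* y)) (complex.Im z)) / 2.

Definition dtau {R : realType} (m : nat) (f : R[i] -> 'cV[R[i]]_m)
    (z : R[i]) : 'cV[R[i]]_m :=
  \col_i dtau_scalar (fun w => f w i 0) z.

(** Conditions at the cusps *)

(* If f_0, ..., f_d satisfy
     f(g z) = \sum_r j_g(z)^(k-r) (j_g')^r rho(g) f_r(z)   for g in Gamma,
   and s is in SL_2(R), then the functions at_cusp s k d F t below satisfy
     f(g s z) = \sum_t j_(gs)(z)^(k-t) (j_(gs)')^t rho(g) (at_cusp s k d F t z).
   They are the components, for the conjugate group s^-1 Gamma s, of the
   expansion of f at the cusp s(oo); for d = 0 this is the usual f|_k s. *)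
Definition at_cusp {R : realType} (m : nat) (s : 'M[R]_2) (k : int) (d : nat)
    (F : nat -> R[i] -> 'cV[R[i]]_m) (t : nat) (z : R[i]) : 'cV[R[i]]_m :=
  \sum_(r < d.+1 | (t <= r)%N)
    ('C(r, t)%:R * (- autj' s) ^+ (r - t) * autj s z ^ (r%:Z + t%:Z - k))
      *: F r (mobius s z).

Definition bounded_at_ioo {R : realType} (m : nat) (h : R[i] -> 'cV[R[i]]_m) :
    Prop :=
  exists M Y : R, forall z, Y <= complex.Im z ->
    forall i, `|h z i 0| <= M%:C.

Definition vanishing_at_ioo {R : realType} (m : nat)
    (h : R[i] -> 'cV[R[i]]_m) : Prop :=
  forall eps : R, 0 < eps -> exists Y : R, forall z, Y <= complex.Im z ->
    forall i, `|h z i 0| <= eps%:C.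

Definition exp_growth_at_ioo {R : realType} (m : nat)
    (h : R[i] -> 'cV[R[i]]_m) : Prop :=
  exists B M Y : R, forall z, Y <= complex.Im z ->
    forall i, `|h z i 0| <= (B * expR (M * complex.Im z))%:C.

(** Quasi-modular forms *)

(* mer: meromorphic on the upper half-plane; merc: moreover meromorphic at the
   cusps.  Both are closed under the brackets. *)
Variant regularity := an | sing | mer | merc | hol | cusp | wh.

Definition regularity_on_H {R : realType} (m : nat) (star : regularity)
    (S : set R[i]) (f : R[i] -> 'cV[R[i]]_m) : Prop :=
  forall a, upper_half_plane a ->
    match star with
    | an | sing => ~ S a -> coordwise real_analytic_at f a
    | mer | merc => (~ S a -> coordwise holomorphic_at f a) /\
                    coordwise meromorphic_at f a
    | hol | cusp | wh => coordwise holomorphic_at f a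
    end.

Definition singular_set {R : realType} (star : regularity) (S : set R[i]) :
    Prop :=
  match star with
  | sing | mer | merc => discrete_in_H S
  | _ => S = set0
  end.

(* For cusp forms only the component number 0 has to vanish at the cusps, the
   other ones being bounded: E_4' is a cusp form of weight 6 and depth 1 over
   SL_2(Z), although its component number 1 is a multiple of E_4. *)
Definition condition_at_cusps {R : realType} (Gamma : set 'M[R]_2) (m : nat)
    (star : regularity) (k : int) (d : nat) (S : set R[i])
    (F : nat -> R[i] -> 'cV[R[i]]_m) : Prop :=
  forall s, cusp_at Gamma s ->
    match star with
    | an | sing | mer => True
    | hol => forall t, (t <= d)%N -> bounded_at_ioo (at_cusp s k d F t)
    | cusp => (forall t, (t <= d)%N -> bounded_at_ioo (at_cusp s k d F t)) /\
              vanishing_at_ioo (at_cusp s k d F 0)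
    | wh => forall t, (t <= d)%N -> exp_growth_at_ioo (at_cusp s k d F t)
    | merc => (exists Y : R, forall z, Y <= complex.Im z -> ~ S (mobius s z)) /\
              forall t, (t <= d)%N -> exp_growth_at_ioo (at_cusp s k d F t)
    end.

(* S is the set of possible singularities; it is empty unless star is sing,
   mer or merc.  Over a Fuchsian group f_1, ..., f_d are determined by f. *)
Definition quasimodular {R : realType} (Gamma : set 'M[R]_2) (m : nat)
    (rho : 'M[R]_2 -> 'M[R[i]]_m) (star : regularity) (k : int) (d : nat)
    (f : R[i] -> 'cV[R[i]]_m) : Prop :=
  exists (F : nat -> R[i] -> 'cV[R[i]]_m) (S : set R[i]),
  [/\ F 0%N = f,
      singular_set star S,
      forall r, (r <= d)%N -> regularity_on_H star S (F r),
      forall g z, Gamma g -> upper_half_plane z -> ~ S z -> ~ S (mobius g z) ->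
        f (mobius g z) =
        \sum_(r < d.+1)
          (autj g z ^ (k - r%:Z) * autj' g ^+ r) *: (rho g *m F r z)
    & condition_at_cusps Gamma star k d S F].

(* cusp and wh are only considered for groups with cusps. *)
Definition regularity_for {R : realType} (Gamma : set 'M[R]_2)
    (star : regularity) : Prop :=
  match star with
  | cusp | wh => has_cusps Gamma
  | _ => True
  end.

(** Brackets *)

Definition bracket {R : realType} (n : nat) (c : 'rV[R[i]]_n.+1) (m p : nat)
    (f : R[i] -> 'cV[R[i]]_m) (g : R[i] -> 'cV[R[i]]_p) (z : R[i]) :
    'cV[R[i]]_(m * p) :=
  \sum_(r < n.+1)
    c 0 r *: (iter r (@dtau R m) f z *t iter (n - r) (@dtau R p) g z).

Definition preserves_quasimodularity {R : realType} (k l : int) (d e n : nat)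
    (c : 'rV[R[i]]_n.+1) : Prop :=
  forall (Gamma : set 'M[R]_2) (m p : nat)
    (rho : 'M[R]_2 -> 'M[R[i]]_m) (eta : 'M[R]_2 -> 'M[R[i]]_p)
    (star : regularity) (f : R[i] -> 'cV[R[i]]_m) (g : R[i] -> 'cV[R[i]]_p),
  fuchsian Gamma -> representation Gamma rho -> representation Gamma eta ->
  regularity_for Gamma star ->
  quasimodular Gamma rho star k d f -> quasimodular Gamma eta star l e g ->
  quasimodular Gamma (tensor_rep rho eta) star (k + l + (2 * n)%:Z) (d + e)
    (bracket c f g).

Definition rc_coef {R : realType} (k l : int) (d e n : nat) :
    'rV[R[i]]_n.+1 :=
  \row_(r < n.+1)
    ((-1) ^+ r * 'C(n, r)%:R
     * (\prod_(r <= j < n) (k - d%:Z + j%:Z)%:~R)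
     * (\prod_(n - r <= q < n) (l - e%:Z + q%:Z)%:~R)).

(* Main.v *)
Require Import Defs.
From HB Require Import structures.
From mathcomp Require Import all_boot all_order all_algebra.
From mathcomp Require Import complex mxtens ring lra zify.
From mathcomp Require Import all_classical all_reals all_analysis.
From mathcomp Require Import measurable_realfun.
Import Order.TTheory GRing.Theory Num.Theory.
Import numFieldNormedType.Exports.

Set Implicit Arguments.
Unset Strict Implicit.
Unset Printing Implicit Defensive.

Local Open Scope classical_set_scope.
Local Open Scope ring_scope.
Local Open Scope complex_scope.

(* On vectors (f_0, ..., f_d) the operator sending f_r to f_r' + (d - r + 1) f_(r-1)
   lifts d/dtau, and in the variable u = 1/X of the generating polynomial it is
   the derivation d/dtau + d/du. With respect to it a quasi-modular form of weight
   k and depth d behaves like a modular form of weight k - d, so the classical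
   Rankin-Cohen computation applies with the weights k - d and l - e. Cauchy
   estimates show that a derivative of a function bounded at a cusp vanishes
   there, hence the cusp forms for n >= 1.

   For uniqueness, y^(-d-p) Sym^m(z, 1) (x) Sym^p(conj z, 1) is a real analytic
   quasi-modular form for SL_2(Z), of any prescribed weight and depth once m and p
   are chosen. Its linear functionals include functions that vanish at z_0 to any
   given order; comparing degrees in X = c / (c z_0 + d) in the transformation law
   of the bracket yields, for every a < n,
     (n - a) (l - e + n - 1 - a) c_a + (a + 1) (k - d + a) c_(a+1) = 0,
   and outside the excluded case the solutions of this recurrence form a line. *)

(** Only [f_0] is given a transformation law, and laws for the other components are never derived.
    The law under one matrix with lower row [(c, d')] is read as an equality of generating
    polynomials on the curve [X = c / (c tau + d')]. There [u = tau + d'/c] moves with speed one, so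
    the curve is an integral curve of [d/dtau + d/du], and differentiating along it preserves the
    equality. Each step concerns a single matrix of determinant 1, so the same computation serves
    the elements of the group and the matrices that carry [oo] to a cusp.

    Power series are stable under [d/dtau] after shrinking the radius. Near the cusps finite Taylor
    expansions take their place, since they survive quotients and composition with Moebius maps;
    Cauchy's estimate is derived from a maximum principle for functions with such expansions.

    The test forms for uniqueness transform under all of [SL_2(R)], but the property may be tested
    only on Fuchsian groups, hence the explicit fundamental domain of [SL_2(Z)]. Its lower unipotent
    elements give infinitely many values of [X] at one point, enough to compare polynomials. *)

Local Notation nm := Normc.normc.

(** * The real-valued modulus and convergence of complex sequences *)

Section ComplexNorm.
Variable R : realType.
Implicit Types (z w : R[i]) (x y : R).

Lemma nm_ge0 z : 0 <= nm z.
Proof. by case: z => a b; exact: sqrtr_ge0. Qed.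

Lemma nm0 : nm (0 : R[i]) = 0. Proof. exact: Normc.normc0. Qed.

Lemma nm1 : nm (1 : R[i]) = 1. Proof. exact: Normc.normc1. Qed.

Lemma nmM z w : nm (z * w) = nm z * nm w. Proof. exact: Normc.normcM. Qed.

Lemma nmV z : nm z^-1 = (nm z)^-1. Proof. exact: Normc.normcV. Qed.

Lemma nmN z : nm (- z) = nm z. Proof. exact: normcN. Qed.

Lemma nmD z w : nm (z + w) <= nm z + nm w. Proof. exact: le_normcD. Qed.

Lemma nmB z w : nm (z - w) <= nm z + nm w.
Proof. by rewrite -(nmN w); exact: nmD. Qed.

Lemma nmBC z w : nm (z - w) = nm (w - z).
Proof. by rewrite -nmN opprB. Qed.

Lemma nm_eq0 z : (nm z == 0) = (z == 0).
Proof.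
by apply/eqP/eqP => [/Normc.eq0_normc|->] //; exact: nm0.
Qed.

Lemma nm_gt0 z : (0 < nm z) = (z != 0).
Proof. by rewrite lt_def nm_ge0 andbT nm_eq0. Qed.

Lemma nmX z n : nm (z ^+ n) = nm z ^+ n.
Proof. by elim: n => [|n IH]; rewrite ?expr0 ?nm1 // !exprS nmM IH. Qed.

Lemma nm_sum (I : Type) (r : seq I) (P : pred I) (F : I -> R[i]) :
  nm (\sum_(i <- r | P i) F i) <= \sum_(i <- r | P i) nm (F i).
Proof.
elim/big_rec2 : _ => [|i x y _ H]; first by rewrite nm0.
by apply: le_trans (nmD _ _) _; rewrite lerD2l.
Qed.

Lemma nm_sqr z : nm z ^+ 2 = complex.Re z ^+ 2 + complex.Im z ^+ 2.
Proof. by case: z => a b /=; rewrite sqr_sqrtr // addr_ge0 ?sqr_ge0. Qed.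

Lemma nm_real x : nm x%:C = `|x|.
Proof. by rewrite /= expr0n /= addr0 sqrtr_sqr. Qed.

Lemma nm_conj z : nm (conjc z) = nm z.
Proof. by case: z => a b /=; rewrite sqrrN. Qed.

Lemma nm_nat n : nm (n%:R : R[i]) = n%:R.
Proof. by rewrite -(rmorph_nat (real_complex R)) nm_real ger0_norm ?ler0n. Qed.

Lemma nm_Re z : `|complex.Re z| <= nm z.
Proof.
by rewrite -(@ler_pXn2r _ 2) ?nnegrE ?nm_ge0 // nm_sqr real_normK ?num_real // lerDl sqr_ge0.
Qed.

Lemma nm_Im z : `|complex.Im z| <= nm z.
Proof.
by rewrite -(@ler_pXn2r _ 2) ?nnegrE ?nm_ge0 // nm_sqr real_normK ?num_real // lerDr sqr_ge0.
Qed.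

Lemma nm_le_ReIm z : nm z <= `|complex.Re z| + `|complex.Im z|.
Proof.
rewrite -(@ler_pXn2r _ 2) ?nnegrE ?nm_ge0 ?addr_ge0 // nm_sqr.
rewrite sqrrD !real_normK ?num_real // lerD2r lerDl mulrn_wge0 //.
Qed.

(** The radii of [R[i]^o] are elements of [R[i]]; a real radius keeps all later estimates inside the
    ordered field [R]. *)
Definition tends (u : nat -> R[i]) (l : R[i]) : Prop :=
  forall e : R, 0 < e -> exists N, forall n, (N <= n)%N -> nm (u n - l) < e.

Lemma tendsP (u : nat -> R[i]) (l : R[i]) :
  ((u : nat -> R[i]^o) @ \oo --> (l : R[i]^o)) <-> tends u l.
Proof.
split.
  move=> /cvgrPdist_lt H e e0.
  have := H e%:C; rewrite ltcR => /(_ e0) [N _ HN]; exists N => n Nn.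
  by have := HN n Nn; rewrite /= -ltcR nmBC.
(* The order of [R[i]] compares only numbers with equal imaginary part, so a positive radius is
   real. *)
move=> H; apply/cvgrPdist_lt => e; case: e => e f; rewrite ltcE /= => /andP[/eqP -> e0].
have [N HN] := H _ e0; exists N => // n /= Nn.
by have := HN n Nn; rewrite -ltcR nmBC.
Qed.

Lemma tends_ext u v l : (forall n, u n = v n) -> tends u l -> tends v l.
Proof. by move=> /funext ->. Qed.

Lemma tends_cst l : tends (fun=> l) l.
Proof. by move=> e e0; exists 0%N => n _; rewrite subrr nm0. Qed.

Lemma tendsD u v l m : tends u l -> tends v m -> tends (fun n => u n + v n) (l + m).
Proof.
move=> Hu Hv e e0; have e20 : 0 < e / 2 by rewrite divr_gt0.
have [N HN] := Hu _ e20; have [N' HN'] := Hv _ e20.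
exists (maxn N N') => n; rewrite geq_max => /andP[/HN h /HN' h'].
have -> : u n + v n - (l + m) = (u n - l) + (v n - m) by ring.
by apply: le_lt_trans (nmD _ _) _; lra.
Qed.

Lemma tendsZ c u l : tends u l -> tends (fun n => c * u n) (c * l).
Proof.
move=> Hu e e0; have c0 : 0 < nm c + 1 by rewrite ltr_wpDl ?nm_ge0.
have [N HN] := Hu _ (divr_gt0 e0 c0); exists N => n /HN h.
rewrite -mulrBr nmM; apply: (@le_lt_trans _ _ ((nm c + 1) * nm (u n - l))).
  by rewrite ler_wpM2r ?nm_ge0 // lerDl.
by rewrite mulrC -ltr_pdivlMr.
Qed.

Lemma tends_near u v l : tends u l -> tends (fun n => u n - v n) 0 -> tends v l.
Proof.
move=> Hu /(tendsZ (-1)) Hv.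
by have := tendsD Hu Hv; rewrite mulr0 addr0; apply: tends_ext => n; ring.
Qed.

Lemma tends_shift u l : tends (fun n => u n.+1) l -> tends u l.
Proof.
move=> H e e0; have [N HN] := H e e0; exists N.+1 => -[//|n] Nn; exact: HN.
Qed.

Lemma tends_shiftr u l : tends u l -> tends (fun n => u n.+1) l.
Proof.
move=> H e e0; have [N HN] := H e e0; exists N => n Nn; apply: HN; exact: leqW.
Qed.

Lemma tends_le u l (C : R) : tends u l -> (forall n, nm (u n) <= C) -> nm l <= C.
Proof.
move=> H HC; rewrite leNgt; apply/negP => Cl.
have [N HN] := H (nm l - C) ltac:(lra).
have := HN N (leqnn N); have := HC N.
have : nm l <= nm (u N) + nm (u N - l) by
  apply: le_trans (nmB _ _); rewrite opprB addrC subrK.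
lra.
Qed.

Lemma tends_bounded u l : tends u l -> exists C : R, forall n, nm (u n) <= C.
Proof.
move=> H; have [N HN] := H 1 ltr01.
exists (nm l + 1 + \sum_(i < N) nm (u i)) => n.
have S0 : 0 <= \sum_(i < N) nm (u i) by apply: sumr_ge0 => i _; exact: nm_ge0.
case: (leqP N n) => [/HN h|nN].
  have : nm (u n) <= nm (u n - l) + nm l by apply: le_trans (nmD _ _); rewrite subrK.
  lra.
have : nm (u n) <= \sum_(i < N) nm (u i).
  rewrite (bigD1 (Ordinal nN)) //= lerDl; apply: sumr_ge0 => i _; exact: nm_ge0.
have := nm_ge0 l; lra.
Qed.

Lemma half_expr_lt (C e : R) : 0 < e -> exists N, forall n, (N <= n)%N -> C * 2^-1 ^+ n < e.
Proof.
move=> e0; have C0 : 0 < `|C| + 1 by rewrite ltr_wpDl.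
have := @cvg_expr R 2^-1; rewrite ger0_norm ?invr_ge0 // => /(_ ltac:(lra)).
move=> /cvgrPdist_lt /(_ _ (divr_gt0 e0 C0)) [N _ HN]; exists N => n Nn.
have := HN n Nn; rewrite /= sub0r normrN ger0_norm ?exprn_ge0 ?invr_ge0 // => h.
apply: (@le_lt_trans _ _ ((`|C| + 1) * 2^-1 ^+ n)).
  by rewrite ler_wpM2r ?exprn_ge0 ?invr_ge0 //; have := ler_norm C; lra.
by rewrite mulrC -ltr_pdivlMr.
Qed.

Lemma tendsM u v l m : tends u l -> tends v m -> tends (fun n => u n * v n) (l * m).
Proof.
move=> Hu Hv e e0; have [C HC] := tends_bounded Hu.
have C0 : 0 < `|C| + 1 by rewrite ltr_wpDl.
have m0 : 0 < nm m + 1 by rewrite ltr_wpDl ?nm_ge0.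
have e20 : 0 < e / 2 by rewrite divr_gt0.
have [N HN] := Hu _ (divr_gt0 e20 m0); have [N' HN'] := Hv _ (divr_gt0 e20 C0).
exists (maxn N N') => n; rewrite geq_max => /andP[/HN h /HN' h'].
have -> : u n * v n - l * m = u n * (v n - m) + (u n - l) * m by ring.
apply: le_lt_trans (nmD _ _) _; rewrite !nmM.
have h1 : nm (u n) * nm (v n - m) <= (`|C| + 1) * nm (v n - m).
  by rewrite ler_wpM2r ?nm_ge0 //; have := HC n; have := ler_norm C; lra.
have h2 : nm (u n - l) * nm m <= nm (u n - l) * (nm m + 1).
  by rewrite ler_wpM2l ?nm_ge0 // lerDl.
move: h h'; rewrite !ltr_pdivlMr // => h h'.
lra.
Qed.

Lemma tends_0_half u (C : R) : (forall n, nm (u n) <= C * 2^-1 ^+ n) -> tends u 0.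
Proof.
move=> H e e0; have [N HN] := half_expr_lt C e0; exists N => n /HN h.
by rewrite subr0; apply: le_lt_trans h.
Qed.

(** The rate [2^-n] is the one that a power series summable at radius [eps] gives at points of
    modulus at most [eps / 2]. *)
Lemma cauchy_half_cvg (u : nat -> R) (C : R) :
  (forall n m, (n <= m)%N -> `|u m - u n| <= C * 2^-1 ^+ n) ->
  exists l, forall e, 0 < e -> exists N, forall n, (N <= n)%N -> `|u n - l| < e.
Proof.
move=> H; have cu : cvgn u.
  apply: R_complete; apply/cauchy_exP => e e0.
  have [N HN] := half_expr_lt C e0.
  exists (u N); exists N => // n Nn; rewrite /ball /= distrC.
  by apply: le_lt_trans (H _ _ Nn) _; exact: HN.
exists (limn u) => e e0; move/cvgrPdist_lt : cu => /(_ _ e0) [N _ HN].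
by exists N => n Nn; rewrite distrC; exact: HN.
Qed.

Lemma tends_cauchy_half (u : nat -> R[i]) (C : R) :
  (forall n m, (n <= m)%N -> nm (u m - u n) <= C * 2^-1 ^+ n) ->
  exists l, tends u l.
Proof.
move=> H.
have [a Ha] : exists l : R, forall e, 0 < e -> exists N, forall n, (N <= n)%N -> `|complex.Re (u n) - l| < e.
  apply: (@cauchy_half_cvg _ C) => n m nm'; apply: le_trans (H _ _ nm').
  by apply: le_trans (nm_Re _); case: (u m) (u n) => a b [c d'] /=.
have [b Hb] : exists l : R, forall e, 0 < e -> exists N, forall n, (N <= n)%N -> `|complex.Im (u n) - l| < e.
  apply: (@cauchy_half_cvg _ C) => n m nm'; apply: le_trans (H _ _ nm').
  by apply: le_trans (nm_Im _); case: (u m) (u n) => c d [c' d'] /=.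
exists (a +i* b) => e e0; have e20 : 0 < e / 2 by rewrite divr_gt0.
have [N HN] := Ha _ e20; have [N' HN'] := Hb _ e20.
exists (maxn N N') => n; rewrite geq_max => /andP[/HN h /HN' h'].
apply: le_lt_trans (nm_le_ReIm _) _.
by move: h h'; case: (u n) => x y /=; lra.
Qed.

End ComplexNorm.

(** * Power series in two variables: convergence, products, derivatives *)

Section DoubleSeries.
Variable R : realType.
Implicit Types (A B : nat -> nat -> R[i]) (x y s t : R[i]) (eps M : R).

Definition dser A x y (n : nat) : R[i] :=
  \sum_(i < n) \sum_(j < n) A i j * x ^+ i * y ^+ j.

(** Absolute summability is one bound on all square partial sums, so that rearrangements are made on
    finite sums only. *)
Definition dsummable A eps M : Prop :=
  forall n, \sum_(i < n) \sum_(j < n) nm (A i j) * eps ^+ (i + j) <= M.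

Lemma dsummable_le A eps eps' M :
  0 <= eps' <= eps -> dsummable A eps M -> dsummable A eps' M.
Proof.
move=> /andP[e0 ee'] H n; apply: le_trans (H n).
apply: ler_sum => i _; apply: ler_sum => j _.
by rewrite ler_wpM2l ?nm_ge0 // lerXn2r // nnegrE // (le_trans e0).
Qed.

Lemma le_dterm A x y (r : R) i j : nm x <= r -> nm y <= r ->
  nm (A i j * x ^+ i * y ^+ j) <= nm (A i j) * r ^+ (i + j).
Proof.
move=> hx hy; have r0 : 0 <= r := le_trans (nm_ge0 _) hx.
rewrite !nmM !nmX exprD mulrA; apply: ler_pM; rewrite ?mulr_ge0 ?exprn_ge0 ?nm_ge0 //.
  by rewrite ler_wpM2l ?nm_ge0 // lerXn2r // nnegrE ?nm_ge0.
by rewrite lerXn2r // nnegrE ?nm_ge0.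
Qed.

Lemma half_expr_le (m n : nat) : (m <= n)%N -> (2^-1 : R) ^+ n <= 2^-1 ^+ m.
Proof. by move=> mn; apply: ler_wiXn2l => //; rewrite ?invr_ge0 // invf_le1 // ler1n. Qed.

(** Between the two squares every term has [i + j >= n], and its halved variables contribute
    [2^-(i+j) <= 2^-n]; what is left is summed by [M]. *)
Lemma dser_cauchy A x y eps M n m : nm x <= eps / 2 -> nm y <= eps / 2 ->
  dsummable A eps M -> (n <= m)%N ->
  nm (dser A x y m - dser A x y n) <= M * 2^-1 ^+ n.
Proof.
move=> hx hy H nm'.
have e0 : 0 <= eps by have := le_trans (nm_ge0 _) hx; lra.
have -> : dser A x y n =
    \sum_(i < m) \sum_(j < m) (if (i < n)%N && (j < n)%N then A i j * x ^+ i * y ^+ j else 0).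
  rewrite /dser (big_ord_widen m (fun i => \sum_(j < n) A i j * x ^+ i * y ^+ j)) // big_mkcond /=.
  apply: eq_bigr => i _; case: ifP => hi /=; last by rewrite big1.
  by rewrite (big_ord_widen m (fun j => A i j * x ^+ i * y ^+ j)) // big_mkcond.
rewrite /dser -sumrB; under eq_bigr do rewrite -sumrB.
apply: (@le_trans _ _ ((\sum_(i < m) \sum_(j < m) nm (A i j) * eps ^+ (i + j)) * 2^-1 ^+ n)); last first.
  by rewrite ler_wpM2r // exprn_ge0 // invr_ge0.
apply: le_trans (nm_sum _ _ _) _; rewrite mulr_suml; apply: ler_sum => i _.
apply: le_trans (nm_sum _ _ _) _; rewrite mulr_suml; apply: ler_sum => j _.
case: ifP => hij.
  by rewrite subrr nm0 !mulr_ge0 ?nm_ge0 ?exprn_ge0 ?invr_ge0.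
rewrite subr0; apply: le_trans (le_dterm _ _ _ hx hy) _.
rewrite exprMn -mulrA ler_wpM2l ?nm_ge0 // ler_wpM2l ?exprn_ge0 // half_expr_le //.
by move: hij; lia.
Qed.

Lemma dser_cvg A x y eps M : nm x <= eps / 2 -> nm y <= eps / 2 ->
  dsummable A eps M -> exists l, tends (dser A x y) l.
Proof.
move=> hx hy H; apply: (@tends_cauchy_half _ _ M) => n m nm'.
exact: (dser_cauchy hx hy).
Qed.

Lemma triangle_reindex (V : nmodType) (t : nat -> nat -> V) n :
  \sum_(p < n) \sum_(i < p.+1) t i (p - i)%N =
  \sum_(i < n) \sum_(j < n | (i + j < n)%N) t i j.
Proof.
transitivity (\sum_(p < n) \sum_(i < n | (i <= p)%N) t i (p - i)%N).
  by apply: eq_bigr => p _; rewrite (big_ord_widen n (fun i => t i (p - i)%N)).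
rewrite (exchange_big_dep xpredT) //=; apply: eq_bigr => i _.
rewrite -(big_mkord (fun p => (i <= p)%N) (fun p => t i (p - i)%N)).
rewrite -(big_mkord (fun j => (i + j < n)%N) (fun j => t i j)).
rewrite (@big_cat_nat _ _ _ i) //=; last exact: ltnW.
rewrite big_nat_cond big1 ?add0r; last by move=> p; lia.
rewrite -{1}[nat_of_ord i]add0n big_addn.
rewrite [RHS](@big_cat_nat _ _ _ (n - i)) ?leq_subr //=.
rewrite [X in _ = _ + X]big_nat_cond [X in _ = _ + X]big1 ?addr0; last by move=> p; lia.
rewrite [LHS]big_nat_cond [RHS]big_nat_cond.
by apply: eq_big => p; [have := ltn_ord i; lia|rewrite addnK].
Qed.

(** The Cauchy product in both variables: [triangle_reindex] once for [(i, i')] and once for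
    [(j, j')]. A product of two square sums exceeds it by the terms that the [if] cuts off. *)
Lemma square_reindex (V : nmodType) (t : nat -> nat -> nat -> nat -> V) n :
  \sum_(p < n) \sum_(q < n) \sum_(i < p.+1) \sum_(j < q.+1) t i j (p - i)%N (q - j)%N =
  \sum_(i < n) \sum_(j < n) \sum_(i' < n) \sum_(j' < n)
    (if (i + i' < n)%N && (j + j' < n)%N then t i j i' j' else 0).
Proof.
transitivity (\sum_(p < n) \sum_(i < p.+1)
    (\sum_(q < n) \sum_(j < q.+1) t i j (p - i)%N (q - j)%N)).
  by apply: eq_bigr => p _; rewrite exchange_big.
rewrite (triangle_reindex (fun i i' => \sum_(q < n) \sum_(j < q.+1) t i j i' (q - j)%N)).
apply: eq_bigr => i _; rewrite big_mkcond /= exchange_big /=; apply: eq_bigr => i' _.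
case: ifP => h /=; last by rewrite big1 // => j _; rewrite big1.
rewrite (triangle_reindex (fun j j' => t i j i' j')); apply: eq_bigr => j _.
by rewrite big_mkcond.
Qed.

Definition dconv A B (p q : nat) : R[i] :=
  \sum_(i < p.+1) \sum_(j < q.+1) A i j * B (p - i)%N (q - j)%N.

Lemma sum4_distr (K : comNzRingType) (a b : nat -> nat -> K) n :
  (\sum_(i < n) \sum_(j < n) a i j) * (\sum_(i < n) \sum_(j < n) b i j) =
  \sum_(i < n) \sum_(j < n) \sum_(i' < n) \sum_(j' < n) a i j * b i' j'.
Proof.
rewrite mulr_suml; apply: eq_bigr => i _; rewrite mulr_suml; apply: eq_bigr => j _.
by rewrite mulr_sumr; apply: eq_bigr => i' _; rewrite mulr_sumr.
Qed.

Lemma dconv_summable A B eps M M' : 0 <= eps ->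
  dsummable A eps M -> dsummable B eps M' -> dsummable (dconv A B) eps (M * M').
Proof.
move=> e0 HA HB n.
apply: (@le_trans _ _ ((\sum_(i < n) \sum_(j < n) nm (A i j) * eps ^+ (i + j)) *
   (\sum_(i < n) \sum_(j < n) nm (B i j) * eps ^+ (i + j)))); last first.
  by apply: ler_pM => //; apply: sumr_ge0 => i _; apply: sumr_ge0 => j _;
     rewrite mulr_ge0 ?nm_ge0 ?exprn_ge0.
rewrite (sum4_distr (fun i j => nm (A i j) * eps ^+ (i + j)) (fun i j => nm (B i j) * eps ^+ (i + j))).
pose t i j i' j' := (nm (A i j) * eps ^+ (i + j)) * (nm (B i' j') * eps ^+ (i' + j')).
apply: (@le_trans _ _ (\sum_(p < n) \sum_(q < n) \sum_(i < p.+1) \sum_(j < q.+1) t i j (p - i)%N (q - j)%N)).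
  apply: ler_sum => p _; apply: ler_sum => q _.
  apply: le_trans (ler_wpM2r (exprn_ge0 _ e0) (nm_sum _ _ _)) _.
  rewrite mulr_suml; apply: ler_sum => i _.
  apply: le_trans (ler_wpM2r (exprn_ge0 _ e0) (nm_sum _ _ _)) _.
  rewrite mulr_suml; apply: ler_sum => j _; rewrite nmM /t.
  have -> : (p + q = (i + j) + ((p - i) + (q - j)))%N by have := ltn_ord i; have := ltn_ord j; lia.
  by rewrite exprD le_eqVlt; apply/orP; left; apply/eqP; ring.
rewrite square_reindex; do 4 (apply: ler_sum => ? _).
by case: ifP => // _; rewrite /t !mulr_ge0 ?nm_ge0 ?exprn_ge0.
Qed.

(** Only the products with [i + i' >= n] or [j + j' >= n] separate the two sides; their total degree
    is at least [n], hence the factor [2^-n]. *)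
Lemma dser_dconv A B x y eps M M' n : nm x <= eps / 2 -> nm y <= eps / 2 ->
  dsummable A eps M -> dsummable B eps M' ->
  nm (dser A x y n * dser B x y n - dser (dconv A B) x y n) <= M * M' * 2^-1 ^+ n.
Proof.
move=> hx hy HA HB.
have e0 : 0 <= eps by have := le_trans (nm_ge0 _) hx; lra.
pose a i j := A i j * x ^+ i * y ^+ j; pose b i j := B i j * x ^+ i * y ^+ j.
have -> : dser (dconv A B) x y n =
   \sum_(i < n) \sum_(j < n) \sum_(i' < n) \sum_(j' < n)
    (if (i + i' < n)%N && (j + j' < n)%N then a i j * b i' j' else 0).
  rewrite -(square_reindex (fun i j i' j' => a i j * b i' j')).
  apply: eq_bigr => p _; apply: eq_bigr => q _.
  rewrite !mulr_suml; apply: eq_bigr => i _; rewrite !mulr_suml; apply: eq_bigr => j _.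
  have Ep : x ^+ p = x ^+ i * x ^+ (p - i) by rewrite -exprD subnKC //; have := ltn_ord i; lia.
  have Eq : y ^+ q = y ^+ j * y ^+ (q - j) by rewrite -exprD subnKC //; have := ltn_ord j; lia.
  by rewrite /a /b Ep Eq; ring.
rewrite (sum4_distr a b) -sumrB; under eq_bigr do rewrite -sumrB.
under eq_bigr do under eq_bigr do rewrite -sumrB.
under eq_bigr do under eq_bigr do under eq_bigr do rewrite -sumrB.
apply: (@le_trans _ _ (((\sum_(i < n) \sum_(j < n) nm (A i j) * eps ^+ (i + j)) *
   (\sum_(i < n) \sum_(j < n) nm (B i j) * eps ^+ (i + j))) * 2^-1 ^+ n)); last first.
  rewrite ler_wpM2r ?exprn_ge0 ?invr_ge0 //.
  by apply: ler_pM => //; apply: sumr_ge0 => i _; apply: sumr_ge0 => j _;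
     rewrite mulr_ge0 ?nm_ge0 ?exprn_ge0.
rewrite (sum4_distr (fun i j => nm (A i j) * eps ^+ (i + j)) (fun i j => nm (B i j) * eps ^+ (i + j))).
apply: le_trans (nm_sum _ _ _) _; rewrite mulr_suml; apply: ler_sum => i _.
apply: le_trans (nm_sum _ _ _) _; rewrite mulr_suml; apply: ler_sum => j _.
apply: le_trans (nm_sum _ _ _) _; rewrite mulr_suml; apply: ler_sum => i' _.
apply: le_trans (nm_sum _ _ _) _; rewrite mulr_suml; apply: ler_sum => j' _.
case: ifP => hij.
  by rewrite subrr nm0 !mulr_ge0 ?nm_ge0 ?exprn_ge0 ?invr_ge0.
rewrite subr0 nmM.
apply: le_trans (ler_pM (nm_ge0 _) (nm_ge0 _) (le_dterm _ _ _ hx hy) (le_dterm _ _ _ hx hy)) _.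
rewrite !exprMn [X in X <= _](_ : _ = (nm (A i j) * eps ^+ (i + j) *
  (nm (B i' j') * eps ^+ (i' + j'))) * (2^-1 ^+ (i + j) * 2^-1 ^+ (i' + j'))); last by ring.
rewrite ler_wpM2l ?mulr_ge0 ?nm_ge0 ?exprn_ge0 //.
by rewrite -exprD half_expr_le //; move: hij; lia.
Qed.

Lemma dser_mul A B x y eps M M' h h' : nm x <= eps / 2 -> nm y <= eps / 2 ->
  dsummable A eps M -> dsummable B eps M' ->
  tends (dser A x y) h -> tends (dser B x y) h' ->
  tends (dser (dconv A B) x y) (h * h').
Proof.
move=> hx hy HA HB th th'; apply: tends_near (tendsM th th') _.
by apply: tends_0_half => n; exact: dser_dconv HA HB.
Qed.

Definition dpx A (i j : nat) : R[i] := i.+1%:R * A i.+1 j.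
Definition dpy A (i j : nat) : R[i] := j.+1%:R * A i j.+1.

Lemma half_nat_le n : n.+1%:R * (2^-1 : R) ^+ n <= 1.
Proof.
rewrite exprVn ler_pdivrMr ?exprn_gt0 // mul1r -natrX ler_nat; exact: ltn_expl.
Qed.

(** Halving the radius absorbs the factor [i + 1] by [half_nat_le]; the index shift costs one power
    of [eps]. *)
Lemma dpx_summable A eps M : 0 < eps -> dsummable A eps M ->
  dsummable (dpx A) (eps / 2) (M / eps).
Proof.
move=> e0 H n; rewrite ler_pdivlMr //; apply: le_trans (H n.+1).
rewrite big_ord_recl /=; apply: ler_wpDl.
  by apply: sumr_ge0 => j _; rewrite mulr_ge0 ?nm_ge0 ?exprn_ge0 ?ltW.
rewrite mulr_suml; apply: ler_sum => i _; rewrite big_ord_recr /=.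
apply: ler_wpDr; first by rewrite mulr_ge0 ?nm_ge0 ?exprn_ge0 ?ltW.
rewrite mulr_suml; apply: ler_sum => j _.
rewrite /dpx nmM nm_nat exprMn /bump /= add1n addSn exprS.
rewrite [X in X <= _](_ : _ = (nm (A i.+1 j) * (eps * eps ^+ (i + j))) * (i.+1%:R * 2^-1 ^+ (i + j))); last by ring.
rewrite -[leRHS]mulr1 ler_wpM2l ?mulr_ge0 ?nm_ge0 ?exprn_ge0 ?(ltW e0) //.
apply: le_trans (half_nat_le i); rewrite ler_wpM2l ?ler0n // half_expr_le //; lia.
Qed.

Lemma dser_swap A x y n : dser (fun i j => A j i) y x n = dser A x y n.
Proof.
by rewrite /dser exchange_big /=; apply: eq_bigr => i _; apply: eq_bigr => j _; ring.
Qed.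

Lemma dsummable_swap A eps M : dsummable A eps M -> dsummable (fun i j => A j i) eps M.
Proof.
move=> H n; apply: le_trans (H n); rewrite exchange_big /=.
by apply: ler_sum => i _; apply: ler_sum => j _; rewrite addnC.
Qed.

Lemma dpy_summable A eps M : 0 < eps -> dsummable A eps M ->
  dsummable (dpy A) (eps / 2) (M / eps).
Proof.
move=> e0 H; have := dpx_summable e0 (dsummable_swap H).
by move/dsummable_swap.
Qed.

Definition dserx A x y n : R[i] :=
  \sum_(i < n) \sum_(j < n) A i j * (i%:R * x ^+ i.-1) * y ^+ j.

Lemma dserx_tends A x y eps M l : 0 < eps -> nm x <= eps / 4 -> nm y <= eps / 4 ->
  dsummable A eps M -> tends (dser (dpx A) x y) l -> tends (dserx A x y) l.
Proof.
move=> e0 hx hy H th; apply: tends_shift; apply: tends_near th _.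
apply: (@tends_0_half _ _ (M / eps)) => n.
(* Differentiating the square sum of side [n + 1] shifts only the first index: it gives the square
   sum of side [n] for [dpx A] and extra terms with [j = n], which tend to 0. *)
have -> : dserx A x y n.+1 = dser (dpx A) x y n + \sum_(i < n) dpx A i n * x ^+ i * y ^+ n.
  rewrite /dserx big_ord_recl /= big1 ?add0r; last by move=> j _; rewrite !(mul0r, mulr0).
  rewrite -big_split /=; apply: eq_bigr => i _; rewrite big_ord_recr /=; congr (_ + _).
    by apply: eq_bigr => j _; rewrite /dpx /bump /= add1n; ring.
  by rewrite /dpx /bump /= add1n; ring.
rewrite opprD addNKr nmN.
have hx' : nm x <= eps / 2 / 2 by lra.
have hy' : nm y <= eps / 2 / 2 by lra.
apply: le_trans (nm_sum _ _ _) _.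
apply: (@le_trans _ _ ((\sum_(i < n.+1) \sum_(j < n.+1) nm (dpx A i j) * (eps / 2) ^+ (i + j)) * 2^-1 ^+ n)); last first.
  by rewrite ler_wpM2r ?exprn_ge0 ?invr_ge0 //; exact: dpx_summable.
have e20 : 0 <= eps / 2 by lra.
rewrite big_ord_recr /= mulrDl; apply: ler_wpDr.
  by rewrite mulr_ge0 ?exprn_ge0 ?invr_ge0 // sumr_ge0 // => j _; rewrite mulr_ge0 ?nm_ge0 ?exprn_ge0.
rewrite mulr_suml; apply: ler_sum => i _.
rewrite big_ord_recr /= mulrDl; apply: ler_wpDl.
  by rewrite mulr_ge0 ?exprn_ge0 ?invr_ge0 // sumr_ge0 // => j _; rewrite mulr_ge0 ?nm_ge0 ?exprn_ge0.
apply: le_trans (le_dterm _ _ _ hx' hy') _.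
rewrite exprMn mulrA ler_wpM2l ?mulr_ge0 ?nm_ge0 ?exprn_ge0 // half_expr_le //; lia.
Qed.

Definition dsery A x y n : R[i] :=
  \sum_(i < n) \sum_(j < n) A i j * x ^+ i * (j%:R * y ^+ j.-1).

Lemma dsery_tends A x y eps M l : 0 < eps -> nm x <= eps / 4 -> nm y <= eps / 4 ->
  dsummable A eps M -> tends (dser (dpy A) x y) l -> tends (dsery A x y) l.
Proof.
move=> e0 hx hy H th.
have := @dserx_tends _ y x eps M l e0 hy hx (dsummable_swap H).
rewrite (_ : dser _ y x = dser (dpy A) x y); last by apply/funext => n; rewrite -dser_swap.
move=> /(_ th); apply: tends_ext => n; rewrite /dserx /dsery exchange_big /=.
by apply: eq_bigr => i _; apply: eq_bigr => j _; ring.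
Qed.

(* Bounds on a monomial of degree [k], on its linear part and on the error of
   its first order expansion, set up so as to pass from [b] to [x * b]. *)
Definition mono_bounds (r sg : R) (k : nat) (a b L : R[i]) :=
  [/\ nm b <= r ^+ k, nm L * r <= sg * k%:R * r ^+ k &
      nm (a - b - L) * r ^+ 2 <= sg ^+ 2 * k%:R ^+ 2 * r ^+ k].

Lemma mono_bounds_mul (r sg : R) k a b L x s :
  nm x <= r -> nm (x + s) <= r -> nm s <= sg -> mono_bounds r sg k a b L ->
  mono_bounds r sg k.+1 ((x + s) * a) (x * b) (s * b + x * L).
Proof.
move=> hx hxs hs [hb hL hR].
have r0 : 0 <= r := le_trans (nm_ge0 _) hx.
have s0 : 0 <= sg := le_trans (nm_ge0 _) hs.
have rk : 0 <= r ^+ k by exact: exprn_ge0.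
split.
- by rewrite nmM exprS; apply: ler_pM => //; exact: nm_ge0.
- apply: le_trans (ler_wpM2r r0 (nmD _ _)) _; rewrite !nmM exprS -natr1.
  have h1 := ler_pM (nm_ge0 _) (nm_ge0 _) hs hb.
  have h2 : nm x * (nm L * r) <= r * (sg * k%:R * r ^+ k).
    by apply: ler_pM => //; rewrite ?mulr_ge0 ?nm_ge0.
  have h3 := ler_wpM2r r0 h1.
  lra.
- have -> : (x + s) * a - x * b - (s * b + x * L) = (x + s) * (a - b - L) + s * L by ring.
  apply: le_trans (ler_wpM2r (exprn_ge0 _ r0) (nmD _ _)) _; rewrite !nmM (exprS r k) -natr1.
  have h1 : nm (x + s) * (nm (a - b - L) * r ^+ 2) <= r * (sg ^+ 2 * k%:R ^+ 2 * r ^+ k).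
    by apply: ler_pM => //; rewrite ?mulr_ge0 ?nm_ge0 ?exprn_ge0.
  have h2 : nm s * (nm L * r) <= sg * (sg * k%:R * r ^+ k).
    by apply: ler_pM => //; rewrite ?mulr_ge0 ?nm_ge0 ?exprn_ge0.
  have h3 := ler_wpM2r r0 h2.
  (* The slack is [(k + 1)^2 - k^2 - k = k + 1]. *)
  have h4 : 0 <= sg ^+ 2 * r ^+ k * r * (k%:R + 1).
    by rewrite !mulr_ge0 ?exprn_ge0 ?addr_ge0 ?ler0n.
  lra.
Qed.

Lemma monomial_bounds x y s t (r sg : R) i j :
  nm x <= r -> nm y <= r -> nm (x + s) <= r -> nm (y + t) <= r ->
  nm s <= sg -> nm t <= sg ->
  mono_bounds r sg (i + j) ((x + s) ^+ i * (y + t) ^+ j) (x ^+ i * y ^+ j)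
    (s * (i%:R * x ^+ i.-1 * y ^+ j) + t * (x ^+ i * (j%:R * y ^+ j.-1))).
Proof.
move=> hx hy hxs hyt hs ht; elim: i => [|i IH]; last first.
  have := mono_bounds_mul hx hxs hs IH; rewrite addSn !exprS !mulrA.
  congr mono_bounds; case: i {IH} => [|i]; rewrite /= ?expr0 ?exprS -?natr1; ring.
rewrite add0n; elim: j => [|j IH].
  rewrite !expr0 !(mul0r, mul1r, mulr1, mulr0, addr0); split.
  - by rewrite nm1.
  - by rewrite nm0 mul0r mulr0 mul0r.
  - by rewrite subrr subr0 nm0 mul0r expr0n /= mulr0 mul0r.
have := mono_bounds_mul hy hyt ht IH; rewrite !exprS.
congr mono_bounds; rewrite ?expr0; try ring.
case: j {IH} => [|j]; rewrite /= ?expr0 ?exprS -?natr1; ring.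
Qed.

(** A monomial of degree [k] has error at most [k^2 sg^2 r^(k-2)] with [r = eps / 4], and
    [k^2 < 4^k] turns [r^k] back into [eps^k]. The constant [M (4 / eps)^2] does not depend on the
    point, which makes the remainder [O(|w|^2)]. *)
Lemma dser_taylor A x y s t eps M (sg : R) h0 h1 hx hy : 0 < eps ->
  nm x <= eps / 4 -> nm y <= eps / 4 -> nm (x + s) <= eps / 4 -> nm (y + t) <= eps / 4 ->
  nm s <= sg -> nm t <= sg -> dsummable A eps M ->
  tends (dser A x y) h0 -> tends (dser A (x + s) (y + t)) h1 ->
  tends (dser (dpx A) x y) hx -> tends (dser (dpy A) x y) hy ->
  nm (h1 - h0 - (s * hx + t * hy)) <= M * (4 / eps) ^+ 2 * sg ^+ 2.
Proof.
move=> e0 bx by_ bxs byt bs bt H t0 t1 /(dserx_tends e0 bx by_ H) tx /(dsery_tends e0 bx by_ H) ty.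
have s0 : 0 <= sg := le_trans (nm_ge0 _) bs.
have r0 : 0 < eps / 4 by lra.
have := tendsD (tendsD t1 (tendsZ (-1) t0)) (tendsZ (-1) (tendsD (tendsZ s tx) (tendsZ t ty))).
rewrite !mulN1r => T; apply: tends_le T _ => n.
rewrite !mulN1r -sumrB; under eq_bigr do rewrite -sumrB.
rewrite !mulr_sumr -big_split /=; under [X in _ - X]eq_bigr do rewrite !mulr_sumr -big_split /=.
rewrite -sumrB; under eq_bigr do rewrite -sumrB.
apply: (@le_trans _ _ ((\sum_(i < n) \sum_(j < n) nm (A i j) * eps ^+ (i + j)) * ((4 / eps) ^+ 2 * sg ^+ 2))); last first.
  by rewrite -mulrA ler_wpM2r // mulr_ge0 ?exprn_ge0 // divr_ge0 // ltW.
apply: le_trans (nm_sum _ _ _) _; rewrite mulr_suml; apply: ler_sum => i _.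
apply: le_trans (nm_sum _ _ _) _; rewrite mulr_suml; apply: ler_sum => j _.
have [_ _ hR] := monomial_bounds i j bx by_ bxs byt bs bt.
rewrite [X in nm X](_ : _ = A i j * ((x + s) ^+ i * (y + t) ^+ j - x ^+ i * y ^+ j -
    (s * (i%:R * x ^+ i.-1 * y ^+ j) + t * (x ^+ i * (j%:R * y ^+ j.-1))))); last by ring.
rewrite nmM -[leRHS]mulrA ler_wpM2l ?nm_ge0 //.
rewrite -(@ler_pM2r _ ((eps / 4) ^+ 2)) ?exprn_gt0 //; apply: le_trans hR _.
rewrite [leRHS](_ : _ = sg ^+ 2 * eps ^+ (i + j)); last by field; rewrite lt0r_neq0.
rewrite -mulrA ler_wpM2l ?exprn_ge0 // exprMn mulrCA -[leRHS]mulr1 ler_wpM2l ?exprn_ge0 ?ltW //.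
rewrite exprVn ltr_pdivrMr ?exprn_gt0 // mul1r -!natrX ltr_nat.
by rewrite (_ : 4 = 2 ^ 2)%N // -expnM mulnC expnM ltn_exp2r // ltn_expl.
Qed.


End DoubleSeries.

(** * Remainders of order k at the origin *)

Section BigO.
Variable R : realType.
Implicit Types (r : R[i] -> R[i]) (z w : R[i]).

Definition cnear z (P : R[i] -> Prop) : Prop :=
  exists2 d : R, 0 < d & forall w, nm w < d -> P (z + w).

Lemma cnear_and z P Q : cnear z P -> cnear z Q -> cnear z (fun w => P w /\ Q w).
Proof.
move=> [d d0 Hd] [e e0 He]; exists (Num.min d e); first by rewrite lt_min d0.
by move=> w; rewrite lt_min => /andP[/Hd ? /He].
Qed.

Lemma cnear_sub z (P Q : R[i] -> Prop) : (forall w, P w -> Q w) -> cnear z P -> cnear z Q.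
Proof. by move=> H [d d0 Hd]; exists d => // w /Hd /H. Qed.

Lemma cnear_at z P : cnear z P -> P z.
Proof. by move=> [d d0 Hd]; have := Hd 0; rewrite nm0 addr0; exact. Qed.

Definition bigO (k : nat) r : Prop :=
  exists C d : R, 0 < d /\ forall w, nm w < d -> nm (r w) <= C * nm w ^+ k.

Lemma bigO_nneg k r : bigO k r ->
  exists C d : R, [/\ 0 <= C, 0 < d <= 1 & forall w, nm w < d -> nm (r w) <= C * nm w ^+ k].
Proof.
move=> [C [d [d0 H]]]; exists `|C|, (Num.min d 1); split => //.
  by rewrite lt_min d0 ltr01 ge_min lexx orbT.
move=> w; rewrite lt_min => /andP[/H h _]; apply: le_trans h _.
by rewrite ler_wpM2r ?exprn_ge0 ?nm_ge0 // ler_norm.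
Qed.

Lemma bigO_near k r r' : cnear 0 (fun w => r w = r' w) -> bigO k r -> bigO k r'.
Proof.
move=> [e e0 He] [C [d [d0 H]]]; exists C, (Num.min d e); rewrite lt_min d0; split=> // w.
by rewrite lt_min => /andP[/H h /He]; rewrite add0r => <-.
Qed.

Lemma bigO_ext k r r' : (forall w, r w = r' w) -> bigO k r -> bigO k r'.
Proof. by move=> /funext ->. Qed.

Lemma bigO_weak k l r : (l <= k)%N -> bigO k r -> bigO l r.
Proof.
move=> lk /bigO_nneg[C [d [C0 /andP[d0 d1] H]]]; exists C, d; split=> // w hw.
apply: le_trans (H _ hw) _; rewrite ler_wpM2l //; apply: ler_wiXn2l => //; first exact: nm_ge0.
by apply: ltW; exact: lt_le_trans d1.
Qed.

Lemma bigOD k r r' : bigO k r -> bigO k r' -> bigO k (fun w => r w + r' w).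
Proof.
move=> [C [d [d0 H]]] [C' [d' [d'0 H']]]; exists (C + C'), (Num.min d d').
rewrite lt_min d0; split=> // w; rewrite lt_min => /andP[/H h /H' h'].
by apply: le_trans (nmD _ _) _; rewrite mulrDl lerD.
Qed.

Lemma bigOM k l r r' : bigO k r -> bigO l r' -> bigO (k + l) (fun w => r w * r' w).
Proof.
move=> /bigO_nneg[C [d [C0 /andP[d0 _] H]]] /bigO_nneg[C' [d' [C'0 /andP[d'0 _] H']]].
exists (C * C'), (Num.min d d'); rewrite lt_min d0; split=> // w; rewrite lt_min => /andP[/H h /H' h'].
by rewrite nmM exprD mulrACA; apply: ler_pM => //; exact: nm_ge0.
Qed.

Lemma bigO_cst c : bigO 0 (fun=> c).
Proof. by exists (nm c), 1; split=> // w _; rewrite expr0 mulr1. Qed.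

Lemma bigOZ k c r : bigO k r -> bigO k (fun w => c * r w).
Proof. by move=> H; have := bigOM (bigO_cst c) H. Qed.

Lemma bigO0 k : bigO k (fun=> 0).
Proof. by exists 0, 1; split=> // w _; rewrite nm0 mul0r. Qed.

Lemma bigO_id : bigO 1 id.
Proof. by exists 1, 1; split=> // w _; rewrite expr1 mul1r. Qed.

Lemma bigO_conj : bigO 1 (@conjc R).
Proof. by exists 1, 1; split=> // w _; rewrite expr1 mul1r nm_conj. Qed.

Lemma bigO_Xn k : bigO k (fun w => w ^+ k).
Proof. by exists 1, 1; split=> // w _; rewrite mul1r nmX. Qed.

Lemma bigO_comp k r s : bigO k r -> bigO 1 s -> bigO k (fun w => r (s w)).
Proof.
move=> /bigO_nneg[C [d [C0 /andP[d0 _] H]]] /bigO_nneg[C' [d' [C'0 /andP[d'0 _] H']]].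
exists (C * (C' + 1) ^+ k), (Num.min d' (d / (C' + 1))).
have C1 : 0 < C' + 1 by lra.
rewrite lt_min d'0 divr_gt0 //; split=> // w; rewrite lt_min => /andP[/H' h' hw].
have hs : nm (s w) <= (C' + 1) * nm w.
  by apply: le_trans h' _; rewrite expr1 ler_wpM2r ?nm_ge0 // lerDl.
have hd : nm (s w) < d.
  by apply: le_lt_trans hs _; rewrite mulrC -ltr_pdivlMr.
apply: le_trans (H _ hd) _; rewrite -mulrA ler_wpM2l // -exprMn.
by rewrite lerXn2r // nnegrE ?nm_ge0 // mulr_ge0 ?nm_ge0 // ltW.
Qed.

Lemma bigO_cont r e : bigO 1 r -> 0 < e -> cnear 0 (fun w => nm (r w) < e).
Proof.
move=> /bigO_nneg[C [d [C0 /andP[d0 _] H]]] e0; have C1 : 0 < C + 1 by lra.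
exists (Num.min d (e / (C + 1))); first by rewrite lt_min d0 divr_gt0.
move=> w; rewrite lt_min add0r => /andP[/H h hw]; apply: le_lt_trans h _.
rewrite expr1; apply: (@le_lt_trans _ _ ((C + 1) * nm w)).
  by rewrite ler_wpM2r ?nm_ge0 // lerDl.
by rewrite mulrC -ltr_pdivlMr.
Qed.

End BigO.

(** * Wirtinger derivatives with quadratic remainder *)

Section Wirtinger.
Variable R : realType.
Implicit Types (h g s : R[i] -> R[i]) (z w al be : R[i]).

(** The coefficient of [w] is the derivative [d/dtau], that of [conjc w] the antiholomorphic one.
    Asking for [O(|w|^2)], which analytic functions satisfy, makes the product and chain rules plain
    algebra of remainders. *)
Definition wdiff h z al : Prop :=
  exists be, bigO 2 (fun w => h (z + w) - h z - (al * w + be * conjc w)).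

Definition hdiff h z al : Prop :=
  bigO 2 (fun w => h (z + w) - h z - al * w).

Lemma hdiff_wdiff h z al : hdiff h z al -> wdiff h z al.
Proof.
by move=> H; exists 0; apply: bigO_ext H => w; rewrite mul0r addr0.
Qed.

Lemma derive1_quadratic (u : R -> R) (t a C d : R) : 0 < d ->
  (forall s : R, `|s| < d -> `|u (t + s) - u t - a * s| <= C * s ^+ 2) ->
  derive1 (u : R -> R^o) t = a.
Proof.
move=> d0 H; rewrite derive1E; apply: cvg_lim => //.
apply/cvgrPdist_lt => e e0; near=> s.
have s0 : s != 0 by near: s; exact: nbhs_dnbhs_neq.
have C0 : 0 < `|C| + 1 by rewrite ltr_wpDl.
have hs : `|s| < Num.min d (e / (`|C| + 1)).
  near: s; apply: dnbhs0_lt; by rewrite lt_min d0 divr_gt0.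
move: hs; rewrite lt_min => /andP[/H hs hs'].
rewrite /GRing.scale /= /GRing.scale /= mulr1 (addrC s t).
have -> : a - s^-1 * (u (t + s) - u t) = - (s^-1 * (u (t + s) - u t - a * s)).
  by field.
rewrite normrN normrM normfV ltr_pdivrMl ?normr_gt0 //.
apply: le_lt_trans hs _; apply: (@le_lt_trans _ _ ((`|C| + 1) * `|s| ^+ 2)).
  rewrite -(@real_normK _ s) ?num_real // ler_wpM2r ?exprn_ge0 //.
  by have := ler_norm C; lra.
by rewrite expr2 mulrCA ltr_pM2l ?normr_gt0 // mulrC -ltr_pdivlMr.
Unshelve. all: by end_near. Qed.

Lemma derive_line_quadratic (u : R -> R[i]) (t : R) (a : R[i]) (C d : R) : 0 < d ->
  (forall s : R, `|s| < d -> nm (u (t + s) - u t - a * s%:C) <= C * `|s| ^+ 2) ->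
  derive_line u t = a.
Proof.
move=> d0 H; rewrite /derive_line.
rewrite (@derive1_quadratic _ t (complex.Re a) C d) //; last first.
  move=> s /H h; rewrite -(@real_normK _ s) ?num_real //; apply: le_trans h.
  apply: le_trans (nm_Re _); case: (u (t + s)) (u t) (a) => [x y] [x' y'] [c b] /=.
  by rewrite mulr0 subr0.
rewrite (@derive1_quadratic _ t (complex.Im a) C d) //; last first.
  move=> s /H h; rewrite -(@real_normK _ s) ?num_real //; apply: le_trans h.
  apply: le_trans (nm_Im _); case: (u (t + s)) (u t) (a) => [x y] [x' y'] [c b] /=.
  by rewrite mulr0 add0r.
by case: a {H}.
Qed.

(** The derivative is [al + be] in the direction 1 and [i (al - be)] in the direction [i], and the
    combination that defines [dtau_scalar] retains [al]. The limits inside [dtau_scalar] are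
    evaluated only here. *)
Lemma wdiff_dtau h z al : wdiff h z al -> dtau_scalar h z = al.
Proof.
move=> [be [C [d [d0 H]]]]; rewrite /dtau_scalar.
rewrite (@derive_line_quadratic _ _ (al + be) C d) //; last first.
  move=> s hs; have := H s%:C; rewrite nm_real => /(_ hs).
  rewrite conjc_real -mulrDl; congr (nm (h _ - h _ - _) <= _).
    by case: (z) => a b /=; simpc.
  by case: (z).
rewrite (@derive_line_quadratic _ _ ('i * (al - be)) C d) //; last first.
  move=> s hs; have := H ('i * s%:C); rewrite nmM nm_real.
  have -> : nm ('i : R[i]) = 1 by rewrite /= expr0n /= add0r expr1n sqrtr1.
  rewrite mul1r => /(_ hs).
  have -> : conjc ('i * s%:C) = - ('i * s%:C) :> R[i] by simpc.
  congr (nm (h _ - h _ - _) <= _).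
  - by case: (z) => a b /=; simpc.
  - by case: (z).
  - by ring.
have := @sqr_i R; rewrite -/('i) => ii.
have -> : (al + be - 'i * ('i * (al - be))) = 2 * al.
  by rewrite mulrA -expr2 ii; ring.
by field.
Qed.

Lemma wdiff_unique h z al al' : wdiff h z al -> wdiff h z al' -> al = al'.
Proof. by move=> /wdiff_dtau <- /wdiff_dtau. Qed.

Lemma wdiff_lin h z al : wdiff h z al -> bigO 1 (fun w => h (z + w) - h z).
Proof.
move=> [be H]; apply: (@bigO_ext _ _ (fun w => (h (z + w) - h z - (al * w + be * conjc w)) +
   (al * w + be * conjc w))); first by move=> w; ring.
apply: bigOD; first exact: bigO_weak H.
by apply: bigOD; apply: bigOZ; [exact: bigO_id|exact: bigO_conj].
Qed.

Lemma wdiff_bdd h z al : wdiff h z al -> bigO 0 (fun w => h (z + w)).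
Proof.
move=> /wdiff_lin /(@bigO_weak _ 1 0 _ isT) H.
by have := bigOD H (bigO_cst (h z)); apply: bigO_ext => w; rewrite subrK.
Qed.

Lemma wdiff_near h g z al : cnear z (fun w => h w = g w) -> wdiff h z al -> wdiff g z al.
Proof.
move=> Hn [be H]; exists be; apply: bigO_near H.
have hz := cnear_at Hn; move: Hn => [d d0 Hd]; exists d => // w /Hd.
by rewrite add0r hz => ->.
Qed.

Lemma wdiff_ext h g z al : (forall w, h w = g w) -> wdiff h z al -> wdiff g z al.
Proof. by move=> /funext ->. Qed.

Lemma wdiff_cst c z : wdiff (fun=> c) z 0.
Proof.
by exists 0; apply: bigO_ext (bigO0 _ 2) => w; rewrite subrr !mul0r addr0 subr0.
Qed.

Lemma wdiff_id z : wdiff id z 1.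
Proof.
by exists 0; apply: bigO_ext (bigO0 _ 2) => w; ring.
Qed.

Lemma wdiff_conj z : wdiff (@conjc R) z 0.
Proof.
by exists 1; apply: bigO_ext (bigO0 _ 2) => w; rewrite rmorphD; ring.
Qed.

Lemma wdiffD h g z al al' : wdiff h z al -> wdiff g z al' ->
  wdiff (fun w => h w + g w) z (al + al').
Proof.
move=> [be H] [be' H']; exists (be + be').
by have := bigOD H H'; apply: bigO_ext => w; ring.
Qed.

Lemma wdiffM h g z al al' : wdiff h z al -> wdiff g z al' ->
  wdiff (fun w => h w * g w) z (al * g z + h z * al').
Proof.
move=> H H'; have bg := wdiff_bdd H'; move: H H' => [be H] [be' H'].
have bL : bigO 1 (fun w => al * w + be * conjc w).
  by apply: bigOD; apply: bigOZ; [exact: bigO_id|exact: bigO_conj].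
have bL' : bigO 1 (fun w => al' * w + be' * conjc w).
  by apply: bigOD; apply: bigOZ; [exact: bigO_id|exact: bigO_conj].
have b0 := bigOD (bigO_cst (h z)) (@bigO_weak _ 1 0 _ isT bL).
exists (be * g z + h z * be').
have := bigOD (bigOD (bigOM H bg) (bigOM b0 H')) (bigOM bL bL').
by apply: bigO_ext => w; ring.
Qed.

Lemma wdiffZ c h z al : wdiff h z al -> wdiff (fun w => c * h w) z (c * al).
Proof. by move=> H; have := wdiffM (wdiff_cst c z) H; rewrite mul0r add0r. Qed.

Lemma wdiff_sum (I : Type) (r : seq I) (P : pred I) (h : I -> R[i] -> R[i]) (al : I -> R[i]) z :
  (forall i, P i -> wdiff (h i) z (al i)) ->
  wdiff (fun w => \sum_(i <- r | P i) h i w) z (\sum_(i <- r | P i) al i).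
Proof.
move=> H; elim: r => [|i r IH].
  by rewrite big_nil; apply: wdiff_ext (wdiff_cst 0 z) => w; rewrite big_nil.
rewrite big_cons; case: ifP => Pi.
  by apply: wdiff_ext (wdiffD (H i Pi) IH) => w; rewrite big_cons Pi.
by apply: wdiff_ext IH => w; rewrite big_cons Pi.
Qed.

Lemma wdiffX h z al n : wdiff h z al -> wdiff (fun w => h w ^+ n) z (n%:R * al * h z ^+ n.-1).
Proof.
move=> H; elim: n => [|n IH].
  by rewrite !mul0r; apply: wdiff_ext (wdiff_cst 1 z) => w; rewrite expr0.
have := wdiffM H IH.
have -> : al * h z ^+ n + h z * (n%:R * al * h z ^+ n.-1) = n.+1%:R * al * h z ^+ n.
  by case: n {IH} => [|n]; rewrite /= ?exprS ?expr0 -?natr1; ring.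
by apply: wdiff_ext => w; rewrite exprS.
Qed.

Lemma bigO0_inv (h : R[i] -> R[i]) c : c != 0 -> bigO 1 (fun w => h w - c) ->
  cnear 0 (fun w => h w != 0) /\ bigO 0 (fun w => (h w)^-1).
Proof.
rewrite -nm_gt0 => c0 H; have c20 : 0 < nm c / 2 by rewrite divr_gt0.
have [d d0 Hd] := bigO_cont H c20.
have Hlow w : nm w < d -> nm c / 2 < nm (h w).
  move=> /Hd; rewrite add0r => hw.
  have : nm c <= nm (h w) + nm (h w - c) by apply: le_trans (nmB _ _); rewrite opprB addrC subrK.
  lra.
split; first by exists d => // w /Hlow; rewrite add0r -nm_gt0; apply: lt_trans.
exists (nm c / 2)^-1, d; split=> // w /Hlow h'.
by rewrite expr0 mulr1 nmV lef_pV2 ?posrE //; [exact: ltW|exact: lt_trans h'].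
Qed.

Lemma wdiffV h z al : h z != 0 -> wdiff h z al ->
  wdiff (fun w => (h w)^-1) z (- (h z ^+ 2)^-1 * al).
Proof.
move=> hz0 H; have HL := wdiff_lin H; have [nz bV] := bigO0_inv hz0 HL.
move: H => [be H]; exists (- (h z ^+ 2)^-1 * be).
(* With [D] the increment of [h], [1/h(z+w) - 1/h(z) + D/h(z)^2 = D^2/(h(z)^2 h(z+w))]. *)
have := bigOD (bigOZ (- (h z ^+ 2)^-1) H)
  (bigOM (bigOZ (h z ^+ 2)^-1 (bigOM HL HL)) bV).
apply: bigO_near; move: nz => [d d0 Hd]; exists d => // w /Hd; rewrite add0r => hw0.
by field; rewrite hz0.
Qed.

(** The inner map is holomorphic, so [conjc w] is only multiplied by [conjc sg] and contributes
    nothing to the coefficient of [w]. *)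
Lemma wdiff_comp h s z al sg : wdiff h (s z) al -> hdiff s z sg ->
  wdiff (fun w => h (s w)) z (al * sg).
Proof.
move=> [be H] Hs; have Hl := wdiff_lin (hdiff_wdiff Hs).
exists (be * conjc sg).
have Hs' : bigO 2 (fun w => conjc (s (z + w) - s z - sg * w)).
  by move: Hs => [C [d [d0 Hd]]]; exists C, d; split=> // w /Hd; rewrite nm_conj.
have := bigOD (bigO_comp H Hl) (bigOD (bigOZ al Hs) (bigOZ be Hs')).
apply: bigO_ext => w; rewrite (addrC (s z)) subrK !rmorphB !rmorphM /=; ring.
Qed.

End Wirtinger.

(** * Linear combinations of double series *)

Section DserLinear.
Variable R : realType.
Implicit Types (A B : nat -> nat -> R[i]) (x y c : R[i]).

Lemma dserD A B x y n :
  dser (fun i j => A i j + B i j) x y n = dser A x y n + dser B x y n.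
Proof.
rewrite /dser -big_split; apply: eq_bigr => i _ /=; rewrite -big_split.
by apply: eq_bigr => j _ /=; ring.
Qed.

Lemma dserZ c A x y n : dser (fun i j => c * A i j) x y n = c * dser A x y n.
Proof.
rewrite /dser mulr_sumr; apply: eq_bigr => i _; rewrite mulr_sumr.
by apply: eq_bigr => j _; ring.
Qed.

Lemma dsummableD A B (eps M M' : R) : 0 <= eps -> dsummable A eps M -> dsummable B eps M' ->
  dsummable (fun i j => A i j + B i j) eps (M + M').
Proof.
move=> e0 HA HB n; apply: le_trans (lerD (HA n) (HB n)).
rewrite -big_split; apply: ler_sum => i _ /=; rewrite -big_split; apply: ler_sum => j _ /=.
by rewrite -mulrDl ler_wpM2r ?exprn_ge0 // nmD.
Qed.

Lemma dsummableZ c A (eps M : R) : dsummable A eps M ->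
  dsummable (fun i j => c * A i j) eps (nm c * M).
Proof.
move=> HA n; apply: le_trans (ler_wpM2l (nm_ge0 c) (HA n)).
rewrite mulr_sumr; apply: ler_sum => i _; rewrite mulr_sumr; apply: ler_sum => j _.
by rewrite nmM mulrA.
Qed.

Lemma dser_single (f : nat -> nat -> R[i]) i0 j0 n : (i0 < n)%N -> (j0 < n)%N ->
  (forall i j, (i, j) != (i0, j0) -> f i j = 0) ->
  \sum_(i < n) \sum_(j < n) f i j = f i0 j0.
Proof.
move=> hi hj H; rewrite (bigD1 (Ordinal hi)) //= (bigD1 (Ordinal hj)) //=.
rewrite !big1 ?addr0 //.
  move=> i ni; rewrite big1 // => j _; apply: H.
  by apply: contra ni => /eqP [E _]; apply/eqP/val_inj.
by move=> j nj; apply: H; apply: contra nj => /eqP [E]; apply/eqP/val_inj.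
Qed.

End DserLinear.

(** * Functions given by a power series in two linear forms *)

Section Analytic.
Variable R : realType.

(* [phi1 w] and [phi2 w] are the two variables of the power series: the real
   and imaginary parts of [w] for real analytic functions, [w] and [0] for
   holomorphic ones. *)
Variables p1 q1 p2 q2 : R[i].
Definition phi (p q w : R[i]) : R[i] := p * w + q * conjc w.
Hypothesis phi1_le : forall w, nm (phi p1 q1 w) <= nm w.
Hypothesis phi2_le : forall w, nm (phi p2 q2 w) <= nm w.
Hypothesis phi_ge : forall w, nm w <= nm (phi p1 q1 w) + nm (phi p2 q2 w).
Implicit Types (h g : R[i] -> R[i]) (a z w c : R[i]).

Definition ana h a : Prop :=
  exists (A : nat -> nat -> R[i]) (eps M : R), [/\ 0 < eps, dsummable A eps M &
    forall w, nm (phi p1 q1 w) <= eps -> nm (phi p2 q2 w) <= eps ->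
      tends (dser A (phi p1 q1 w) (phi p2 q2 w)) (h (a + w))].

Lemma ana_small h a (d : R) : 0 < d -> ana h a ->
  exists (A : nat -> nat -> R[i]) (eps M : R), [/\ 0 < eps < d, dsummable A eps M &
    forall w, nm (phi p1 q1 w) <= eps -> nm (phi p2 q2 w) <= eps ->
      tends (dser A (phi p1 q1 w) (phi p2 q2 w)) (h (a + w))].
Proof.
move=> d0 [A [eps [M [e0 HA H]]]]; exists A, (Num.min eps (d / 2)), M.
have d20 : 0 < d / 2 by rewrite divr_gt0.
have m0 : 0 < Num.min eps (d / 2) by rewrite lt_min e0.
split.
- by rewrite m0 gt_min; apply/orP; right; lra.
- by apply: dsummable_le HA; rewrite ltW // ge_min lexx.
- by move=> w; rewrite !le_min => /andP[h1 _] /andP[h2 _]; exact: H.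
Qed.

Lemma ana_near h g a : cnear a (fun w => h w = g w) -> ana h a -> ana g a.
Proof.
move=> [d d0 Hd] H; have d20 : 0 < d / 2 by rewrite divr_gt0.
have [A [eps [M [/andP[e0 ed] HA Hh]]]] := ana_small d20 H.
exists A, eps, M; split=> // w h1 h2; rewrite -Hd; first exact: Hh.
by apply: le_lt_trans (phi_ge w) _; lra.
Qed.

Lemma anaD h g a : ana h a -> ana g a -> ana (fun w => h w + g w) a.
Proof.
move=> [B [eps [N [e0 HB Hh]]]] /(ana_small e0) [A [ep [M [/andP[e'0 ee] HA Hg]]]].
exists (fun i j => B i j + A i j), ep, (N + M); split=> //.
  apply: dsummableD => //; first exact: ltW.
  by apply: dsummable_le HB; rewrite !ltW.
move=> w h1 h2; have t1 := Hh w (le_trans h1 (ltW ee)) (le_trans h2 (ltW ee)).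
by have := tendsD t1 (Hg w h1 h2); apply: tends_ext => n; rewrite dserD.
Qed.

Lemma anaZ c h a : ana h a -> ana (fun w => c * h w) a.
Proof.
move=> [A [eps [M [e0 HA H]]]]; exists (fun i j => c * A i j), eps, (nm c * M); split=> //.
  exact: dsummableZ.
by move=> w h1 h2; have := tendsZ c (H w h1 h2); apply: tends_ext => n; rewrite dserZ.
Qed.

Lemma anaM h g a : ana h a -> ana g a -> ana (fun w => h w * g w) a.
Proof.
move=> [B [eps [N [e0 HB Hh]]]] /(ana_small e0) [A [ep [M [/andP[e'0 ee] HA Hg]]]].
have HB' : dsummable B ep N by apply: dsummable_le HB; rewrite !ltW.
have e20 : 0 < ep / 2 by rewrite divr_gt0.
exists (dconv B A), (ep / 2), (N * M); split=> //.
  apply: (@dsummable_le _ _ ep); first by rewrite (ltW e20); lra.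
  by apply: dconv_summable => //; exact: ltW.
move=> w h1 h2; apply: (dser_mul h1 h2 HB' HA); last by apply: Hg; lra.
by apply: Hh; lra.
Qed.

Lemma ana_mono (A : nat -> nat -> R[i]) i0 j0 h a :
  (forall i j, (i, j) != (i0, j0) -> A i j = 0) ->
  (forall w, h (a + w) = A i0 j0 * phi p1 q1 w ^+ i0 * phi p2 q2 w ^+ j0) -> ana h a.
Proof.
move=> HA Hh; exists A, 1, (nm (A i0 j0)); split=> // [n|w _ _].
  pose n' := (n + i0 + j0).+1.
  apply: (@le_trans _ _ (\sum_(i < n') \sum_(j < n') nm (A i j))).
    have nn : (n <= n')%N by rewrite /n'; lia.
    rewrite (big_ord_widen n' (fun i => \sum_(j < n) nm (A i j) * 1 ^+ (i + j))) //.
    rewrite big_mkcond; apply: ler_sum => i _; case: ifP => _; last first.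
      by apply: sumr_ge0 => j _; exact: nm_ge0.
    rewrite (big_ord_widen n' (fun j => nm (A i j) * 1 ^+ (i + j))) //.
    rewrite big_mkcond; apply: ler_sum => j _; case: ifP => _; last exact: nm_ge0.
    by rewrite expr1n mulr1.
  rewrite -lecR rmorph_sum; under eq_bigr do rewrite rmorph_sum.
  rewrite (@dser_single _ (fun i j => (nm (A i j))%:C) i0 j0) //; try by rewrite /n'; lia.
  by move=> i j /HA ->; rewrite nm0.
move=> e e0; exists (i0 + j0).+1 => n nn; rewrite /dser.
rewrite (@dser_single _ (fun i j => A i j * phi p1 q1 w ^+ i * phi p2 q2 w ^+ j) i0 j0); try lia.
  by rewrite Hh subrr nm0.
by move=> i j /HA ->; rewrite !mul0r.
Qed.

Lemma ana_cst c a : ana (fun=> c) a.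
Proof.
apply: (@ana_mono (fun i j => if (i == 0)%N && (j == 0)%N then c else 0) 0%N 0%N).
  by move=> [|i] [|j].
by move=> w; rewrite !expr0 !mulr1.
Qed.

Lemma ana_phi1 a : ana (phi p1 q1) a.
Proof.
apply: (@ana_near (fun w => phi p1 q1 a + phi p1 q1 (w - a))).
  by exists 1 => // w _; rewrite /phi !rmorphB !rmorphD /=; ring.
apply: anaD; first exact: ana_cst.
apply: (@ana_mono (fun i j => if (i == 1)%N && (j == 0)%N then 1 else 0) 1%N 0%N).
  by move=> [|[|i]] [|j].
by move=> w; rewrite expr0 expr1 mulr1 mul1r addrC addKr.
Qed.

Lemma ana_phi2 a : ana (phi p2 q2) a.
Proof.
apply: (@ana_near (fun w => phi p2 q2 a + phi p2 q2 (w - a))).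
  by exists 1 => // w _; rewrite /phi !rmorphB !rmorphD /=; ring.
apply: anaD; first exact: ana_cst.
apply: (@ana_mono (fun i j => if (i == 0)%N && (j == 1)%N then 1 else 0) 0%N 1%N).
  by move=> [|i] [|[|j]].
by move=> w; rewrite expr0 expr1 mulr1 mul1r addrC addKr.
Qed.

Lemma anaX h a n : ana h a -> ana (fun w => h w ^+ n) a.
Proof.
move=> H; elim: n => [|n IH].
  by apply: ana_near (ana_cst 1 a); exists 1 => // w _; rewrite expr0.
by apply: ana_near (anaM H IH); exists 1 => // w _; rewrite exprS.
Qed.

(** By the chain rule the derivative is [p1] times the series [dpx A] plus [p2] times [dpy A], at
    every point near [a], which gives both claims. Taking [|w|, |s| < eps / 8] keeps [w] and [w + s]
    within the radius [eps / 4] of [dser_taylor]. *)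
Lemma ana_dtau_both h a : ana h a ->
  cnear a (fun z => wdiff h z (dtau_scalar h z)) /\ ana (dtau_scalar h) a.
Proof.
move=> [A [eps [M [e0 HA H]]]].
have key w : nm w < eps / 8 -> exists hx hy,
    [/\ tends (dser (dpx A) (phi p1 q1 w) (phi p2 q2 w)) hx,
        tends (dser (dpy A) (phi p1 q1 w) (phi p2 q2 w)) hy &
        wdiff h (a + w) (p1 * hx + p2 * hy)].
  move=> hw; have b1 := phi1_le w; have b2 := phi2_le w.
  have c1 : nm (phi p1 q1 w) <= eps / 2 / 2 by lra.
  have c2 : nm (phi p2 q2 w) <= eps / 2 / 2 by lra.
  have [hx tx] := dser_cvg c1 c2 (dpx_summable e0 HA).
  have [hy ty] := dser_cvg c1 c2 (dpy_summable e0 HA).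
  exists hx, hy; split=> //; exists (q1 * hx + q2 * hy), (M * (4 / eps) ^+ 2), (eps / 8).
  split=> [|s hs]; first by lra.
  have d1 := phi1_le s; have d2 := phi2_le s.
  have e1 := phi1_le (w + s); have e2 := phi2_le (w + s); have ws := nmD w s.
  have phiD p q : phi p q (w + s) = phi p q w + phi p q s.
    by rewrite /phi rmorphD /=; ring.
  rewrite !phiD in e1 e2.
  have t0 := H w ltac:(lra) ltac:(lra).
  have t1 := H (w + s); rewrite !phiD in t1; have {t1} t1 := t1 ltac:(lra) ltac:(lra).
  rewrite [X in nm (_ - X)](_ : _ = phi p1 q1 s * hx + phi p2 q2 s * hy); last by rewrite /phi; ring.
  rewrite -[a + w + s]addrA; apply: (dser_taylor (x := phi p1 q1 w) (y := phi p2 q2 w) e0 _ _ _ _ d1 d2 HA t0 t1 tx ty); lra.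
split.
  exists (eps / 8); first by lra.
  by move=> w /key[hx [hy [_ _ W]]]; rewrite (wdiff_dtau W).
(* Both forms at most [eps / 32] force [|w| <= eps / 16], within reach of [key]. *)
exists (fun i j => p1 * dpx A i j + p2 * dpy A i j), (eps / 32), (nm p1 * (M / eps) + nm p2 * (M / eps)).
split; first by lra.
  apply: dsummableD; first by lra.
    by apply: dsummableZ; apply: dsummable_le (dpx_summable e0 HA); lra.
  by apply: dsummableZ; apply: dsummable_le (dpy_summable e0 HA); lra.
move=> w h1 h2; have := phi_ge w => h3; have /key[hx [hy [tx ty W]]] : nm w < eps / 8 by lra.
rewrite (wdiff_dtau W); have := tendsD (tendsZ p1 tx) (tendsZ p2 ty).
by apply: tends_ext => n; rewrite dserD !dserZ.
Qed.

Lemma ana_wdiff h a : ana h a -> cnear a (fun z => wdiff h z (dtau_scalar h z)).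
Proof. by move=> /ana_dtau_both[]. Qed.

Lemma ana_dtau h a : ana h a -> ana (dtau_scalar h) a.
Proof. by move=> /ana_dtau_both[]. Qed.

End Analytic.

(** * Real analytic and holomorphic functions as instances *)

Section RegularityClasses.
Variable R : realType.
Implicit Types (h g : R[i] -> R[i]) (a z w c : R[i]).

Let ir : R[i] := 'i / 2.

Lemma phi_Re w : phi 2^-1 2^-1 w = (complex.Re w)%:C.
Proof. by rewrite /phi -mulrDr addcJ mulrA mulVf ?mul1r // pnatr_eq0. Qed.

Lemma phi_Im w : phi (- ir) ir w = (complex.Im w)%:C.
Proof. by rewrite ImJ_sub /phi /ir mulNr addrC -mulrBr -mulrA mulrC (mulrC 2^-1). Qed.

Lemma nm_phi_Re w : nm (phi 2^-1 2^-1 w) <= nm w.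
Proof. by rewrite phi_Re nm_real nm_Re. Qed.

Lemma nm_phi_Im w : nm (phi (- ir) ir w) <= nm w.
Proof. by rewrite phi_Im nm_real nm_Im. Qed.

Lemma nm_phi_ReIm w : nm w <= nm (phi 2^-1 2^-1 w) + nm (phi (- ir) ir w).
Proof. by rewrite phi_Re phi_Im !nm_real nm_le_ReIm. Qed.

Lemma phi_id w : phi 1 0 w = w.
Proof. by rewrite /phi mul1r mul0r addr0. Qed.

Lemma phi_0 w : phi 0 0 w = 0.
Proof. by rewrite /phi !mul0r addr0. Qed.

Lemma nm_phi_id w : nm (phi 1 0 w) <= nm w.
Proof. by rewrite phi_id. Qed.

Lemma nm_phi_0 w : nm (phi 0 0 w) <= nm w.
Proof. by rewrite phi_0 nm0 nm_ge0. Qed.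

Lemma nm_phi_id0 w : nm w <= nm (phi 1 0 w) + nm (phi 0 0 w).
Proof. by rewrite phi_0 phi_id nm0 addr0. Qed.

Lemma real_analyticP h a : real_analytic_at h a <-> ana 2^-1 2^-1 (- ir) ir h a.
Proof.
have dS (A : nat -> nat -> R[i]) (eps : R) n : \sum_(i < n) \sum_(j < n) `|A i j| * eps%:C ^+ (i + j) =
    (\sum_(i < n) \sum_(j < n) nm (A i j) * eps ^+ (i + j))%:C.
  rewrite rmorph_sum; apply: eq_bigr => i _; rewrite rmorph_sum; apply: eq_bigr => j _.
  by rewrite rmorphM rmorphXn.
split.
  move=> [A [eps [M [e0 HM H]]]]; exists A, eps, M; split=> // [n|w].
    by have := HM n; rewrite dS lecR.
  rewrite phi_Re phi_Im !nm_real => h1 h2; have /tendsP := H _ _ h1 h2.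
  by case: w {h1 h2}.
move=> [A [eps [M [e0 HM H]]]]; exists A, eps, M; split=> // [n|u v h1 h2].
  by rewrite dS lecR.
apply/tendsP; have := H (u +i* v); rewrite phi_Re phi_Im !nm_real; exact.
Qed.

(** [holomorphic_at] asks for plain convergence on a disc. Convergence at distance [eps / 2] bounds
    the terms by some [C], so at radius [eps / 4] the series is dominated by a geometric one of sum
    at most [2 C]. *)
Lemma holomorphicP h a : holomorphic_at h a <-> ana 1 0 0 0 h a.
Proof.
split.
  move=> [A [eps [e0 H]]].
  have r0 : 0 < eps / 2 by rewrite divr_gt0.
  have [C HC] : exists C : R, forall n, nm (A n) * (eps / 2) ^+ n <= C.
    have := H (a + (eps / 2)%:C); rewrite (addrC a) addrK => /(_ _)/tendsP T.
    have {}T := T; have := T ltac:(rewrite -[`|_|]/((nm _)%:C) nm_real ltcR ger0_norm; lra) => {}T.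
    have T' := tends_shiftr T; have := tendsD T' (tendsZ (-1) T) => /tends_bounded[C HC].
    exists C => n; apply: le_trans (HC n); rewrite big_ord_recr /= mulN1r addrAC subrr add0r.
    by rewrite nmM nmX nm_real ger0_norm // ltW.
  exists (fun i j => if j == 0%N then A i else 0), (eps / 4), (C * 2); split; first by lra.
    move=> n; apply: (@le_trans _ _ (\sum_(i < n) C * 2^-1 ^+ i)).
      apply: ler_sum => i _; case: n i => [[]//|n] i.
      rewrite big_ord_recl /= big1 ?addr0; last first.
        by move=> j _; rewrite [X in X * _](_ : _ = 0) ?mul0r //; exact: nm0.
      rewrite (_ : eps / 4 = (eps / 2) * 2^-1); last by field.
      by rewrite addn0 exprMn mulrA ler_wpM2r ?exprn_ge0 ?invr_ge0.
    have C0 : 0 <= C by apply: le_trans (HC 0%N); rewrite mulr_ge0 ?nm_ge0 ?exprn_ge0 ?ltW.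
    rewrite -mulr_sumr ler_wpM2l //.
    have -> : \sum_(i < n) (2^-1 : R) ^+ i = 2 - 2 * 2^-1 ^+ n.
      elim: n => [|n IH]; first by rewrite big_ord0 expr0; ring.
      by rewrite big_ord_recr /= IH exprS; field.
    by rewrite lerBlDr lerDl mulr_ge0 ?exprn_ge0 ?invr_ge0.
  move=> w; rewrite phi_id phi_0 => h1 _.
  have := H (a + w); rewrite (addrC a) addrK => /(_ _)/tendsP T.
  have {T} := T ltac:(rewrite -[`|_|]/((nm _)%:C) ltcR; lra).
  apply: tends_ext => -[|n]; rewrite /dser ?big_ord0 //.
  apply: eq_bigr => i _; rewrite big_ord_recl /= big1 ?addr0 ?expr0 ?mulr1 //.
  by move=> j _; rewrite /bump /= !mul0r.
move=> [A [eps [M [e0 HM H]]]]; exists (fun i => A i 0%N), eps; split=> // z hz.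
apply/tendsP; have := H (z - a); rewrite phi_id phi_0 nm0 (addrC a) subrK.
move=> T; have {T} := T (ltW _) (ltW e0); rewrite -ltcR => /(_ hz).
apply: tends_ext => -[|n]; rewrite /dser ?big_ord0 //.
apply: eq_bigr => i _; rewrite big_ord_recl /= big1 ?addr0 ?expr0 ?mulr1 //.
by move=> j _; rewrite /bump /= exprS mul0r mulr0.
Qed.

End RegularityClasses.

(** * Finite complex Taylor expansions at a point *)

Section Taylor.
Variable R : realType.
Implicit Types (h g s : R[i] -> R[i]) (z w : R[i]) (P Q : {poly R[i]}).

(** The polynomial is in [w] alone, so for [N >= 2] this includes complex differentiability. Finite
    expansions pass to quotients and compositions by polynomial algebra, where power series would
    have to be re-expanded. *)
Definition tay (N : nat) h z : Prop :=
  exists P, bigO N (fun w => h (z + w) - P.[w]).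

Lemma bigO_horner P : bigO 0 (horner P).
Proof.
elim/poly_ind: P => [|P c IH].
  by apply: bigO_ext (bigO0 _ 0) => w; rewrite horner0.
have := bigOD (bigOM IH (@bigO_weak _ 1 0 _ isT (bigO_id R))) (bigO_cst c).
by apply: bigO_ext => w; rewrite hornerMXaddC.
Qed.

Lemma bigO_horner0 P : P.[0] = 0 -> bigO 1 (horner P).
Proof.
move=> P0; have /factor_theorem[Q ->] : root P 0 by apply/rootP.
have := bigOM (bigO_horner Q) (bigO_id R).
by apply: bigO_ext => w; rewrite hornerM hornerXsubC subr0.
Qed.

Lemma bigO_horner_sub N P (u v : R[i] -> R[i]) : bigO 0 u -> bigO 0 v ->
  bigO N (fun w => u w - v w) -> bigO N (fun w => P.[u w] - P.[v w]).
Proof.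
move=> bu bv H; elim/poly_ind: P => [|P c IH].
  by apply: bigO_ext (bigO0 _ N) => w; rewrite !horner0 subrr.
have bP : bigO 0 (fun w => P.[v w]).
  elim/poly_ind: P {IH} => [|P c' IH].
    by apply: bigO_ext (bigO0 _ 0) => w; rewrite horner0.
  have := bigOD (bigOM IH bv) (bigO_cst c').
  by apply: bigO_ext => w; rewrite hornerMXaddC.
have h1 := bigOM IH bu; rewrite addn0 in h1; have := bigOD h1 (bigOM bP H).
by apply: bigO_ext => w; rewrite !hornerMXaddC; ring.
Qed.

Lemma tay_near N h g z : cnear z (fun w => h w = g w) -> tay N h z -> tay N g z.
Proof.
move=> [d d0 Hd] [P H]; exists P; apply: bigO_near H; exists d => // w /Hd.
by rewrite add0r => ->.
Qed.

Lemma tay_ext N h g z : (forall w, h w = g w) -> tay N h z -> tay N g z.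
Proof. by move=> /funext ->. Qed.

Lemma tay_weak N M h z : (M <= N)%N -> tay N h z -> tay M h z.
Proof. by move=> MN [P H]; exists P; exact: bigO_weak H. Qed.

Lemma tay_cst N c z : tay N (fun=> c) z.
Proof. by exists c%:P; apply: bigO_ext (bigO0 _ N) => w; rewrite hornerC subrr. Qed.

Lemma tay_id N z : tay N id z.
Proof.
by exists (z%:P + 'X); apply: bigO_ext (bigO0 _ N) => w; rewrite hornerD hornerC hornerX subrr.
Qed.

Lemma tayD N h g z : tay N h z -> tay N g z -> tay N (fun w => h w + g w) z.
Proof.
move=> [P HP] [Q HQ]; exists (P + Q); have := bigOD HP HQ.
by apply: bigO_ext => w; rewrite hornerD; ring.
Qed.

Lemma tay_bdd N h z : tay N h z -> bigO 0 (fun w => h (z + w)).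
Proof.
move=> [P /(@bigO_weak _ N 0 _ isT) H]; have := bigOD H (bigO_horner P).
by apply: bigO_ext => w; rewrite subrK.
Qed.

Lemma tayM N h g z : tay N h z -> tay N g z -> tay N (fun w => h w * g w) z.
Proof.
move=> [P HP] Tg; have bg := tay_bdd Tg; move: Tg => [Q HQ]; exists (P * Q).
have h1 := bigOM HP bg; rewrite addn0 in h1; have := bigOD h1 (bigOM (bigO_horner P) HQ).
by apply: bigO_ext => w; rewrite hornerM; ring.
Qed.

Lemma tayX N h z n : tay N h z -> tay N (fun w => h w ^+ n) z.
Proof.
move=> H; elim: n => [|n IH]; first by apply: tay_ext (tay_cst N 1 z) => w; rewrite expr0.
by apply: tay_ext (tayM H IH) => w; rewrite exprS.
Qed.

Lemma tay_sum N (I : Type) (r : seq I) (B : pred I) (h : I -> R[i] -> R[i]) z :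
  (forall i, B i -> tay N (h i) z) -> tay N (fun w => \sum_(i <- r | B i) h i w) z.
Proof.
move=> H; elim: r => [|i r IH].
  by apply: tay_ext (tay_cst N 0 z) => w; rewrite big_nil.
case: (boolP (B i)) => Bi.
  by apply: tay_ext (tayD (H i Bi) IH) => w; rewrite big_cons Bi.
by apply: tay_ext IH => w; rewrite big_cons (negbTE Bi).
Qed.

Lemma bigO_at0 N r : bigO N.+1 r -> r (0 : R[i]) = 0.
Proof.
move=> [C [d [d0 H]]]; have := H 0; rewrite nm0 expr0n mulr0 => /(_ d0) h.
by apply/eqP; rewrite -nm_eq0 eq_le h nm_ge0.
Qed.

Lemma tay_at0 N h z P : bigO N.+1 (fun w => h (z + w) - P.[w]) -> P.[0] = h z.
Proof. by move/bigO_at0; rewrite addr0 => /eqP; rewrite subr_eq0 => /eqP ->. Qed.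

Lemma tay_lin N h z : tay N.+1 h z -> bigO 1 (fun w => h (z + w) - h z).
Proof.
move=> [P H]; have P0 := tay_at0 H.
have h1 : bigO 1 (horner (P - (h z)%:P)).
  by apply: bigO_horner0; rewrite hornerD hornerN hornerC P0 subrr.
have := bigOD (@bigO_weak _ N.+1 1 _ isT H) h1.
by apply: bigO_ext => w; rewrite hornerD hornerN hornerC; ring.
Qed.

Lemma tayV N h z : h z != 0 -> tay N.+1 h z -> tay N.+1 (fun w => (h w)^-1) z.
Proof.
move=> hz Th; have [nz bV] := bigO0_inv hz (tay_lin Th).
move: Th => [P H]; have P0 := tay_at0 H; pose c := h z.
(* Truncated geometric series: [u] vanishes at 0 and [P Q = 1 - u^(N+1)], so [Q] inverts [P] up to
   the order allowed. *)
pose u := 1 - c^-1 *: P; pose Q := c^-1 *: \sum_(i < N.+1) u ^+ i.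
have u0 : u.[0] = 0 by rewrite /u !hornerE P0 mulVf // subrr.
have PQ w : P.[w] * Q.[w] = 1 - u.[w] ^+ N.+1.
  rewrite /Q hornerZ horner_sum; under eq_bigr do rewrite horner_exp.
  have Eu : c^-1 * P.[w] = 1 - u.[w] by rewrite /u !hornerE; ring.
  by rewrite mulrCA mulrA Eu -[RHS]opprB subrX1 -mulNr opprB.
exists Q; have hu : bigO N.+1 (fun w => u.[w] ^+ N.+1).
  by have := bigO_comp (bigO_Xn R N.+1) (bigO_horner0 u0).
have h1 := bigOM H (bigO_horner Q); rewrite addn0 in h1.
have := bigOM (bigOD hu (bigOZ (-1) h1)) bV; rewrite addn0.
apply: bigO_near; move: nz => [d d0 Hd]; exists d => // w /Hd; rewrite add0r => hw.
have -> : u.[w] ^+ N.+1 = 1 - P.[w] * Q.[w] by rewrite PQ; ring.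
by field.
Qed.

Lemma tay_comp N h s z : tay N.+1 h (s z) -> tay N.+1 s z -> tay N.+1 (fun w => h (s w)) z.
Proof.
move=> [P HP] Ts; have ls := tay_lin Ts; move: Ts => [S HS]; have S0 := tay_at0 HS.
exists (P \Po (S - (s z)%:P)).
have h1 := bigO_comp HP ls.
have b1 := @bigO_weak _ 1 0 _ isT ls.
have h2 : bigO N.+1 (fun w => (s (z + w) - s z) - (S - (s z)%:P).[w]).
  by apply: bigO_ext HS => w; rewrite hornerD hornerN hornerC; ring.
have := bigOD h1 (bigO_horner_sub P b1 (bigO_horner _) h2).
by apply: bigO_ext => w; rewrite horner_comp (addrC (s z)) subrK; ring.
Qed.

Lemma tay_coef N h z : tay N h z -> exists b : nat -> R[i],
  bigO N (fun w => h (z + w) - \sum_(i < N) b i * w ^+ i).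
Proof.
move=> [P H]; exists (fun i => P`_i).
have h1 := bigOM (bigO_Xn R N) (bigO_horner (drop_poly N P)); rewrite addn0 in h1.
have := bigOD H h1; apply: bigO_ext => w.
have -> : P.[w] = \sum_(i < N) P`_i * w ^+ i + w ^+ N * (drop_poly N P).[w].
  rewrite -{1}(poly_take_drop N P) hornerD hornerM hornerXn [X in _ + X]mulrC; congr (_ + _).
  by rewrite /take_poly horner_poly.
by ring.
Qed.

Lemma tay_hdiff h z : tay 2 h z -> exists al, hdiff h z al.
Proof.
move=> /tay_coef[b H]; exists (b 1%N); have b0 := bigO_at0 H.
move: b0; rewrite addr0 !big_ord_recr big_ord0 /= expr1 mulr0 addr0 add0r expr0 mulr1 => /eqP.
rewrite subr_eq0 => /eqP b0; apply: bigO_ext H => w.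
by rewrite !big_ord_recr big_ord0 /= b0 expr1; ring.
Qed.

Lemma tay_wdiff h z : tay 2 h z -> wdiff h z (dtau_scalar h z).
Proof.
by move=> /tay_hdiff[al /hdiff_wdiff W]; rewrite (wdiff_dtau W).
Qed.

(** The tail from degree [N] on is at most [(|w| / eps)^N] times the absolute sum at radius [eps],
    which [M] bounds. *)
Lemma holomorphic_tay N h z : ana 1 0 0 0 h z -> tay N h z.
Proof.
move=> [A [eps [M [e0 HM H]]]]; exists (\poly_(i < N) A i 0%N).
exists (M / eps ^+ N), eps; split=> // w hw.
have := H w; rewrite phi_id phi_0 nm0 => /(_ (ltW hw) (ltW e0)) T.
rewrite horner_poly.
have {}T : tends (fun n => \sum_(i < n.+1 + N) A i 0%N * w ^+ i) (h (z + w)).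
  move=> e /T[n0 Hn]; exists n0 => n nn; have := Hn (n.+1 + N)%N ltac:(lia).
  rewrite /dser; congr (nm (_ - _) < _); apply: eq_bigr => i _.
  by rewrite big_ord_recl /= big1 ?addr0 ?expr0 ?mulr1 // => j _; rewrite exprS mul0r mulr0.
have := tendsD T (tends_cst (- \sum_(i < N) A i 0%N * w ^+ i)).
move=> {}T; apply: (tends_le T) => n.
rewrite addnC big_split_ord /= addrAC subrr add0r.
apply: le_trans (nm_sum _ _ _) _.
rewrite mulrAC -(mulrC (nm w ^+ N)) ler_pdivlMr ?exprn_gt0 //.
have He : forall i : nat, 0 <= nm (A i 0%N) * eps ^+ i.
  by move=> i; rewrite mulr_ge0 ?nm_ge0 ?exprn_ge0 ?ltW.
apply: (@le_trans _ _ (nm w ^+ N * \sum_(i < N + n.+1) nm (A i 0%N) * eps ^+ i)); last first.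
  rewrite ler_wpM2l ?exprn_ge0 ?nm_ge0 //; apply: le_trans (HM (N + n.+1)%N).
  have h0 : (0 < N + n.+1)%N by lia.
  apply: ler_sum => i _; rewrite (bigD1 (Ordinal h0)) //= addn0 lerDl.
  by apply: sumr_ge0 => j _; rewrite mulr_ge0 ?nm_ge0 ?exprn_ge0 ?ltW.
rewrite big_split_ord /= mulrDr; apply: ler_wpDl.
  by rewrite mulr_ge0 ?exprn_ge0 ?nm_ge0 // sumr_ge0.
rewrite mulr_suml mulr_sumr; apply: ler_sum => i _.
rewrite nmM nmX !exprD.
have : nm w ^+ i <= eps ^+ i by rewrite lerXn2r ?nnegrE ?nm_ge0 ?ltW.
move=> hi; rewrite [leLHS](_ : _ = (nm w ^+ N * nm (A (N + i)%N 0%N) * eps ^+ N) * nm w ^+ i); last by ring.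
rewrite [leRHS](_ : _ = (nm w ^+ N * nm (A (N + i)%N 0%N) * eps ^+ N) * eps ^+ i); last by ring.
by rewrite ler_wpM2l // !mulr_ge0 ?exprn_ge0 ?nm_ge0 ?ltW.
Qed.

End Taylor.

(** * Maximum principle and Cauchy's estimate *)

Section CauchyEstimate.
Variable R : realType.
Implicit Types (h g : R[i] -> R[i]) (a z w : R[i]).

Lemma nm_continuous2 g (p : R * R) : tay 1 g (p.1 +i* p.2) ->
  {for p, continuous (fun q : R * R => nm (g (q.1 +i* q.2)))}.
Proof.
move=> T; apply/cvgrPdist_lt => e e0; have [d d0 Hd] := bigO_cont (tay_lin T) e0.
have d20 : 0 < d / 2 by rewrite divr_gt0.
exists (ball p.1 (d / 2), ball p.2 (d / 2)).
  by split; exact: nbhsx_ballx.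
move=> [x y] [/= h1 h2].
have := Hd ((x - p.1) +i* (y - p.2)); rewrite add0r.
have -> : (p.1 +i* p.2) + ((x - p.1) +i* (y - p.2)) = x +i* y.
  by simpc; rewrite !(addrC _ (_ - _)) !subrK.
move=> H; have {H} : nm (g (x +i* y) - g (p.1 +i* p.2)) < e.
  apply: H; apply: le_lt_trans (nm_le_ReIm _) _ => /=.
  by move: h1 h2; rewrite /ball /= distrC (distrC p.2); lra.
have t1 : nm (g (x +i* y)) <= nm (g (x +i* y) - g (p.1 +i* p.2)) + nm (g (p.1 +i* p.2)).
  by apply: le_trans (nmD _ _); rewrite subrK.
have t2 : nm (g (p.1 +i* p.2)) <= nm (g (x +i* y) - g (p.1 +i* p.2)) + nm (g (x +i* y)).
  by rewrite nmBC; apply: le_trans (nmD _ _); rewrite subrK.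
by move=> t3; rewrite ltr_norml; apply/andP; split; lra.
Qed.

(** A square is a product of two segments, which gives its compactness; to lie in a half-plane
    [Im z > Y] it needs room only in the vertical direction. *)
Definition square a (r : R) z : Prop :=
  `|complex.Re z - complex.Re a| <= r /\ `|complex.Im z - complex.Im a| <= r.

(** The four points are [t] times the fourth roots of unity. Distinct powers among [1, w, w^2] are
    orthogonal on them, so the cross terms cancel. *)
Lemma parseval4 (b0 b1 b2 : R[i]) (t : R) :
  let u w := b0 + b1 * w + b2 * (w * w) in
  nm (u t%:C) ^+ 2 + nm (u (0 +i* t)) ^+ 2 + nm (u (- t%:C)) ^+ 2 + nm (u (0 -i* t)) ^+ 2
   = 4 * (nm b0 ^+ 2 + t ^+ 2 * nm b1 ^+ 2 + t ^+ 4 * nm b2 ^+ 2).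
Proof.
move=> u; rewrite !nm_sqr /u {u}; case: b0 => x0 y0; case: b1 => x1 y1; case: b2 => x2 y2 /=.
by ring.
Qed.

Lemma square_in a r p : `|complex.Re p - complex.Re a| < r ->
  `|complex.Im p - complex.Im a| < r -> cnear p (square a r).
Proof.
move=> h1 h2; exists (Num.min (r - `|complex.Re p - complex.Re a|) (r - `|complex.Im p - complex.Im a|)).
  by rewrite lt_min !subr_gt0 h1.
move=> w; rewrite lt_min => /andP[w1 w2]; have := nm_Re w; have := nm_Im w => wi wr.
split; case: p w h1 h2 w1 w2 wi wr => [x y] [u v] /= h1 h2 w1 w2 wi wr.
  rewrite addrAC; apply: le_trans (ler_normD _ _) _; lra.
rewrite addrAC; apply: le_trans (ler_normD _ _) _; lra.
Qed.

(* [|g|^2 + e |z - a|^2] has no interior maximum: averaging it over the four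
   points [p + i^k t] kills the terms of order 1 and 2 in the expansion of [g]
   at [p], up to nonnegative ones. *)
Lemma no_interior_max g a p (r e : R) : 0 < e -> tay 3 g p -> cnear p (square a r) ->
  ~ (forall z, square a r z ->
      nm (g z) ^+ 2 + e * nm (z - a) ^+ 2 <= nm (g p) ^+ 2 + e * nm (p - a) ^+ 2).
Proof.
move=> e0 /tay_coef[b H] [d1 d10 Hsq] Hmax.
have b0 : b 0%N = g p.
  have := bigO_at0 H; rewrite addr0 !big_ord_recr big_ord0 /= !expr0n /= !mulr0 !addr0 add0r mulr1.
  by move=> /eqP; rewrite subr_eq0 => /eqP ->.
have [C [d [C0 /andP[d0 dle1] HC]]] := bigO_nneg H.
pose F := nm (g p) ^+ 2 + e * nm (p - a) ^+ 2; pose B := F + 1.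
have F0 : 0 <= F by rewrite addr_ge0 ?exprn_ge0 ?nm_ge0 // mulr_ge0 ?exprn_ge0 ?nm_ge0 // ltW.
(* With [|g| <= B] at the four points and [t <= 1], squaring [|u| <= |g| + C t^3] costs at most
   [D t^3]; [t] is then chosen so that this stays below the gain [e t^2]. *)
pose D := 2 * B * C + C ^+ 2.
have D0 : 0 <= D by rewrite addr_ge0 ?exprn_ge0 // !mulr_ge0 // /B; lra.
pose t := (Num.min (Num.min d d1) (e / (D + 1))) / 2.
have D1 : 0 < D + 1 by lra.
have m0 : 0 < Num.min (Num.min d d1) (e / (D + 1)) by rewrite !lt_min d0 d10 divr_gt0.
have t0 : 0 < t by rewrite divr_gt0.
have [td td1 te] : [/\ t < d, t < d1 & t * (D + 1) < e].
  have : t < Num.min (Num.min d d1) (e / (D + 1)) by rewrite /t; lra.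
  by rewrite !lt_min => /andP[/andP[-> ->]]; rewrite ltr_pdivlMr.
have t1 : t < 1 by lra.
pose u w := b 0%N + b 1%N * w + b 2%N * (w * w).
have key w : nm w = t -> nm (u w) ^+ 2 <= nm (g (p + w)) ^+ 2 + D * t ^+ 3 /\
     nm (g (p + w)) ^+ 2 + e * nm (p + w - a) ^+ 2 <= F.
  move=> nw; have hw1 : square a r (p + w) by apply: Hsq; rewrite nw.
  have h1 := Hmax _ hw1; split; last exact: h1.
  have := HC w; rewrite nw => /(_ td); rewrite !big_ord_recr big_ord0 /= add0r expr0 mulr1 expr1 expr2 => h2.
  have h3 : nm (u w) <= nm (g (p + w)) + C * t ^+ 3.
    have : nm (u w) <= nm (g (p + w)) + nm (g (p + w) - u w).
      by apply: le_trans (nmB _ _); rewrite opprB addrC subrK.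
    move: h2; rewrite -/(u w); lra.
  have hB : nm (g (p + w)) <= B.
    rewrite leNgt; apply/negP => hB.
    have : B * B < nm (g (p + w)) ^+ 2 by rewrite expr2 ltr_pM //; rewrite /B; lra.
    have := mulr_ge0 (ltW e0) (exprn_ge0 2 (nm_ge0 (p + w - a))).
    have : B <= B * B by rewrite /B; nra.
    move: h1; rewrite -/F /B; lra.
  have := nm_ge0 (u w); have := nm_ge0 (g (p + w)) => g0 u0.
  apply: (@le_trans _ _ ((nm (g (p + w)) + C * t ^+ 3) ^+ 2)).
    by rewrite lerXn2r // nnegrE // (le_trans u0).
  have t30 : 0 <= t ^+ 3 by rewrite exprn_ge0 // ltW.
  have t31 : t ^+ 3 <= 1 by rewrite exprn_ile1 // ltW.
  have q1 : nm (g (p + w)) * C * t ^+ 3 <= B * C * t ^+ 3 by rewrite !ler_wpM2r.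
  have q2 : C ^+ 2 * t ^+ 3 * t ^+ 3 <= C ^+ 2 * t ^+ 3 * 1 by rewrite ler_wpM2l // mulr_ge0 // exprn_ge0.
  by rewrite /D; lra.
have nt : nm (t%:C : R[i]) = t by rewrite nm_real ger0_norm // ltW.
have [k1 l1] := key t%:C nt.
have [k2 l2] := key (0 +i* t) ltac:(by rewrite /= expr0n /= add0r sqrtr_sqr (ger0_norm (ltW t0))).
have [k3 l3] := key (- t%:C) ltac:(by rewrite nmN).
have [k4 l4] := key (0 -i* t) ltac:(by rewrite /= expr0n /= add0r sqrrN sqrtr_sqr (ger0_norm (ltW t0))).
have := parseval4 (b 0%N) (b 1%N) (b 2%N) t => /= pa; rewrite -!/(u _) in pa.
have E : nm (p + t%:C - a) ^+ 2 + nm (p + (0 +i* t) - a) ^+ 2 + nm (p - t%:C - a) ^+ 2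
    + nm (p + (0 -i* t) - a) ^+ 2 = 4 * nm (p - a) ^+ 2 + 4 * t ^+ 2.
  by rewrite !nm_sqr; case: (p) (a) => [x y] [x' y'] /=; ring.
have Ee := congr1 (fun x => e * x) E; rewrite /= in Ee.
have t20 : 0 < t ^+ 2 by rewrite exprn_gt0.
have f1 : 0 <= t ^+ 2 * nm (b 1%N) ^+ 2 by rewrite mulr_ge0 ?exprn_ge0 ?nm_ge0 ?ltW.
have f2 : 0 <= t ^+ 4 * nm (b 2%N) ^+ 2 by rewrite mulr_ge0 ?exprn_ge0 ?nm_ge0 ?ltW.
have f3 : e * t ^+ 2 <= D * t ^+ 3.
  rewrite b0 in pa; move: k1 k2 k3 k4 l1 l2 l3 l4 pa Ee f1 f2; rewrite /F.
  lra.
have f4 : t ^+ 3 * (D + 1) < e * t ^+ 2.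
  by rewrite exprSr -mulrA mulrC ltr_pM2r.
have f5 : 0 < t ^+ 3 by rewrite exprn_gt0.
lra.
Qed.

(** A maximum of [|g|^2 + e |z - a|^2] over the square lies either in the open disc of radius [r],
    which [no_interior_max] forbids, or off it, where [|g| <= m]. *)
Lemma max_principle g a (r m : R) : 0 < r ->
  (forall z, square a r z -> tay 3 g z) ->
  (forall z, square a r z -> r <= nm (z - a) -> nm (g z) <= m) -> nm (g a) <= m.
Proof.
move=> r0 T Hb.
pose z0 := a + r%:C.
have sq0 : square a r z0.
  rewrite /square /z0; case: (a) => x y /=; rewrite addr0 subrr normr0 addrAC subrr add0r ger0_norm ?(ltW r0) //.
have m0 : 0 <= m.
  apply: le_trans (nm_ge0 _) (Hb _ sq0 _); rewrite /z0 addrC addKr nm_real ger0_norm //; exact: ltW.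
rewrite leNgt; apply/negP => ma.
(* On the square [|z - a|^2 <= 2 r^2], so the added term makes up at most half of the gap between
   [|g a|^2] and [m^2]. *)
pose e := (nm (g a) ^+ 2 - m ^+ 2) / (4 * r ^+ 2).
have r2 : 0 < 4 * r ^+ 2 by rewrite mulr_gt0 // exprn_gt0.
have e0 : 0 < e.
  rewrite divr_gt0 // subr_gt0 ltrXn2r ?nnegrE ?nm_ge0 //.
pose K := `[complex.Re a - r, complex.Re a + r]%classic `*` `[complex.Im a - r, complex.Im a + r]%classic : set (R * R).
have KP q : K q <-> square a r (q.1 +i* q.2).
  by rewrite /K /square /= !in_itv /= !ler_distl.
pose f (q : R * R) : R := nm (g (q.1 +i* q.2)) ^+ 2 + e * nm ((q.1 +i* q.2) - a) ^+ 2.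
have cK : compact K by apply: compact_setX; exact: segment_compact.
have Ka : K (complex.Re a, complex.Im a).
  by apply/KP; rewrite /square /= !subrr normr0; split; exact: ltW.
have cf : {within K, continuous f}.
  apply: continuous_in_subspaceT => q; rewrite inE => /KP /T Tq.
  have c1 := nm_continuous2 (tay_weak (isT : (1 <= 3)%N) Tq).
  have c2 := @nm_continuous2 (fun z => z - a) q (tayD (tay_id 1 _) (tay_cst 1 (- a) _)).
  apply: cvgD; first exact: (cvgM c1 c1).
  apply: cvgM; first exact: cvg_cst.
  exact: (cvgM c2 c2).
have [q /set_mem Kq Hq] := compact_EVT_max (ex_intro _ _ Ka) cK cf.
set p := q.1 +i* q.2.
have Hmax z : square a r z -> nm (g z) ^+ 2 + e * nm (z - a) ^+ 2 <= nm (g p) ^+ 2 + e * nm (p - a) ^+ 2.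
  have Hq' (q' : R * R) : K q' -> f q' <= f q by move=> Kq'; apply: Hq; rewrite inE.
  by case: z => x y sz; have /Hq' : K (x, y) by apply/KP.
have sp : square a r p by apply/KP.
have pin : nm (p - a) < r.
  rewrite ltNge; apply/negP => rp; have gm := Hb _ sp rp.
  have := Hmax a; rewrite subrr nm0 expr0n mulr0 addr0 => /(_ _) h.
  have {h} : nm (g a) ^+ 2 <= nm (g p) ^+ 2 + e * nm (p - a) ^+ 2.
    by apply: h; rewrite /square !subrr normr0; split; exact: ltW.
  have : nm (p - a) ^+ 2 <= 2 * r ^+ 2.
    rewrite nm_sqr; move: sp => [].
    have E1 : complex.Re p - complex.Re a = complex.Re (p - a) by case: (p) (a) => ? ? [].
    have E2 : complex.Im p - complex.Im a = complex.Im (p - a) by case: (p) (a) => ? ? [].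
    rewrite E1 E2 -(@real_normK _ (complex.Re (p - a))) ?num_real // -(@real_normK _ (complex.Im (p - a))) ?num_real //.
    move=> s1 s2.
    have : `|complex.Re (p - a)| ^+ 2 <= r ^+ 2 by rewrite lerXn2r ?nnegrE ?normr_ge0 ?(ltW r0).
    have : `|complex.Im (p - a)| ^+ 2 <= r ^+ 2 by rewrite lerXn2r ?nnegrE ?normr_ge0 ?(ltW r0).
    lra.
  have : nm (g p) ^+ 2 <= m ^+ 2 by rewrite lerXn2r ?nnegrE ?nm_ge0.
  have E : e * (4 * r ^+ 2) = nm (g a) ^+ 2 - m ^+ 2 by rewrite mulfVK // lt0r_neq0.
  move=> h1 h2; have := ler_wpM2l (ltW e0) h2; have : 0 < e * r ^+ 2 by rewrite mulr_gt0 // exprn_gt0.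
  lra.
apply: (no_interior_max e0 (T _ sp) _ Hmax); apply: square_in.
  by apply: le_lt_trans pin; apply: le_trans (nm_Re _); case: (p) (a) => ? ? [].
by apply: le_lt_trans pin; apply: le_trans (nm_Im _); case: (p) (a) => ? ? [].
Qed.

(** The maximum principle is applied to the difference quotient at [a], completed by the derivative:
    off the disc it is at most [2 M / r]. Dividing the expansion of [h] at [a] by [w] costs one
    order, hence [tay 4] for the required [tay 3]. *)
Lemma cauchy_estimate h a (r M : R) : 0 < r ->
  (forall z, square a r z -> tay 4 h z) ->
  (forall z, square a r z -> nm (h z) <= M) -> nm (dtau_scalar h a) <= 2 * M / r.
Proof.
move=> r0 T HM.
have sa : square a r a by rewrite /square !subrr normr0; split; exact: ltW.
have W := tay_wdiff (tay_weak (isT : (2 <= 4)%N) (T _ sa)).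
pose g z := if z == a then dtau_scalar h a else (h z - h a) / (z - a).
have -> : dtau_scalar h a = g a by rewrite /g eqxx.
apply: (max_principle r0) => z sz.
  case: (eqVneq z a) => [->|za]; last first.
    apply: (@tay_near _ _ (fun z => (h z - h a) * (z - a)^-1)).
      have : 0 < nm (z - a) by rewrite nm_gt0 subr_eq0.
      move=> zp; exists (nm (z - a)) => // w hw; rewrite /g; case: eqP => // E.
      by move: hw; rewrite -E opprD addNKr nmN ltxx.
    apply: tayM; first by apply: tayD; [exact: tay_weak (T _ sz)|exact: tay_cst].
    apply: tayV; first by rewrite subr_eq0.
    by apply: tayD; [exact: tay_id|exact: tay_cst].
  have [P H] := T _ sa; have P0 := tay_at0 H.
  have /factor_theorem[Q EQ] : root (P - (h a)%:P) 0.
    by apply/rootP; rewrite hornerD hornerN hornerC P0 subrr.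
  have PE w : P.[w] = h a + Q.[w] * w.
    by rewrite -[P](subrK (h a)%:P) EQ hornerD hornerM hornerXsubC subr0 hornerC addrC.
  have Q0 : Q.[0] = dtau_scalar h a.
    symmetry; apply: wdiff_dtau; apply: hdiff_wdiff.
    have /factor_theorem[Q2 E2] : root (Q - (Q.[0])%:P) 0.
      by apply/rootP; rewrite hornerD hornerN hornerC subrr.
    have QE w : Q.[w] = Q.[0] + Q2.[w] * w.
      by rewrite -{1}[Q](subrK (Q.[0])%:P) E2 hornerD hornerM hornerXsubC subr0 hornerC addrC.
    have := bigOD (@bigO_weak _ 4 2 _ isT H) (bigOM (bigO_horner Q2) (bigO_Xn R 2)).
    by apply: bigO_ext => w; rewrite PE QE; ring.
  exists Q; move: H => [C [d [d0 H]]]; exists C, d; split=> // w hw.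
  case: (eqVneq w 0) => [->|w0].
    by rewrite addr0 /g eqxx Q0 subrr nm0 expr0n mulr0.
  rewrite /g -subr_eq0 (addrC a) addrK (negbTE w0) addrC.
  have nw : 0 < nm w by rewrite nm_gt0.
  rewrite -(ler_pM2r nw) -nmM -mulrA -exprSr; apply: le_trans (H _ hw).
  rewrite PE le_eqVlt; apply/orP; left; apply/eqP; congr nm.
  by rewrite (addrC a); field.
move=> rz; have za : z != a.
  by rewrite -subr_eq0 -nm_gt0; exact: lt_le_trans rz.
rewrite /g (negbTE za) nmM nmV.
have M0 : 0 <= M := le_trans (nm_ge0 _) (HM _ sa).
apply: ler_pM; rewrite ?nm_ge0 ?invr_ge0 ?nm_ge0 //.
  apply: le_trans (nmB _ _) _; have := HM _ sz; have := HM _ sa; lra.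
by rewrite lef_pV2 ?posrE // (lt_le_trans r0).
Qed.

End CauchyEstimate.

(** * Moebius maps and the automorphy factor *)

Section Mobius.
Variable R : realType.
Implicit Types (s g : 'M[R]_2) (z w : R[i]).

Lemma det2 s : \det s = s 0 0 * s 1 1 - s 0 1 * s 1 0.
Proof.
rewrite (expand_det_row _ 0) !big_ord_recl big_ord0 /= addr0 /cofactor !det_mx11 !mxE /=.
rewrite addn0 expr0 mul1r /bump /= expr1 mulN1r mulrN.
by congr (s 0 _ * s _ _ - s 0 _ * s _ _); apply/val_inj.
Qed.

Lemma ReImD z w : (complex.Re (z + w) = complex.Re z + complex.Re w) *
  (complex.Im (z + w) = complex.Im z + complex.Im w).
Proof. by case: z w => [a b] [c d]. Qed.

Lemma Re_autj s z : complex.Re (autj s z) = s 1 0 * complex.Re z + s 1 1.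
Proof. by rewrite /autj; case: z => a b /=; rewrite mul0r subr0. Qed.

Lemma Im_autj s z : complex.Im (autj s z) = s 1 0 * complex.Im z.
Proof. by rewrite /autj; case: z => a b /=; rewrite mul0r !addr0. Qed.

Lemma autj_neq0 s z : \det s = 1 -> upper_half_plane z -> autj s z != 0.
Proof.
rewrite det2 /upper_half_plane /= => ds z0; apply/eqP => E.
have := Im_autj s z; rewrite E /= => /esym/eqP; rewrite mulf_eq0 (gt_eqF z0) orbF => /eqP c0.
have := Re_autj s z; rewrite E /= c0 mul0r add0r => /esym d0.
by move: ds; rewrite c0 d0 !mulr0 subrr => /esym/eqP; rewrite oner_eq0.
Qed.

Lemma Im_mobius s z : \det s = 1 ->
  complex.Im (mobius s z) = complex.Im z / nm (autj s z) ^+ 2.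
Proof.
rewrite det2 => ds; rewrite nm_sqr /mobius /autj.
case: z => x y /=; rewrite !(mul0r, mulr0, subr0, addr0).
set D := _ ^+ 2 + _ ^+ 2.
transitivity ((s 0 0 * s 1 1 - s 0 1 * s 1 0) * y / D); last by rewrite ds mul1r.
by ring.
Qed.

Lemma mobius_upper s z : \det s = 1 -> upper_half_plane z -> upper_half_plane (mobius s z).
Proof.
move=> ds z0; rewrite /upper_half_plane /= Im_mobius // divr_gt0 //.
by rewrite exprn_gt0 // nm_gt0 autj_neq0.
Qed.

Lemma upper_near z : upper_half_plane z -> cnear z upper_half_plane.
Proof.
move=> z0; exists (complex.Im z) => // w hw; rewrite /upper_half_plane /= ReImD.
have := nm_Im w; rewrite ler_norml => /andP[]; move: hw; lra.
Qed.

Lemma tay_affine N (p q : R[i]) z : tay N (fun w => p * w + q) z.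
Proof.
by apply: tayD; [apply: tayM; [exact: tay_cst|exact: tay_id]|exact: tay_cst].
Qed.

Lemma tay_autj N s z : tay N (autj s) z.
Proof. exact: tay_affine. Qed.

Lemma tay_mobius N s z : \det s = 1 -> upper_half_plane z -> tay N.+1 (mobius s) z.
Proof.
move=> ds z0; apply: tayM; first exact: tay_affine.
by apply: tayV; [exact: autj_neq0|exact: tay_affine].
Qed.

Lemma tay_autjz N s z (m : int) : \det s = 1 -> upper_half_plane z ->
  tay N.+1 (fun w => autj s w ^ m) z.
Proof.
move=> ds z0; case: m => m; first by apply: tayX; exact: tay_autj.
by apply: tayV; [rewrite expf_neq0 // autj_neq0|apply: tayX; exact: tay_autj].
Qed.

Lemma wdiff_affine (p q : R[i]) z : wdiff (fun w => p * w + q) z p.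
Proof.
have := wdiffD (wdiffZ p (wdiff_id z)) (wdiff_cst q z).
by rewrite mulr1 addr0.
Qed.

Lemma wdiff_autj s z : wdiff (autj s) z (autj' s).
Proof. exact: wdiff_affine. Qed.

Lemma hdiff_mobius s z : \det s = 1 -> upper_half_plane z ->
  hdiff (mobius s) z (autj s z ^- 2).
Proof.
move=> ds z0; have [al Hal] := tay_hdiff (tay_mobius 1 ds z0).
have j0 := autj_neq0 ds z0.
suff -> : autj s z ^- 2 = al by [].
apply: wdiff_unique (hdiff_wdiff Hal).
have := wdiffM (wdiff_affine (s 0 0)%:C (s 0 1)%:C z) (wdiffV j0 (wdiff_autj s z)).
congr wdiff; have : (s 0 0)%:C * (s 1 1)%:C - (s 0 1)%:C * (s 1 0)%:C = 1 :> R[i].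
  by rewrite -!rmorphM -rmorphB -det2 ds.
move: j0; rewrite /autj /autj' => j0 D.
rewrite -[RHS]mul1r -{}D; field; exact: j0.
Qed.

Lemma wdiff_autjz s z (m : int) : \det s = 1 -> upper_half_plane z ->
  wdiff (fun w => autj s w ^ m) z (m%:~R * autj' s * autj s z ^ (m - 1)).
Proof.
move=> ds z0; have j0 := autj_neq0 ds z0; have J := wdiff_autj s z.
case: m => m.
  have := wdiffX m J; congr wdiff; case: m => [|m]; first by rewrite !mul0r.
  by rewrite (_ : m.+1%:Z - 1 = m) //; lia.
have := @wdiffV _ (fun w => autj s w ^+ m.+1) z _ (expf_neq0 m.+1 j0) (wdiffX m.+1 J); congr wdiff.
rewrite NegzE (_ : - m.+1%:Z - 1 = Negz m.+1); last by lia.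
rewrite mulrNz /exprz -[m.+1.-1]/m -[(m.+1)%:~R]/(m.+1%:R) !exprS; field.
by rewrite expf_neq0.
Qed.

(** The anomaly [-j'/j] of the automorphy factor. It solves [x' = x^2], so derivatives of its powers
    are multiples of its powers; [X = - xj] is the point [c / (c z + d)] of the transformation
    law. *)
Definition xj s z : R[i] := - autj' s / autj s z.

Lemma wdiff_xj s z : \det s = 1 -> upper_half_plane z -> wdiff (xj s) z (xj s z ^+ 2).
Proof.
move=> ds z0; have j0 := autj_neq0 ds z0.
have := wdiffZ (- autj' s) (wdiffV j0 (wdiff_autj s z)); congr wdiff.
by rewrite /xj; field.
Qed.

Lemma tay_xj N s z : \det s = 1 -> upper_half_plane z -> tay N.+1 (xj s) z.
Proof.
move=> ds z0; apply: tayM; first exact: tay_cst.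
by apply: tayV; [exact: autj_neq0|exact: tay_autj].
Qed.

End Mobius.

(** * Families of components and their derivation under the slash *)

Section Families.
Variable R : realType.
Implicit Types (F G : nat -> R[i] -> R[i]) (s : 'M[R]_2) (k : int) (z w : R[i]).

(* On generating functions [A = \sum_r F_r X^r] of degree at most [d] this is
   the operator [d/dtau + d X - X^2 d/dX]; in the variable [u = 1/X] it acts on
   [u^d A] as the derivation [d/dtau + d/du]. *)
Definition sdl (d : nat) F (t : nat) : R[i] -> R[i] :=
  if t is t'.+1 then fun z => dtau_scalar (F t) z + (d%:R - t'%:R) * F t' z
  else dtau_scalar (F 0%N).

(** The scalar form of [at_cusp]; the binomial coefficient vanishes for [r < t], which replaces the
    side condition of that sum. *)
Definition scusp s k (d : nat) F (t : nat) z : R[i] :=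
  \sum_(r < d.+1) ('C(r, t)%:R * (- autj' s) ^+ (r - t) * autj s z ^ (r%:Z + t%:Z - k))
    * F r (mobius s z).

(** This is what the algebra takes from analyticity: every iterate of [sdl] can be differentiated
    once more at the point. *)
Definition sregular (d : nat) F z : Prop := forall j r, (r <= d)%N ->
  wdiff (iter j (sdl d) F r) z (dtau_scalar (iter j (sdl d) F r) z).

Definition sprev (d : nat) F (t : nat) z : R[i] :=
  if t is t'.+1 then (d%:R - t'%:R) * F t' z else 0.

Lemma sdlE d F t z : sdl d F t z = dtau_scalar (F t) z + sprev d F t z.
Proof. by case: t => [|t] //=; rewrite addr0. Qed.

Lemma scusp_wdiff s k d F t z : \det s = 1 -> upper_half_plane z ->
  (forall r, (r <= d)%N -> wdiff (F r) (mobius s z) (dtau_scalar (F r) (mobius s z))) ->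
  wdiff (scusp s k d F t) z
    (\sum_(r < d.+1) 'C(r, t)%:R * (- autj' s) ^+ (r - t) *
      ((r%:Z + t%:Z - k)%:~R * autj' s * autj s z ^ (r%:Z + t%:Z - k - 1) * F r (mobius s z)
       + autj s z ^ (r%:Z + t%:Z - k) * (dtau_scalar (F r) (mobius s z) * autj s z ^- 2))).
Proof.
move=> ds z0 H; apply: wdiff_sum => r _.
have W := wdiffM (wdiff_autjz (r%:Z + t%:Z - k) ds z0)
  (wdiff_comp (H r (ltn_ord r)) (hdiff_mobius ds z0)).
by apply: wdiff_ext (wdiffZ ('C(r, t)%:R * (- autj' s) ^+ (r - t)) W) => w; rewrite mulrA.
Qed.

Lemma step_coef (c : R[i]) (r t d : nat) k :
  'C(r, t)%:R * (- c) ^+ (r - t) * ((r%:Z + t%:Z - k)%:~R * c)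
  + (if t is t'.+1 then (d%:R - t'%:R) * ('C(r, t')%:R * (- c) ^+ (r - t')) else 0)
  = 'C(r.+1, t)%:R * (- c) ^+ (r.+1 - t) * (d%:R - r%:R)
    + (k - d%:Z)%:~R * (- c) * ('C(r, t)%:R * (- c) ^+ (r - t)) :> R[i].
Proof.
rewrite !intrD !mulrNz -!pmulrn.
case: t => [|t].
  by rewrite !bin0 !subn0 exprS; ring.
case: (ltngtP r t) => h.
- by rewrite (@bin_small r t) // (@bin_small r t.+1) 1?(@bin_small r.+1 t.+1) //; [ring|lia].
- have -> : (r.+1 - t.+1 = r - t)%N by [].
  have -> : (r - t = (r - t.+1).+1)%N by lia.
  rewrite exprS binS natrD -!natr1.
  have : (t%:R + 1) * 'C(r, t.+1)%:R = (r%:R - t%:R) * 'C(r, t)%:R :> R[i].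
    by rewrite natr1 -natrB ?(ltnW h) // -!natrM mul_bin_left.
  move: ('C(r, t.+1)%:R) ('C(r, t)%:R) => A B E.
  set x := (- c) ^+ _.
  apply/eqP; rewrite -subr_eq0; apply/eqP.
  transitivity (c * x * ((t%:R + 1) * A - (r%:R - t%:R) * B)); first by ring.
  by rewrite E subrr mulr0.
- by rewrite h !binn (@bin_small t t.+1) // !subnn; ring.
Qed.

(** Differentiating the power of [autj] contributes [k xj], and moving the term [d X] of [sdl]
    across the slash takes away [d xj]. What remains is the rule for a modular form of weight
    [k - d]. *)
Lemma sdl_scusp s k d F t z : \det s = 1 -> upper_half_plane z ->
  (forall r, (r <= d)%N -> wdiff (F r) (mobius s z) (dtau_scalar (F r) (mobius s z))) ->
  sdl d (scusp s k d F) t z = scusp s (k + 2) d (sdl d F) t z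
    + ((k - d%:Z)%:~R * xj s z) * scusp s k d F t z.
Proof.
move=> ds z0 H; rewrite sdlE (wdiff_dtau (scusp_wdiff k t ds z0 H)).
have j0 := autj_neq0 ds z0; set c := autj' s; set j := autj s z.
have prevE : sprev d (scusp s k d F) t z = \sum_(r < d.+1)
   (if t is t'.+1 then (d%:R - t'%:R) * ('C(r, t')%:R * (- c) ^+ (r - t')) else 0)
   * j ^ (r%:Z + t%:Z - k - 1) * F r (mobius s z).
  case: t => [|t] /=; first by rewrite big1 // => r _; rewrite !mul0r.
  rewrite /scusp mulr_sumr; apply: eq_bigr => r _.
  have -> : r%:Z + t%:Z - k = r%:Z + t.+1%:Z - k - 1 by lia.
  by rewrite !mulrA.
have nextE : scusp s (k + 2) d (sdl d F) t z =
    \sum_(r < d.+1) 'C(r, t)%:R * (- c) ^+ (r - t) * (j ^ (r%:Z + t%:Z - k) * (dtau_scalar (F r) (mobius s z) * j ^- 2))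
    + \sum_(r < d.+1) 'C(r.+1, t)%:R * (- c) ^+ (r.+1 - t) * (d%:R - r%:R) * j ^ (r%:Z + t%:Z - k - 1) * F r (mobius s z).
  rewrite [in X in _ = _ + X]big_ord_recr /= subrr !(mulr0, mul0r) addr0.
  pose a (r : nat) := 'C(r, t)%:R * (- c) ^+ (r - t) * j ^ (r%:Z + t%:Z - (k + 2)).
  transitivity (\sum_(r < d.+1) (a r * dtau_scalar (F r) (mobius s z) + a r * sprev d F r (mobius s z))).
    by apply: eq_bigr => r _; rewrite sdlE mulrDr.
  rewrite big_split /= /a; congr (_ + _).
    apply: eq_bigr => r _; move: (dtau_scalar (F r) (mobius s z)) => D.
    have -> : r%:Z + t%:Z - (k + 2) = (r%:Z + t%:Z - k) + (- 2%:Z) by lia.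
    by rewrite expfzDr // (_ : j ^ (- 2%:Z) = j ^- 2) //; ring.
  rewrite big_ord_recl /= mulr0 add0r; apply: eq_bigr => r _; rewrite /bump /= add1n.
  have -> : r.+1%:Z + t%:Z - (k + 2) = r%:Z + t%:Z - k - 1 by lia.
  by ring.
rewrite prevE nextE /scusp mulr_sumr -big_split /= -!big_split /=.
apply: eq_bigr => r _.
have Ej : j ^ (r%:Z + t%:Z - k) = j ^ (r%:Z + t%:Z - k - 1) * j.
  by have := expfzDr (r%:Z + t%:Z - k - 1) 1 j0; rewrite expr1z subrK.
have := step_coef c r t d k; set A := (if _ is _.+1 then _ else _) => E.
rewrite -/c -/j /xj -/c -/j.
have -> : (k - d%:Z)%:~R * (- c / j) * ('C(r, t)%:R * (- c) ^+ (r - t) * j ^ (r%:Z + t%:Z - k) * F r (mobius s z))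
  = (k - d%:Z)%:~R * (- c) * ('C(r, t)%:R * (- c) ^+ (r - t)) * j ^ (r%:Z + t%:Z - k - 1) * F r (mobius s z).
  by rewrite Ej; field.
move: E; set P1 := 'C(r, t)%:R * _; set P2 := 'C(r.+1, t)%:R * _ * _; set P3 := (k - d%:Z)%:~R * _ * _.
set I := (_ + _ - k)%:~R => E.
transitivity ((P1 * (I * c) + A) * j ^ (r%:Z + t%:Z - k - 1) * F r (mobius s z)
  + P1 * (j ^ (r%:Z + t%:Z - k) * (dtau_scalar (F r) (mobius s z) * j ^- 2))); first by ring.
by rewrite E; ring.
Qed.

(** The coefficients of the classical formula for the [r]-th derivative of a slashed form of weight
    [kap]: [cf kap r j x^(r-j)] multiplies the [j]-th derivative, slashed in weight [kap + 2j]. *)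
Definition cf (kap : int) (r j : nat) : R[i] :=
  'C(r, j)%:R * \prod_(j <= i < r) (kap + i%:Z)%:~R.

(** Differentiating [x^(r-j)] brings [r - j] since [x' = x^2], and the anomaly in weight [kap + 2j]
    brings [kap + 2j]; the factor [kap + r + j] is their sum. *)
Lemma cf_rec kap r j : (j <= r.+1)%N ->
  cf kap r.+1 j = cf kap r j * (kap + r%:Z + j%:Z)%:~R + (if j is j'.+1 then cf kap r j' else 0).
Proof.
rewrite /cf; case: j => [_|j jr].
  by rewrite !bin0 big_nat_recr //= !mul1r addr0 addr0.
case: (ltnP j r) => [{}jr|rj]; last first.
  have -> : j = r by lia.
  by rewrite binn bin_small // !big_geq // !mul0r add0r binn.
rewrite big_nat_recr //= [in X in _ = _ + X]big_ltn // binS natrD !intrD -!pmulrn -!natr1.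
have : (j%:R + 1) * 'C(r, j.+1)%:R = (r%:R - j%:R) * 'C(r, j)%:R :> R[i].
  by rewrite natr1 -natrB ?(ltnW jr) // -!natrM mul_bin_left.
move: ('C(r, j.+1)%:R) ('C(r, j)%:R) (\prod_(j.+1 <= i < r) _) => A B P E.
apply/eqP; rewrite -subr_eq0; apply/eqP.
transitivity (- P * ((j%:R + 1) * A - (r%:R - j%:R) * B)); first by ring.
by rewrite E subrr mulr0.
Qed.

Section IterCusp.
Variables (s : 'M[R]_2) (k : int) (d : nat) (F : nat -> R[i] -> R[i]).
Variable U : R[i] -> Prop.
Hypothesis ds : \det s = 1.
Hypothesis Uopen : forall z, U z -> cnear z U.
Hypothesis Ureg : forall z, U z -> upper_half_plane z /\ sregular d F (mobius s z).

Definition tcusp (j t : nat) z := scusp s (k + (2 * j)%:Z) d (iter j (sdl d) F) t z.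

Lemma tcusp_wdiff j t z : U z -> wdiff (tcusp j t) z (dtau_scalar (tcusp j t) z).
Proof.
move=> /Ureg[z0 H]; have W := scusp_wdiff (k + (2 * j)%:Z) t ds z0 (H j).
by rewrite (wdiff_dtau W).
Qed.

Lemma tcusp_step j t z : U z ->
  sdl d (tcusp j) t z = tcusp j.+1 t z + ((k - d%:Z + (2 * j)%:Z)%:~R * xj s z) * tcusp j t z.
Proof.
move=> /Ureg[z0 H]; rewrite (sdl_scusp (k + (2 * j)%:Z) t ds z0 (H j)) /tcusp.
by rewrite (_ : k + (2 * j)%:Z + 2 = k + (2 * j.+1)%:Z) 1?(_ : k + (2 * j)%:Z - d%:Z = k - d%:Z + (2 * j)%:Z); lia || by [].
Qed.

(** Induction on [r]. The formula of the previous step is itself differentiated, hence the open set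
    [U] on which it holds at every point. *)
Lemma iter_scusp r t z : (t <= d)%N -> U z -> iter r (sdl d) (scusp s k d F) t z =
    \sum_(j < r.+1) cf (k - d%:Z) r j * xj s z ^+ (r - j) * tcusp j t z.
Proof.
elim: r t z => [|r IH] t z td Uz.
  by rewrite big_ord1 /cf binn big_geq // !mul1r /tcusp muln0 addr0.
have [z0 _] := Ureg Uz; rewrite iterS.
set G := iter r (sdl d) (scusp s k d F).
have W : wdiff (G t) z (\sum_(j < r.+1) cf (k - d%:Z) r j *
    ((r - j)%:R * xj s z ^+ (r - j).+1 * tcusp j t z + xj s z ^+ (r - j) * dtau_scalar (tcusp j t) z)).
  apply: (@wdiff_near _ (fun w => \sum_(j < r.+1) cf (k - d%:Z) r j * xj s w ^+ (r - j) * tcusp j t w)).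
    by apply: cnear_sub (Uopen Uz) => w Uw; rewrite /G IH.
  apply: wdiff_sum => j _.
  have := wdiffZ (cf (k - d%:Z) r j) (wdiffM (wdiffX (r - j) (wdiff_xj ds z0)) (tcusp_wdiff j t Uz)).
  have -> : (r - j)%:R * xj s z ^+ 2 * xj s z ^+ (r - j).-1 = (r - j)%:R * xj s z ^+ (r - j).+1.
    by case: (r - j)%N => [|m]; rewrite ?mul0r //= -mulrA -exprD.
  by apply: wdiff_ext => w; rewrite mulrA.
rewrite sdlE (wdiff_dtau W).
have -> : sprev d G t z = \sum_(j < r.+1) cf (k - d%:Z) r j * (xj s z ^+ (r - j) * sprev d (tcusp j) t z).
  case: t td {W} => [|t] td /=; first by rewrite big1 // => j _; rewrite !mulr0.
  by rewrite /G IH ?(ltnW td) // mulr_sumr; apply: eq_bigr => j _; ring.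
rewrite -big_split /=.
transitivity (\sum_(j < r.+1) (cf (k - d%:Z) r j * (k - d%:Z + r%:Z + j%:Z)%:~R * xj s z ^+ (r.+1 - j) * tcusp j t z
   + cf (k - d%:Z) r j * xj s z ^+ (r - j) * tcusp j.+1 t z)).
  apply: eq_bigr => j _; have jr : (j <= r)%N by have := ltn_ord j.
  have := tcusp_step j t Uz; rewrite sdlE => E.
  have -> : (r.+1 - j = (r - j).+1)%N by lia.
  transitivity (cf (k - d%:Z) r j * ((r - j)%:R * xj s z ^+ (r - j).+1 * tcusp j t z
     + xj s z ^+ (r - j) * (dtau_scalar (tcusp j t) z + sprev d (tcusp j) t z))); first by ring.
  rewrite E !intrD -!pmulrn natrB // natrM exprS; ring.
rewrite big_split /= [RHS](_ : _ = \sum_(j < r.+2)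
   (cf (k - d%:Z) r j * (k - d%:Z + r%:Z + j%:Z)%:~R * xj s z ^+ (r.+1 - j) * tcusp j t z
    + (if (j : nat) is j'.+1 then cf (k - d%:Z) r j' else 0) * xj s z ^+ (r.+1 - j) * tcusp j t z)); last first.
  apply: eq_bigr => j _; rewrite cf_rec; last by have := ltn_ord j.
  by rewrite !mulrDl.
rewrite big_split /=; congr (_ + _).
  by rewrite [RHS]big_ord_recr /= /cf bin_small // !mul0r addr0.
by rewrite [RHS]big_ord_recl /= !mul0r add0r.
Qed.

Lemma iter_scusp_sregular z : U z -> sregular d (scusp s k d F) z.
Proof.
move=> Uz r t td; have [z0 _] := Ureg Uz.
have [al W] : exists al, wdiff (fun w => \sum_(j < r.+1) cf (k - d%:Z) r j * xj s w ^+ (r - j) * tcusp j t w) z al.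
  eexists; apply: wdiff_sum => j _; apply: wdiffM; last exact: tcusp_wdiff.
  by apply: wdiffZ; apply: wdiffX; exact: wdiff_xj.
have {W} W : wdiff (iter r (sdl d) (scusp s k d F) t) z al.
  apply: wdiff_near W; apply: cnear_sub (Uopen Uz) => w Uw.
  by rewrite iter_scusp.
by rewrite (wdiff_dtau W).
Qed.

End IterCusp.

End Families.

(** * The Rankin-Cohen identity on coefficients *)

Section RankinCohenAlgebra.
Variable R : realType.
Local Notation cf := (@cf R).

(** Both sides are [n! / (j! (r-j)! i! (n-r-i)!)]. *)
Lemma bin_trinomial (n r j i : nat) : (j <= r)%N -> (r + i <= n)%N ->
  'C(n, r)%:R * 'C(r, j)%:R * 'C(n - r, i)%:R =
  'C(n, j)%:R * 'C(n - j, i)%:R * 'C(n - j - i, r - j)%:R :> R.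
Proof.
move=> jr rin.
have b1 := @bin_fact n r ltac:(lia); have b2 := @bin_fact r j jr.
have b3 := @bin_fact (n - r) i ltac:(lia); have b4 := @bin_fact n j ltac:(lia).
have b5 := @bin_fact (n - j) i ltac:(lia).
have b6 := @bin_fact (n - j - i) (r - j) ltac:(lia).
have E : (n - j - i - (r - j) = n - r - i)%N by lia.
rewrite E in b6.
have toR : forall a b c e : nat, (a * (b * c) = e)%N -> a%:R * (b%:R * c%:R) = e%:R :> R.
  by move=> a b c f <-; rewrite !natrM.
move/toR: b1 => b1; move/toR: b2 => b2; move/toR: b3 => b3.
move/toR: b4 => b4; move/toR: b5 => b5; move/toR: b6 => b6.
have f0 (m : nat) : (m`!%:R : R) != 0 by rewrite pnatr_eq0 -lt0n fact_gt0.
have P0 : j`!%:R * (r - j)`!%:R * (i`!%:R * (n - r - i)`!%:R) != 0 :> R by rewrite !mulf_neq0.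
apply: (mulIf P0).
transitivity ('C(n, r)%:R * (('C(r, j)%:R * (j`!%:R * (r - j)`!%:R)) *
   ('C(n - r, i)%:R * (i`!%:R * (n - r - i)`!%:R))) : R); first by ring.
rewrite b2 b3 b1 -b4 -b5 -b6; ring.
Qed.

Lemma alternating_bin (N : nat) :
  \sum_(s < N.+1) (-1) ^+ s * 'C(N, s)%:R = (N == 0%N)%:R :> R.
Proof.
transitivity ((1 - 1 : R) ^+ N); last by rewrite subrr expr0n.
rewrite exprDn; apply: eq_bigr => s _.
by rewrite expr1n mul1r mulr_natr.
Qed.

(** By [bin_trinomial] the sum is a multiple of the alternating sum of the binomials of order
    [n - j - i], which vanishes unless this order is 0. *)
Lemma alternating_trinomial (n j i : nat) : (j + i <= n)%N ->
  \sum_(r < n.+1) (-1) ^+ r * ('C(n, r)%:R * 'C(r, j)%:R * 'C(n - r, i)%:R) =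
  (if (j + i == n)%N then (-1) ^+ j * 'C(n, j)%:R else 0) :> R.
Proof.
move=> jin; pose f r : R := (-1) ^+ r * ('C(n, r)%:R * 'C(r, j)%:R * 'C(n - r, i)%:R).
rewrite -(big_mkord xpredT f) (@big_cat_nat _ _ _ j) //=; last by lia.
rewrite big_nat_cond big1 ?add0r; last first.
  by move=> r /andP[/andP[_ rj] _]; rewrite /f (@bin_small r j) // mulr0 mul0r mulr0.
rewrite (@big_cat_nat _ _ _ (n - i).+1) //=; [|lia|lia].
rewrite [X in _ + X]big_nat_cond [X in _ + X]big1 ?addr0; last first.
  move=> r /andP[/andP[rj rn] _]; rewrite /f (@bin_small (n - r) i) ?mulr0 //; lia.
rewrite -{1}[j]add0n big_addn (_ : (n - i).+1 - j = (n - j - i).+1)%N; last by lia.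
transitivity (\sum_(0 <= s < (n - j - i).+1) (-1) ^+ j * ('C(n, j)%:R * 'C(n - j, i)%:R) *
    ((-1) ^+ s * 'C(n - j - i, s)%:R) : R).
  apply: eq_big_nat => s /andP[_ hs]; rewrite /f bin_trinomial; [|lia|lia].
  by rewrite addnK exprD; ring.
rewrite -mulr_sumr big_mkord alternating_bin.
case: ifP => [/eqP E|E].
  have -> : (n - j - i = 0)%N by lia.
  by rewrite (_ : (n - j = i)%N) ?binn ?eqxx ?mulr1 //; lia.
by rewrite (_ : (n - j - i == 0)%N = false) ?mulr0 //; lia.
Qed.

Definition rcc (kap lam : int) (n r : nat) : R[i] :=
  (-1) ^+ r * 'C(n, r)%:R * (\prod_(r <= j < n) (kap + j%:Z)%:~R)
    * (\prod_(n - r <= q < n) (lam + q%:Z)%:~R).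

Lemma rc_coefE k l d e n (r : 'I_n.+1) :
  (rc_coef k l d e n : 'rV[R[i]]_n.+1) 0 r = rcc (k - d%:Z) (l - e%:Z) n r.
Proof. by rewrite mxE. Qed.

Lemma cf_small kap r j : (r < j)%N -> cf kap r j = 0.
Proof. by move=> h; rewrite /cf bin_small // mul0r. Qed.

Lemma cf_sum_widen kap r n (x : R[i]) (t : nat -> R[i]) : (r <= n)%N ->
  \sum_(j < r.+1) cf kap r j * x ^+ (r - j) * t j =
  \sum_(j < n.+1) cf kap r j * x ^+ (r - j) * t j.
Proof.
move=> rn; rewrite (big_ord_widen n.+1 (fun j => cf kap r j * x ^+ (r - j) * t j)) //.
rewrite big_mkcond; apply: eq_bigr => j _; case: ifP => // h.
by rewrite cf_small ?mul0r //; move: h; lia.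
Qed.

(** The products in [rcc] and [cf] join into those of [kap + a] over [j <= a < n] and of [lam + a]
    over [i <= a < n], independent of [r]; an alternating sum of binomials remains. This explains
    the shape of the coefficients. *)
Lemma rc_term kap lam n (x : R[i]) j i : (j <= n)%N -> (i <= n)%N ->
  \sum_(r < n.+1) rcc kap lam n r * (cf kap r j * x ^+ (r - j)) *
     (cf lam (n - r) i * x ^+ (n - r - i)) =
  (if (j + i == n)%N then rcc kap lam n j else 0).
Proof.
move=> jn in'.
case: (leqP (j + i) n) => [jin|jin]; last first.
  rewrite ifF; last by lia.
  rewrite big1 // => r _; case: (ltnP r j) => h; first by rewrite (cf_small _ h) !(mul0r, mulr0).
  by rewrite (@cf_small lam) ?mul0r ?mulr0 //; lia.
pose K : R[i] := \prod_(j <= a < n) (kap + a%:Z)%:~R.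
pose L : R[i] := \prod_(i <= a < n) (lam + a%:Z)%:~R.
transitivity (\sum_(r < n.+1) (K * L * x ^+ (n - j - i)) *
    ((-1) ^+ r * ('C(n, r)%:R * 'C(r, j)%:R * 'C(n - r, i)%:R))%:C).
  apply: eq_bigr => r _; rewrite /rcc /cf.
  case: (ltnP r j) => h1; first by rewrite (bin_small h1) !(mul0r, mulr0).
  case: (ltnP (n - r) i) => h2; first by rewrite (bin_small h2) !(mul0r, mulr0).
  have rn : (r <= n)%N by have := ltn_ord r.
  have KE : K = (\prod_(j <= a < r) (kap + a%:Z)%:~R) * \prod_(r <= a < n) (kap + a%:Z)%:~R.
    by rewrite /K (@big_cat_nat _ _ _ r).
  have LE : L = (\prod_(i <= a < n - r) (lam + a%:Z)%:~R) * \prod_(n - r <= a < n) (lam + a%:Z)%:~R.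
    by rewrite /L (@big_cat_nat _ _ _ (n - r)) ?leq_subr.
  rewrite KE LE.
  rewrite (_ : n - j - i = (r - j) + (n - r - i))%N; last by lia.
  rewrite exprD !rmorphM rmorphXn rmorphN1 !rmorph_nat; ring.
rewrite -mulr_sumr -rmorph_sum /= alternating_trinomial //.
case: ifP => [/eqP E|_]; last by rewrite mulr0.
have -> : (n - j - i = 0)%N by lia.
have Ei : i = (n - j)%N by lia.
rewrite /K /L Ei expr0 /rcc rmorphM rmorphXn rmorphN1 rmorph_nat; ring.
Qed.

(** With [t j] and [t' i] the slashed derivatives of the two forms, every positive power of the
    anomaly [x] cancels, and the bracket becomes covariant. *)
Lemma rc_sum kap lam n (x : R[i]) (t t' : nat -> R[i]) :
  \sum_(r < n.+1) rcc kap lam n r *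
    (\sum_(j < r.+1) cf kap r j * x ^+ (r - j) * t j) *
    (\sum_(i < (n - r).+1) cf lam (n - r) i * x ^+ (n - r - i) * t' i) =
  \sum_(j < n.+1) rcc kap lam n j * t j * t' (n - j)%N.
Proof.
transitivity (\sum_(r < n.+1) \sum_(j < n.+1) \sum_(i < n.+1)
   (rcc kap lam n r * (cf kap r j * x ^+ (r - j)) * (cf lam (n - r) i * x ^+ (n - r - i))) * (t j * t' i)).
  apply: eq_bigr => r _; have rn : (r <= n)%N by have := ltn_ord r.
  rewrite (cf_sum_widen _ _ _ rn) (cf_sum_widen _ _ _ (leq_subr r n)).
  rewrite -mulrA mulr_suml mulr_sumr; apply: eq_bigr => j _.
  by rewrite !mulr_sumr; apply: eq_bigr => i _; ring.
rewrite exchange_big /=; apply: eq_bigr => j _; rewrite exchange_big /=.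
have jn : (j <= n)%N by have := ltn_ord j.
have hn : (n - j < n.+1)%N by lia.
rewrite (bigD1 (Ordinal hn)) //= [X in _ + X]big1 ?addr0.
  by rewrite -mulr_suml rc_term ?leq_subr // subnKC // eqxx mulrA.
move=> i ni; rewrite -mulr_suml rc_term //; last by have := ltn_ord i.
rewrite ifF ?mul0r //; apply/negP => /eqP E; move/eqP: ni; apply.
by apply/val_inj => /=; lia.
Qed.

End RankinCohenAlgebra.

(** * Generating polynomials, brackets of families, and the curve X = c/(cz+d) *)

Section GeneratingFunctions.
Variable R : realType.
Implicit Types (F G : nat -> R[i] -> R[i]) (s : 'M[R]_2) (k : int) (z w X : R[i]).

Definition gen (d : nat) F z X : R[i] := \sum_(t < d.+1) F t z * X ^+ t.

Lemma gen_inj d F G z : (forall X, gen d F z X = gen d G z X) ->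
  forall t, (t <= d)%N -> F t z = G t z.
Proof.
move=> H t td; pose P A : {poly R[i]} := \poly_(t < d.+1) A t z.
have PE (A : nat -> R[i] -> R[i]) X : (P A).[X] = gen d A z X by rewrite horner_poly.
have : P F = P G.
  apply/eqP; rewrite -subr_eq0; apply/negPn/negP => P0.
  pose rs : seq R[i] := [seq (i%:R : R[i]) | i <- iota 0 (size (P F - P G)).+1].
  have := max_poly_roots P0 (_ : all (root _) rs) (_ : uniq rs).
  rewrite size_map size_iota ltnNge leqnSn => /(_ _ _)/negP; apply => //.
    by apply/allP => x _; rewrite /root hornerD hornerN !PE H subrr.
  rewrite map_inj_in_uniq ?iota_uniq // => a b _ _ /eqP.
  by rewrite eqr_nat => /eqP.
by move=> /(congr1 (fun p : {poly R[i]} => p`_t)); rewrite !coef_poly ltnS td.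
Qed.

(** By the binomial theorem the slash is an affine substitution in [X] and a power of [autj]. Both
    respect products, which is why brackets are compared on generating polynomials. *)
Lemma gen_scusp s k d F z X : \det s = 1 -> upper_half_plane z ->
  gen d (scusp s k d F) z X =
  autj s z ^ (- k) * gen d F (mobius s z) (autj s z ^+ 2 * X - autj s z * autj' s).
Proof.
move=> ds z0; have j0 := autj_neq0 ds z0; set j := autj s z in j0 *; set c := autj' s.
rewrite /gen /scusp; under eq_bigr do rewrite mulr_suml.
rewrite exchange_big /= mulr_sumr; apply: eq_bigr => r _.
rewrite addrC exprDn mulr_sumr mulr_sumr (big_ord_widen d.+1 (fun t =>
   j ^ (- k) * (F r (mobius s z) * ((- (j * c)) ^+ (r - t) * (j ^+ 2 * X) ^+ t *+ 'C(r, t))))); last by have := ltn_ord r.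
rewrite [RHS]big_mkcond; apply: eq_bigr => t _; case: ifP => tr; last first.
  by rewrite bin_small ?mul0r //; move: tr; lia.
have -> : r%:Z + t%:Z - k = - k + ((r - t) + 2 * t)%N%:Z by lia.
rewrite -/c -/j expfzDr // -mulr_natr -mulrN !exprMn -exprnP mul2n -addnn !exprD; ring.
Qed.

Definition sconv (d e : nat) F G (t : nat) z : R[i] :=
  \sum_(a < d.+1) \sum_(b < e.+1 | (a + b == t)%N) F a z * G b z.

Lemma gen_sconv d e F G z X :
  gen (d + e) (sconv d e F G) z X = gen d F z X * gen e G z X.
Proof.
rewrite /gen /sconv mulr_suml; under eq_bigr do rewrite mulr_suml.
rewrite exchange_big /=; apply: eq_bigr => a _; rewrite mulr_sumr.
under eq_bigr do rewrite mulr_suml; rewrite (exchange_big_dep xpredT) //=.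
apply: eq_bigr => b _.
have hab : (a + b < (d + e).+1)%N by have := ltn_ord a; have := ltn_ord b; lia.
rewrite (big_pred1 (Ordinal hab)) /=; last by move=> t; rewrite eq_sym.
by rewrite exprD; ring.
Qed.

(** The bracket with [sdl] in place of [d/dtau] and products of generating polynomials in place of
    products of functions; its component 0 is the ordinary bracket. *)
Definition sbr (d e n : nat) (c : nat -> R[i]) F G (t : nat) z : R[i] :=
  \sum_(j < n.+1) c j * sconv d e (iter j (sdl d) F) (iter (n - j) (sdl e) G) t z.

Lemma gen_sum d (I : finType) (c : I -> R[i]) (H : I -> nat -> R[i] -> R[i]) z X :
  gen d (fun t z => \sum_i c i * H i t z) z X = \sum_i c i * gen d (H i) z X.
Proof.
rewrite /gen; under eq_bigr do rewrite mulr_suml.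
rewrite exchange_big /=; apply: eq_bigr => i _; rewrite mulr_sumr.
by apply: eq_bigr => t _; rewrite mulrA.
Qed.

Lemma gen_sbr d e n c F G z X : gen (d + e) (sbr d e n c F G) z X =
  \sum_(j < n.+1) c j * (gen d (iter j (sdl d) F) z X * gen e (iter (n - j) (sdl e) G) z X).
Proof.
rewrite (gen_sum (d + e) (fun j : 'I_n.+1 => c j)
  (fun j : 'I_n.+1 => sconv d e (iter j (sdl d) F) (iter (n - j) (sdl e) G))).
by apply: eq_bigr => j _; rewrite gen_sconv.
Qed.

Lemma gen_ext d F G z X : (forall t, (t <= d)%N -> F t z = G t z) -> gen d F z X = gen d G z X.
Proof. by move=> H; apply: eq_bigr => t _; rewrite H //; have := ltn_ord t. Qed.

Section BracketCusp.
Variables (s : 'M[R]_2) (k l : int) (d e n : nat) (F G : nat -> R[i] -> R[i]).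
Variable U : R[i] -> Prop.
Hypothesis ds : \det s = 1.
Hypothesis Uopen : forall z, U z -> cnear z U.
Hypothesis UF : forall z, U z -> upper_half_plane z /\ sregular d F (mobius s z).
Hypothesis UG : forall z, U z -> upper_half_plane z /\ sregular e G (mobius s z).

(** The iterates of the slashed families are expanded by [iter_scusp], and [rc_sum] removes the
    anomaly. With [s] in the group this yields the transformation law, with [s] moving [oo] to a
    cusp the expansion there. *)
Lemma scusp_sbr t z : (t <= d + e)%N -> U z ->
  scusp s (k + l + (2 * n)%:Z) (d + e) (sbr d e n (rcc R (k - d%:Z) (l - e%:Z) n) F G) t z =
  sbr d e n (rcc R (k - d%:Z) (l - e%:Z) n) (scusp s k d F) (scusp s l e G) t z.
Proof.
move=> tde Uz; apply: (@gen_inj (d + e)) tde => X.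
have [z0 _] := UF Uz; have j0 := autj_neq0 ds z0.
rewrite gen_scusp // !gen_sbr.
transitivity (\sum_(r < n.+1) rcc R (k - d%:Z) (l - e%:Z) n r *
   (\sum_(j < r.+1) cf R (k - d%:Z) r j * xj s z ^+ (r - j) * gen d (tcusp s k d F j) z X) *
   (\sum_(i < (n - r).+1) cf R (l - e%:Z) (n - r) i * xj s z ^+ (n - r - i) * gen e (tcusp s l e G i) z X)); last first.
  apply: eq_bigr => r _; rewrite -mulrA; congr (_ * (_ * _)).
    rewrite -(gen_sum d (fun j : 'I_r.+1 => cf R (k - d%:Z) r j * xj s z ^+ (r - j)) (fun j : 'I_r.+1 => tcusp s k d F j)).
    by apply: gen_ext => t1 td; rewrite (iter_scusp k ds Uopen UF).
  rewrite -(gen_sum e (fun j : 'I_(n - r).+1 => cf R (l - e%:Z) (n - r) j * xj s z ^+ (n - r - j)) (fun j : 'I_(n - r).+1 => tcusp s l e G j)).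
  by apply: gen_ext => t1 td; rewrite (iter_scusp l ds Uopen UG).
rewrite (rc_sum _ _ _ _ (fun j => gen d (tcusp s k d F j) z X) (fun j => gen e (tcusp s l e G j) z X)).
rewrite mulr_sumr; apply: eq_bigr => j _; rewrite /tcusp !gen_scusp //.
have jn : (j <= n)%N by have := ltn_ord j.
have -> : - (k + l + (2 * n)%:Z) = - (k + (2 * j)%:Z) + - (l + (2 * (n - j))%:Z) by lia.
by rewrite expfzDr //; ring.
Qed.

End BracketCusp.

Section Curve.
Variables (s : 'M[R]_2) (d : nat).
Hypothesis ds : \det s = 1.

Definition curve F z : R[i] := gen d F z (- xj s z).

(** On the curve [X = - xj] one has [X' = - X^2], so the total derivative is [d/dtau - X^2 d/dX],
    which is [sdl] without its term [d X]. *)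
Lemma curve_wdiff F z : upper_half_plane z ->
  (forall t, (t <= d)%N -> wdiff (F t) z (dtau_scalar (F t) z)) ->
  wdiff (curve F) z (curve (sdl d F) z + d%:R * xj s z * curve F z).
Proof.
move=> z0 H.
have W : wdiff (curve F) z (\sum_(t < d.+1) (dtau_scalar (F t) z * (- xj s z) ^+ t +
    F t z * (t%:R * (- xj s z ^+ 2) * (- xj s z) ^+ t.-1))).
  apply: wdiff_sum => t _; apply: wdiffM; first by apply: H; have := ltn_ord t.
  apply: wdiffX; have := wdiffZ (-1) (wdiff_xj ds z0); rewrite mulN1r.
  by apply: wdiff_ext => w; rewrite mulN1r.
suff -> : curve (sdl d F) z + d%:R * xj s z * curve F z =
   \sum_(t < d.+1) (dtau_scalar (F t) z * (- xj s z) ^+ t +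
    F t z * (t%:R * (- xj s z ^+ 2) * (- xj s z) ^+ t.-1)) by [].
rewrite /curve /gen; set x := xj s z.
have -> : \sum_(t < d.+1) sdl d F t z * (- x) ^+ t =
   \sum_(t < d.+1) dtau_scalar (F t) z * (- x) ^+ t
   + \sum_(t < d.+1) (d%:R - t%:R) * F t z * (- x) ^+ t.+1.
  rewrite [X in _ = _ + X]big_ord_recr /= subrr !mul0r addr0.
  transitivity (\sum_(t < d.+1) (dtau_scalar (F t) z * (- x) ^+ t + sprev d F t z * (- x) ^+ t)).
    by apply: eq_bigr => t _; rewrite sdlE mulrDl.
  rewrite big_split /=; congr (_ + _).
  by rewrite big_ord_recl /= mul0r add0r; apply: eq_bigr => t _; rewrite /bump /= add1n.
rewrite mulr_sumr -addrA -big_split -big_split /=; apply: eq_bigr => t _; congr (_ + _).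
case: (t : nat) => [|m] /=; first by rewrite expr1 expr0; ring.
rewrite !exprS; ring.
Qed.

Lemma curve_sdl F z : upper_half_plane z ->
  (forall t, (t <= d)%N -> wdiff (F t) z (dtau_scalar (F t) z)) ->
  curve (sdl d F) z = dtau_scalar (curve F) z - d%:R * xj s z * curve F z.
Proof. by move=> z0 H; rewrite (wdiff_dtau (curve_wdiff z0 H)) addrK. Qed.

(** The correction in [curve_sdl] is the same for all families of depth [d], so a linear relation
    with constant coefficients on the curve passes to the images under [sdl]. *)
Lemma curve_iter_linear (I : finType) (rho : I -> R[i]) F (G : I -> nat -> R[i] -> R[i])
    (U : R[i] -> Prop) :
  (forall z, U z -> cnear z U) -> (forall z, U z -> upper_half_plane z) ->
  (forall z, U z -> sregular d F z) -> (forall i z, U z -> sregular d (G i) z) ->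
  (forall z, U z -> curve F z = \sum_i rho i * curve (G i) z) ->
  forall r z, U z -> curve (iter r (sdl d) F) z = \sum_i rho i * curve (iter r (sdl d) (G i)) z.
Proof.
move=> Uo U0 UF UG H; elim=> [|r IH] z Uz; first exact: H.
rewrite !iterS curve_sdl; [|exact: U0|exact: (UF z Uz r)].
have W : wdiff (curve (iter r (sdl d) F)) z
    (\sum_i rho i * (curve (sdl d (iter r (sdl d) (G i))) z + d%:R * xj s z * curve (iter r (sdl d) (G i)) z)).
  apply: (@wdiff_near _ (fun w => \sum_i rho i * curve (iter r (sdl d) (G i)) w)).
    by apply: cnear_sub (Uo z Uz) => w Uw; rewrite IH.
  apply: wdiff_sum => i _; apply: wdiffZ; apply: curve_wdiff; first exact: U0.
  exact: (UG i z Uz r).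
rewrite (wdiff_dtau W) IH // mulr_sumr -sumrB; apply: eq_bigr => i _; ring.
Qed.

(** At [X = c/j] the substituted argument [j^2 X - j c] of [gen_scusp] is 0, so only component 0 is
    seen. *)
Lemma curve_scusp k F z : upper_half_plane z ->
  curve (scusp s k d F) z = autj s z ^ (- k) * F 0%N (mobius s z).
Proof.
move=> z0; have j0 := autj_neq0 ds z0; rewrite /curve gen_scusp //; congr (_ * _).
have -> : autj s z ^+ 2 * - xj s z - autj s z * autj' s = 0.
  by rewrite /xj; field.
rewrite /gen big_ord_recl /= big1 ?addr0 ?expr0 ?mulr1 // => i _.
by rewrite /bump /= exprS mul0r mulr0.
Qed.

End Curve.
End GeneratingFunctions.

(** * Regularity classes closed under the bracket *)

Section Closure.
Variable R : realType.
Implicit Types (h g : R[i] -> R[i]) (F G : nat -> R[i] -> R[i]) (a z w c : R[i]).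

(** These four closure properties cover everything a bracket is built from; each regularity class is
    checked against them once. *)
Record diff_algebra (P : (R[i] -> R[i]) -> Prop) : Prop := DiffAlgebra {
  da_cst : forall c, P (fun=> c);
  da_add : forall h g, P h -> P g -> P (fun z => h z + g z);
  da_mul : forall h g, P h -> P g -> P (fun z => h z * g z);
  da_dtau : forall h, P h -> P (dtau_scalar h) }.

Section DiffAlgebra.
Variable P : (R[i] -> R[i]) -> Prop.
Hypothesis HP : diff_algebra P.

Lemma da_sum (I : Type) (r : seq I) (Q : pred I) (h : I -> R[i] -> R[i]) :
  (forall i, Q i -> P (h i)) -> P (fun z => \sum_(i <- r | Q i) h i z).
Proof.
move=> H; elim: r => [|i r IH].
  by rewrite (_ : (fun z => _) = (fun=> 0)); [exact: da_cst|apply/funext => z; rewrite big_nil].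
case: (boolP (Q i)) => Qi.
  rewrite (_ : (fun z => _) = (fun z => h i z + \sum_(i <- r | Q i) h i z)).
    by apply: da_add => //; exact: H.
  by apply/funext => z; rewrite big_cons Qi.
by rewrite (_ : (fun z => _) = (fun z => \sum_(i <- r | Q i) h i z)) //;
  apply/funext => z; rewrite big_cons (negbTE Qi).
Qed.

Lemma da_sdl d F j : (forall r, (r <= d)%N -> P (F r)) ->
  forall r, (r <= d)%N -> P (iter j (sdl d) F r).
Proof.
move=> H; elim: j => [|j IH] r rd; first exact: H.
rewrite iterS (_ : sdl _ _ _ = (fun z => dtau_scalar (iter j (sdl d) F r) z +
    sprev d (iter j (sdl d) F) r z)); last by apply/funext => z; exact: sdlE.
apply: da_add => //; first by apply: da_dtau => //; exact: IH.
case: r rd => [|r] rd /=; first exact: da_cst.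
by apply: da_mul => //; [exact: da_cst|apply: IH; exact: ltnW].
Qed.

Lemma da_sbr d e n (c : nat -> R[i]) F G : (forall r, (r <= d)%N -> P (F r)) ->
  (forall r, (r <= e)%N -> P (G r)) -> forall t, P (sbr d e n c F G t).
Proof.
move=> HF HG t; apply: da_sum => j _; apply: da_mul => //; first exact: da_cst.
apply: da_sum => a _; apply: da_sum => b _; apply: da_mul => //.
  by apply: da_sdl => //; have := ltn_ord a.
by apply: da_sdl => //; have := ltn_ord b.
Qed.

End DiffAlgebra.

Lemma ana_diff_algebra (p1 q1 p2 q2 : R[i]) a :
  (forall w, nm (phi p1 q1 w) <= nm w) -> (forall w, nm (phi p2 q2 w) <= nm w) ->
  (forall w, nm w <= nm (phi p1 q1 w) + nm (phi p2 q2 w)) ->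
  diff_algebra (fun h => ana p1 q1 p2 q2 h a).
Proof.
move=> H1 H2 H3; split.
- by move=> c; exact: ana_cst.
- by move=> h g; exact: anaD.
- by move=> h g; exact: anaM.
- by move=> h; exact: ana_dtau.
Qed.

Lemma ana_sregular (p1 q1 p2 q2 : R[i]) d F z :
  (forall w, nm (phi p1 q1 w) <= nm w) -> (forall w, nm (phi p2 q2 w) <= nm w) ->
  (forall w, nm w <= nm (phi p1 q1 w) + nm (phi p2 q2 w)) ->
  (forall r, (r <= d)%N -> ana p1 q1 p2 q2 (F r) z) -> sregular d F z.
Proof.
move=> H1 H2 H3 H j r rd.
have Hj := da_sdl (ana_diff_algebra z H1 H2 H3) j H.
by have := cnear_at (ana_wdiff H1 H2 H3 (Hj r rd)).
Qed.

Definition real_ana := ana (2^-1) (2^-1) (- ('i / 2)) ('i / 2 : R[i]).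
Definition holo := ana (1 : R[i]) 0 0 0.

Lemma real_ana_algebra a : diff_algebra (real_ana^~ a).
Proof.
by apply: ana_diff_algebra => w; [exact: nm_phi_Re|exact: nm_phi_Im|exact: nm_phi_ReIm].
Qed.

Lemma holo_algebra a : diff_algebra (holo^~ a).
Proof.
by apply: ana_diff_algebra => w; [exact: nm_phi_id|exact: nm_phi_0|exact: nm_phi_id0].
Qed.

Lemma real_ana_sregular d F z : (forall r, (r <= d)%N -> real_ana (F r) z) -> sregular d F z.
Proof.
by apply: ana_sregular => w; [exact: nm_phi_Re|exact: nm_phi_Im|exact: nm_phi_ReIm].
Qed.

Lemma holo_sregular d F z : (forall r, (r <= d)%N -> holo (F r) z) -> sregular d F z.
Proof.
by apply: ana_sregular => w; [exact: nm_phi_id|exact: nm_phi_0|exact: nm_phi_id0].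
Qed.

Lemma holo_near h g a : cnear a (fun w => h w = g w) -> holo h a -> holo g a.
Proof. by apply: ana_near => w; exact: nm_phi_id0. Qed.

Lemma holo_id a : holo id a.
Proof.
apply: (@holo_near (phi 1 0)); first by exists 1 => // w _; rewrite phi_id.
by apply: ana_phi1; exact: (@nm_phi_id0 R).
Qed.

Lemma holo_Xsub a b n : holo (fun z => (z - b) ^+ n) a.
Proof.
apply: anaX; first exact: (@nm_phi_id0 R).
by apply: anaD; [exact: holo_id|exact: ana_cst].
Qed.

Lemma meroP h a : meromorphic_at h a <->
  exists (N : nat) (h0 : R[i] -> R[i]), holo h0 a /\
    exists2 d : R, 0 < d & forall w, w != 0 -> nm w < d -> h (a + w) = h0 (a + w) / w ^+ N.
Proof.
split.
  move=> [N [h0 [d [d0 /holomorphicP H0 H]]]]; exists N, h0; split=> //; exists d => // w w0 wd.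
  rewrite H ?(addrC a) ?addrK //.
    by rewrite -subr_eq0 addrK.
  by rewrite -[`|_|]/((nm _)%:C) ltcR.
move=> [N [h0 [H0 [d d0 H]]]]; exists N, h0, d; split=> //; first exact/holomorphicP.
move=> z za zd; have := H (z - a); rewrite [a + _]addrC subrK; apply; first by rewrite subr_eq0.
by rewrite -ltcR.
Qed.

Lemma mero_algebra a : diff_algebra (meromorphic_at^~ a).
Proof.
have HA := holo_algebra a.
split.
- move=> c; apply/meroP; exists 0%N, (fun=> c); split; first exact: (da_cst HA).
  by exists 1 => // w _ _; rewrite expr0 divr1.
- move=> h g /meroP[N [h0 [H0 [d d0 Hh]]]] /meroP[M [g0 [G0 [e e0 Hg]]]]; apply/meroP.
  exists (N + M)%N, (fun z => h0 z * (z - a) ^+ M + g0 z * (z - a) ^+ N); split.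
    apply: (da_add HA); apply: (da_mul HA) => //; exact: holo_Xsub.
  exists (Num.min d e); first by rewrite lt_min d0.
  move=> w w0; rewrite lt_min => /andP[/(Hh _ w0) -> /(Hg _ w0) ->].
  by rewrite (addrC a) addrK exprD; field; rewrite !expf_neq0.
- move=> h g /meroP[N [h0 [H0 [d d0 Hh]]]] /meroP[M [g0 [G0 [e e0 Hg]]]]; apply/meroP.
  exists (N + M)%N, (fun z => h0 z * g0 z); split; first exact: (da_mul HA).
  exists (Num.min d e); first by rewrite lt_min d0.
  move=> w w0; rewrite lt_min => /andP[/(Hh _ w0) -> /(Hg _ w0) ->].
  by rewrite exprD; field; rewrite !expf_neq0.
- move=> h /meroP[N [h0 [H0 [d d0 Hh]]]]; apply/meroP.
  (* The numerator in the quotient rule for [h0 / (z - a)^N], over [(z - a)^(N+1)]. *)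
  exists N.+1, (fun z => dtau_scalar h0 z * (z - a) + (- N%:R) * h0 z); split.
    apply: (da_add HA); apply: (da_mul HA) => //; [exact: (da_dtau HA)| |exact: (da_cst HA)].
    by have := holo_Xsub a a 1.
  have [e e0 He] := ana_wdiff (@nm_phi_id R) (@nm_phi_0 R) (@nm_phi_id0 R) H0.
  exists (Num.min d e); first by rewrite lt_min d0.
  move=> w w0; rewrite lt_min => /andP[wd /He W].
  apply: wdiff_dtau.
  have W2 : wdiff (fun z => (z - a) ^+ N) (a + w) (N%:R * w ^+ N.-1).
    have := wdiffX N (wdiffD (wdiff_id (a + w)) (wdiff_cst (- a) (a + w))).
    by rewrite addr0 mulr1 /= (addrC a) addrK.
  have n0 : (a + w - a) ^+ N != 0 by rewrite (addrC a) addrK expf_neq0.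
  have := wdiffM W (@wdiffV _ (fun z => (z - a) ^+ N) (a + w) _ n0 W2).
  rewrite /= (addrC a) addrK.
  have -> : dtau_scalar h0 (w + a) / w ^+ N + h0 (w + a) * (- (w ^+ N ^+ 2)^-1 * (N%:R * w ^+ N.-1)) =
     (dtau_scalar h0 (w + a) * w + - N%:R * h0 (w + a)) / w ^+ N.+1.
    case: (N) => [|m]; first by rewrite !expr0 expr1; field.
    by rewrite /= !exprS; field; rewrite w0 expf_neq0.
  apply: wdiff_near; rewrite (addrC w).
  (* This radius keeps [a + w + v] inside the disc and away from [a], where [h] may take any
     value. *)
  have rp : 0 < Num.min (d - nm w) (nm w) by rewrite lt_min subr_gt0 wd nm_gt0.
  exists (Num.min (d - nm w) (nm w)) => // v; rewrite lt_min => /andP[v1 v2].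
  rewrite -addrA Hh ?(addrC a) ?addrK //.
    apply/eqP => E; move: v2; have -> : v = - w by rewrite -[RHS]add0r -E addrAC subrr add0r.
    by rewrite nmN ltxx.
  by apply: le_lt_trans (nmD _ _) _; lra.
Qed.

End Closure.

(** * Growth near i oo *)

Section Growth.
Variable R : realType.
Implicit Types (h g : R[i] -> R[i]) (F G : nat -> R[i] -> R[i]) (z w : R[i]).

Definition high (Y : R) z : Prop := Y < complex.Im z.

Lemma high_near Y z : high Y z -> cnear z (high Y).
Proof.
move=> z0; exists (complex.Im z - Y); first by rewrite subr_gt0.
move=> w hw; rewrite /high ReImD; have := nm_Im w; rewrite ler_norml => /andP[]; lra.
Qed.

Definition bnd h : Prop := exists M Y : R, forall z, Y <= complex.Im z -> nm (h z) <= M.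
Definition van h : Prop := forall eps : R, 0 < eps ->
  exists Y : R, forall z, Y <= complex.Im z -> nm (h z) <= eps.
Definition expg h : Prop := exists B M Y : R, forall z, Y <= complex.Im z ->
  nm (h z) <= B * expR (M * complex.Im z).

(** The analogue of [diff_algebra] for [Im z -> oo]; the derivative asks for expansions on a
    half-plane, where Cauchy's estimate applies. Vanishing is treated apart, since nonzero constants
    do not vanish. *)
Record growth (P : (R[i] -> R[i]) -> Prop) : Prop := Growth {
  gr_cst : forall c, P (fun=> c);
  gr_ext : forall (Y : R) h g, (forall z, Y <= complex.Im z -> h z = g z) -> P h -> P g;
  gr_add : forall h g, P h -> P g -> P (fun z => h z + g z);
  gr_mul : forall h g, P h -> P g -> P (fun z => h z * g z);
  gr_dtau : forall (Y : R) h, (forall z, high Y z -> tay 4 h z) -> P h -> P (dtau_scalar h) }.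

Lemma square_high z z' (r Y : R) : square z r z' -> Y + r < complex.Im z -> high Y z'.
Proof. by move=> [_]; rewrite ler_norml /high => /andP[]; lra. Qed.

Lemma bnd_growth : growth bnd.
Proof.
split.
- by move=> c; exists (nm c), 0.
- move=> Y h g E [M [Y' H]]; exists M, (Num.max Y Y') => z.
  by rewrite ge_max => /andP[/E <- /H].
- move=> h g [M [Y H]] [M' [Y' H']]; exists (M + M'), (Num.max Y Y') => z.
  by rewrite ge_max => /andP[/H h1 /H' h2]; apply: le_trans (nmD _ _) _; rewrite lerD.
- move=> h g [M [Y H]] [M' [Y' H']]; exists (M * M'), (Num.max Y Y') => z.
  by rewrite ge_max => /andP[/H h1 /H' h2]; rewrite nmM; apply: ler_pM => //; exact: nm_ge0.
(* The square of half side 1 around [z] stays in the half-plane where [h] is regular and bounded. *)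
- move=> Y h T [M [Y' H]]; exists (2 * M / 1), (Num.max Y Y' + 2) => z hz.
  have [m1 m2] : Y <= Num.max Y Y' /\ Y' <= Num.max Y Y' by rewrite !le_max !lexx orbT.
  apply: (cauchy_estimate ltr01) => z' sq; have := @square_high _ _ _ (Num.max Y Y') sq ltac:(lra).
    by rewrite /high => hh; apply: T; rewrite /high; lra.
  by rewrite /high => hh; apply: H; lra.
Qed.

(** Non-negative constants together with [Im z >= 0] make the bound monotone in [B] and [M], so that
    those of two functions can be combined. *)
Lemma expg_norm h : expg h -> exists B M Y : R, [/\ 0 <= B, 0 <= M, 0 <= Y &
  forall z, Y <= complex.Im z -> nm (h z) <= B * expR (M * complex.Im z)].
Proof.
move=> [B [M [Y H]]]; exists `|B|, `|M|, (Num.max 0 Y); split=> //.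
  by rewrite le_max lexx.
move=> z; rewrite ge_max => /andP[z0 /H h1]; apply: le_trans h1 _.
apply: (@le_trans _ _ (`|B| * expR (M * complex.Im z))).
  by rewrite ler_wpM2r ?expR_ge0 // ler_norm.
by rewrite ler_wpM2l // ler_expR ler_wpM2r // ler_norm.
Qed.

Lemma expg_growth : growth expg.
Proof.
split.
- by move=> c; exists (nm c), 0, 0 => z _; rewrite mul0r expR0 mulr1.
- move=> Y h g E [B [M [Y' H]]]; exists B, M, (Num.max Y Y') => z.
  by rewrite ge_max => /andP[/E <- /H].
- move=> h g /expg_norm[B [M [Y [B0 M0 Y0 H]]]] /expg_norm[B' [M' [Y' [B'0 M'0 Y'0 H']]]].
  exists (B + B'), (M + M'), (Num.max Y Y') => z.
  rewrite ge_max => /andP[y1 y2]; apply: le_trans (nmD _ _) _; rewrite mulrDl.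
  apply: lerD; [apply: le_trans (H _ y1) _|apply: le_trans (H' _ y2) _].
    by rewrite ler_wpM2l // ler_expR ler_wpM2r ?(le_trans Y0 y1) // lerDl.
  by rewrite ler_wpM2l // ler_expR ler_wpM2r ?(le_trans Y0 y1) // lerDr.
- move=> h g /expg_norm[B [M [Y [B0 M0 Y0 H]]]] /expg_norm[B' [M' [Y' [B'0 M'0 Y'0 H']]]].
  exists (B * B'), (M + M'), (Num.max Y Y') => z.
  rewrite ge_max => /andP[/H h1 /H' h2]; rewrite nmM mulrDl expRD mulrACA.
  by apply: ler_pM => //; exact: nm_ge0.
- move=> Y h T /expg_norm[B [M [Y' [B0 M0 Y'0 H]]]].
  exists (2 * B * expR M), M, (Num.max Y Y' + 2) => z hz.
  have [m1 m2] : Y <= Num.max Y Y' /\ Y' <= Num.max Y Y' by rewrite !le_max !lexx orbT.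
  apply: (@le_trans _ _ (2 * (B * expR (M * (complex.Im z + 1))) / 1)); last first.
    by rewrite divr1 mulrDr mulr1 expRD -!mulrA (mulrC (expR M)).
  apply: (cauchy_estimate ltr01) => z' sq; have := @square_high _ _ _ (Num.max Y Y') sq ltac:(lra).
    by rewrite /high => hh; apply: T; rewrite /high; lra.
  rewrite /high => hh; apply: (@le_trans _ _ (B * expR (M * complex.Im z'))); first by apply: H; lra.
  rewrite ler_wpM2l // ler_expR ler_wpM2l //; move: sq => [_]; rewrite ler_norml => /andP[]; lra.
Qed.

Lemma vanD h g : van h -> van g -> van (fun z => h z + g z).
Proof.
move=> Hh Hg e e0; have e20 : 0 < e / 2 by rewrite divr_gt0.
have [Y H] := Hh _ e20; have [Y' H'] := Hg _ e20; exists (Num.max Y Y') => z.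
by rewrite ge_max => /andP[/H h1 /H' h2]; apply: le_trans (nmD _ _) _; lra.
Qed.

Lemma van0 : van (fun=> 0).
Proof. by move=> e e0; exists 0 => z _; rewrite nm0 ltW. Qed.

Lemma van_mul_bnd h g : van h -> bnd g -> van (fun z => h z * g z).
Proof.
move=> Hh [M [Y' H']] e e0; have M0 : 0 < `|M| + 1 by rewrite ltr_wpDl.
have [Y H] := Hh _ (divr_gt0 e0 M0); exists (Num.max Y Y') => z.
rewrite ge_max => /andP[/H h1 /H' h2]; rewrite nmM -[leRHS](@divfK _ (`|M| + 1)) ?lt0r_neq0 //.
apply: ler_pM => //; try exact: nm_ge0.
by have := ler_norm M; lra.
Qed.

Lemma van_ext (Y : R) h g : (forall z, Y <= complex.Im z -> h z = g z) -> van h -> van g.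
Proof.
move=> E H e /H[Y' H']; exists (Num.max Y Y') => z.
by rewrite ge_max => /andP[/E <- /H'].
Qed.

Lemma van_sum (I : Type) (r : seq I) (Q : pred I) (h : I -> R[i] -> R[i]) :
  (forall i, Q i -> van (h i)) -> van (fun z => \sum_(i <- r | Q i) h i z).
Proof.
move=> H; elim: r => [|i r IH].
  by apply: (@van_ext 0) van0 => z _; rewrite big_nil.
case: (boolP (Q i)) => Qi.
  by apply: (@van_ext 0) (vanD (H i Qi) IH) => z _; rewrite big_cons Qi.
by apply: (@van_ext 0) IH => z _; rewrite big_cons (negbTE Qi).
Qed.

(** High up, squares of any half side [r] fit in the half-plane of boundedness, and Cauchy's
    estimate gives [O(1/r)]. *)
Lemma bnd_dtau_van (Y : R) h : (forall z, high Y z -> tay 4 h z) -> bnd h -> van (dtau_scalar h).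
Proof.
move=> T [M [Y' H]] e e0.
set m := Num.max Y Y'.
have [m1 m2] : Y <= m /\ Y' <= m by rewrite !le_max !lexx orbT.
(* With [r = 1 + K] the bound [2 |M| / r] is at most [e]. *)
pose K := 2 * `|M| / e; have K0 : 0 <= K by rewrite divr_ge0 ?mulr_ge0 // ltW.
exists (m + 2 + K) => z hz; pose r := 1 + K.
have r0 : 0 < r by rewrite /r; lra.
apply: (@le_trans _ _ (2 * `|M| / r)).
  apply: (cauchy_estimate r0) => z' sq; have := @square_high z z' r m sq ltac:(rewrite /r; lra).
    by rewrite /high => hh; apply: T; rewrite /high; lra.
  by rewrite /high => hh; apply: le_trans (ler_norm M); apply: H; lra.
rewrite ler_pdivrMr // /r mulrDr mulr1 /K mulrCA divff ?lt0r_neq0 // mulr1; lra.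
Qed.

Section GrowthClass.
Variable P : (R[i] -> R[i]) -> Prop.
Hypothesis HP : growth P.

Lemma gr_sum (I : Type) (r : seq I) (Q : pred I) (h : I -> R[i] -> R[i]) :
  (forall i, Q i -> P (h i)) -> P (fun z => \sum_(i <- r | Q i) h i z).
Proof.
move=> H; elim: r => [|i r IH].
  by apply: (gr_ext HP (Y := 0)) (gr_cst HP 0) => z _; rewrite big_nil.
case: (boolP (Q i)) => Qi.
  by apply: (gr_ext HP (Y := 0)) (gr_add HP (H i Qi) IH) => z _; rewrite big_cons Qi.
by apply: (gr_ext HP (Y := 0)) IH => z _; rewrite big_cons (negbTE Qi).
Qed.

Lemma gr_sdl (Y : R) d F : (forall j r z, (r <= d)%N -> high Y z -> tay 4 (iter j (sdl d) F r) z) ->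
  (forall r, (r <= d)%N -> P (F r)) -> forall j r, (r <= d)%N -> P (iter j (sdl d) F r).
Proof.
move=> T H; elim=> [|j IH] r rd; first exact: H.
rewrite iterS (_ : sdl _ _ _ = (fun z => dtau_scalar (iter j (sdl d) F r) z +
    sprev d (iter j (sdl d) F) r z)); last by apply/funext => z; exact: sdlE.
apply: (gr_add HP); first by apply: (gr_dtau HP (Y := Y)) (IH _ rd) => z hz; exact: T.
case: r rd => [|r] rd /=; first exact: (gr_cst HP).
by apply: (gr_mul HP); [exact: (gr_cst HP)|apply: IH; exact: ltnW].
Qed.

Lemma gr_sbr (Y : R) d e n c F G t :
  (forall j r z, (r <= d)%N -> high Y z -> tay 4 (iter j (sdl d) F r) z) ->
  (forall j r z, (r <= e)%N -> high Y z -> tay 4 (iter j (sdl e) G r) z) ->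
  (forall r, (r <= d)%N -> P (F r)) -> (forall r, (r <= e)%N -> P (G r)) ->
  P (sbr d e n c F G t).
Proof.
move=> TF TG HF HG; apply: gr_sum => j _; apply: (gr_mul HP); first exact: (gr_cst HP).
apply: gr_sum => a _; apply: gr_sum => b _; apply: (gr_mul HP).
  by apply: (gr_sdl TF) => //; have := ltn_ord a.
by apply: (gr_sdl TG) => //; have := ltn_ord b.
Qed.

End GrowthClass.

Lemma sbr0 d e n c F G z : sbr d e n c F G 0%N z =
  \sum_(j < n.+1) c j * (iter j (sdl d) F 0%N z * iter (n - j) (sdl e) G 0%N z).
Proof.
apply: eq_bigr => j _; congr (_ * _); rewrite /sconv big_ord_recl /= [X in _ + X]big1 ?addr0.
  by rewrite (big_pred1 ord0) // => b; rewrite add0n.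
by move=> a _; rewrite big1 // => b; rewrite /bump /= => /eqP; lia.
Qed.

Lemma van_sdl0 (Y : R) d F j : (forall j r z, (r <= d)%N -> high Y z -> tay 4 (iter j (sdl d) F r) z) ->
  (forall r, (r <= d)%N -> bnd (F r)) -> (0 < j)%N -> van (iter j (sdl d) F 0%N).
Proof.
move=> T H; case: j => // j _; apply: (@bnd_dtau_van Y) => [z|]; first exact: T.
exact: (gr_sdl bnd_growth T).
Qed.

(** In the term of index [j > 0] the factor from [F] is a derivative and vanishes. For [j = 0]
    either [n > 0] and the factor from [G] is such a derivative, or [F] itself vanishes. The other
    factor is bounded. *)
Lemma van_sbr0 (Y : R) d e n c F G :
  (forall j r z, (r <= d)%N -> high Y z -> tay 4 (iter j (sdl d) F r) z) ->
  (forall j r z, (r <= e)%N -> high Y z -> tay 4 (iter j (sdl e) G r) z) ->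
  (forall r, (r <= d)%N -> bnd (F r)) -> (forall r, (r <= e)%N -> bnd (G r)) ->
  (0 < n)%N \/ van (F 0%N) -> van (sbr d e n c F G 0%N).
Proof.
move=> TF TG HF HG Hn.
apply: (@van_ext 0 (fun z => \sum_(j < n.+1) (iter j (sdl d) F 0%N z * iter (n - j) (sdl e) G 0%N z) * c j)).
  by move=> z _; rewrite sbr0; apply: eq_bigr => j _; rewrite mulrC.
apply: van_sum => j _; apply: van_mul_bnd; last exact: (gr_cst bnd_growth).
have bF := gr_sdl bnd_growth TF HF j (leq0n d).
have bG := gr_sdl bnd_growth TG HG (n - j) (leq0n e).
case: (posnP j) => [j0|jp]; last by apply: van_mul_bnd => //; exact: van_sdl0 TF HF jp.
case: Hn => [np|v0]; last by rewrite j0; apply: van_mul_bnd => //; rewrite j0 in bG.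
have vG : van (iter (n - j) (sdl e) G 0%N) by apply: van_sdl0 TG HG _; rewrite j0 subn0.
by apply: (@van_ext 0) (van_mul_bnd vG bF) => z _; rewrite mulrC.
Qed.

(** By [iter_scusp] the iterates are combinations of powers of [xj], powers of [autj] and
    holomorphic functions composed with [mobius s]; finite expansions survive all of these. *)
Lemma tay_iter_scusp (s : 'M[R]_2) k d F (U : R[i] -> Prop) : \det s = 1 ->
  (forall z, U z -> cnear z U) ->
  (forall z, U z -> upper_half_plane z /\ forall r, (r <= d)%N -> holo (F r) (mobius s z)) ->
  forall j r z, (r <= d)%N -> U z -> tay 4 (iter j (sdl d) (scusp s k d F) r) z.
Proof.
move=> ds Uo UF j r z rd Uz; have [z0 Hz] := UF _ Uz.
have Ureg w : U w -> upper_half_plane w /\ sregular d F (mobius s w).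
  by move=> /UF[w0 /holo_sregular].
apply: (@tay_near _ _ (fun w => \sum_(i < j.+1) cf R (k - d%:Z) j i * xj s w ^+ (j - i) * tcusp s k d F i r w)).
  by apply: cnear_sub (Uo _ Uz) => w Uw; rewrite (iter_scusp k ds Uo Ureg).
apply: tay_sum => i _; apply: tayM.
  by apply: tayM; [exact: tay_cst|apply: tayX; exact: tay_xj].
apply: tay_sum => b _; apply: tayM.
  by apply: tayM; [exact: tay_cst|exact: tay_autjz].
apply: tay_comp; last exact: tay_mobius.
apply: holomorphic_tay; apply: (da_sdl (holo_algebra _)) => //.
by have := ltn_ord b.
Qed.

End Growth.

(** * Vector-valued families and the transformation law of the bracket *)

Section VectorValued.
Variable R : realType.

Definition comp m (F : nat -> R[i] -> 'cV[R[i]]_m) (i : 'I_m) (r : nat) (z : R[i]) : R[i] :=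
  F r z i 0.

Lemma at_cuspE m (s : 'M[R]_2) k d (F : nat -> R[i] -> 'cV[R[i]]_m) t z i :
  at_cusp s k d F t z i 0 = scusp s k d (comp F i) t z.
Proof.
rewrite /at_cusp /scusp summxE big_mkcond; apply: eq_bigr => r _.
case: ifP => h; first by rewrite mxE.
by rewrite bin_small ?mul0r //; move: h; lia.
Qed.

(** Nothing is raised into component 0, so there [sdl] is [d/dtau]; this identifies component 0 of
    the bracket family with the bracket. *)
Lemma iter_sdl0 m d (F : nat -> R[i] -> 'cV[R[i]]_m) i j :
  iter j (sdl d) (comp F i) 0%N = fun z => iter j (@dtau R m) (F 0%N) z i 0.
Proof.
elim: j => [//|j IH]; rewrite !iterS /= IH.
by apply/funext => z; rewrite mxE.
Qed.

Definition bracket_family (d e n : nat) (c : nat -> R[i]) m p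
    (F : nat -> R[i] -> 'cV[R[i]]_m) (G : nat -> R[i] -> 'cV[R[i]]_p)
    (t : nat) (z : R[i]) : 'cV[R[i]]_(m * p) :=
  \col_i sbr d e n c (comp F (mxtens_unindex i).1) (comp G (mxtens_unindex i).2) t z.

Lemma comp_bracket_family d e n c m p (F : nat -> R[i] -> 'cV[R[i]]_m)
    (G : nat -> R[i] -> 'cV[R[i]]_p) i :
  comp (bracket_family d e n c F G) i =
  sbr d e n c (comp F (mxtens_unindex i).1) (comp G (mxtens_unindex i).2).
Proof. by apply/funext => t; apply/funext => z; rewrite /comp mxE. Qed.

Lemma bracket_family0 d e n (c : nat -> R[i]) m p (F : nat -> R[i] -> 'cV[R[i]]_m)
    (G : nat -> R[i] -> 'cV[R[i]]_p) (c' : 'rV[R[i]]_n.+1) :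
  (forall r : 'I_n.+1, c' 0 r = c r) ->
  bracket_family d e n c F G 0%N = bracket c' (F 0%N) (G 0%N).
Proof.
move=> cc; apply/funext => z; apply/matrixP => i j; rewrite ord1 mxE sbr0 summxE.
apply: eq_bigr => r _; rewrite !iter_sdl0 cc [RHS]mxE; congr (_ * _).
by rewrite [RHS]mxE !ord1.
Qed.

Section Law.
Variables (s : 'M[R]_2) (k l : int) (d e n m p : nat).
Variables (F : nat -> R[i] -> 'cV[R[i]]_m) (G : nat -> R[i] -> 'cV[R[i]]_p).
Variables (A : 'M[R[i]]_m) (B : 'M[R[i]]_p) (U : R[i] -> Prop).
Hypothesis ds : \det s = 1.
Hypothesis Uopen : forall z, U z -> cnear z U.
Hypothesis Uup : forall z, U z -> upper_half_plane z.
Hypothesis UF : forall z i, U z -> sregular d (comp F i) z /\ sregular d (comp F i) (mobius s z).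
Hypothesis UG : forall z i, U z -> sregular e (comp G i) z /\ sregular e (comp G i) (mobius s z).
Hypothesis lawF : forall z, U z -> F 0%N (mobius s z) =
  \sum_(r < d.+1) (autj s z ^ (k - r%:Z) * autj' s ^+ r) *: (A *m F r z).
Hypothesis lawG : forall z, U z -> G 0%N (mobius s z) =
  \sum_(r < e.+1) (autj s z ^ (l - r%:Z) * autj' s ^+ r) *: (B *m G r z).

(** Dividing by [j^K] turns [(j')^r / j^r] into powers of [X = c/j], and on the left [curve_scusp]
    sees only component 0. *)
Lemma law_curve q (K : int) D (H : nat -> R[i] -> 'cV[R[i]]_q) (M : 'M[R[i]]_q) z :
  upper_half_plane z ->
  (H 0%N (mobius s z) = \sum_(r < D.+1) (autj s z ^ (K - r%:Z) * autj' s ^+ r) *: (M *m H r z)) <->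
  forall i, curve s D (scusp s K D (comp H i)) z = \sum_j M i j * curve s D (comp H j) z.
Proof.
move=> z0; have j0 := autj_neq0 ds z0.
have E i : (\sum_(r < D.+1) (autj s z ^ (K - r%:Z) * autj' s ^+ r) *: (M *m H r z)) i 0 =
   autj s z ^ K * \sum_j M i j * curve s D (comp H j) z.
  rewrite summxE /curve /gen; under [in RHS]eq_bigr do rewrite mulr_sumr.
  rewrite [X in _ = _ * X]exchange_big /= mulr_sumr; apply: eq_bigr => r _.
  rewrite !mxE !mulr_sumr; apply: eq_bigr => j _.
  rewrite expfzDr // (_ : autj s z ^ (- r%:Z) = (autj s z)^-1 ^+ r); last by rewrite exprVn -exprnN.
  by rewrite /comp /xj mulNr opprK exprMn; ring.
split=> [L i|L].
  rewrite curve_scusp // {1}/comp L E mulrA -expfzDr // addNr expr0z mul1r //.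
apply/matrixP => i j; rewrite ord1 E -L curve_scusp // mulrA -expfzDr // subrr expr0z mul1r //.
Qed.

(** On the curve the slashed families are combinations of the original ones with constant matrix
    entries. [curve_iter_linear] keeps this under [sdl], and bilinearity of the bracket then
    produces the entries of the tensor product of [A] and [B]. *)
Lemma bracket_law z : U z ->
  bracket_family d e n (rcc R (k - d%:Z) (l - e%:Z) n) F G 0%N (mobius s z) =
  \sum_(r < (d + e).+1) (autj s z ^ (k + l + (2 * n)%:Z - r%:Z) * autj' s ^+ r) *:
    ((A *t B) *m bracket_family d e n (rcc R (k - d%:Z) (l - e%:Z) n) F G r z).
Proof.
move=> Uz; set c := rcc R _ _ n; have z0 := Uup Uz.
have RF i w : U w -> upper_half_plane w /\ sregular d (comp F i) (mobius s w).
  by move=> Uw; split; [exact: Uup|case: (UF i Uw)].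
have RG i w : U w -> upper_half_plane w /\ sregular e (comp G i) (mobius s w).
  by move=> Uw; split; [exact: Uup|case: (UG i Uw)].
apply/(law_curve _ _ _ _ z0) => i; rewrite comp_bracket_family.
set i1 := (mxtens_unindex i).1; set i2 := (mxtens_unindex i).2.
have cF r : curve s d (iter r (sdl d) (scusp s k d (comp F i1))) z =
    \sum_j A i1 j * curve s d (iter r (sdl d) (comp F j)) z.
  apply: (curve_iter_linear ds Uopen Uup) => //.
  - by move=> w Uw; exact: (iter_scusp_sregular k ds Uopen (RF i1)).
  - by move=> j w Uw; case: (UF j Uw).
  - by move=> w Uw; exact: ((law_curve k d F A (Uup Uw)).1 (lawF Uw) i1).
have cG r : curve s e (iter r (sdl e) (scusp s l e (comp G i2))) z =
    \sum_j B i2 j * curve s e (iter r (sdl e) (comp G j)) z.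
  apply: (curve_iter_linear ds Uopen Uup) => //.
  - by move=> w Uw; exact: (iter_scusp_sregular l ds Uopen (RG i2)).
  - by move=> j w Uw; case: (UG j Uw).
  - by move=> w Uw; exact: ((law_curve l e G B (Uup Uw)).1 (lawG Uw) i2).
transitivity (curve s (d + e) (sbr d e n c (scusp s k d (comp F i1)) (scusp s l e (comp G i2))) z).
  by apply: gen_ext => t td; rewrite (scusp_sbr k l n ds Uopen (RF i1) (RG i2)).
rewrite /curve gen_sbr.
transitivity (\sum_(r < n.+1) \sum_j \sum_j' c r * ((A i1 j * curve s d (iter r (sdl d) (comp F j)) z) *
    (B i2 j' * curve s e (iter (n - r) (sdl e) (comp G j')) z))).
  apply: eq_bigr => r _; rewrite -/(curve s d _ z) -/(curve s e _ z) cF cG mulr_suml mulr_sumr.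
  by apply: eq_bigr => j _; rewrite !mulr_sumr.
rewrite (reindex (@mxtens_index m p)) /=; last first.
  by exists (@mxtens_unindex m p) => q _; rewrite ?mxtens_indexK ?mxtens_unindexK.
rewrite exchange_big /=; under eq_bigr do rewrite exchange_big /=.
rewrite pair_big /=; apply: eq_bigr => -[j j'] _ /=.
rewrite comp_bracket_family mxtens_indexK gen_sbr mulr_sumr; apply: eq_bigr => r _.
by rewrite mxE mxtens_indexK /= /curve; ring.
Qed.

End Law.

Lemma sum_ge_norm q (f : 'I_q -> R) i : f i <= \sum_i `|f i|.
Proof.
apply: le_trans (ler_norm _) _; rewrite (bigD1 i) //= lerDl.
by apply: sumr_ge0.
Qed.

(** Constants are chosen coordinate by coordinate and made uniform by summing their absolute
    values. *)
Lemma bounded_at_iooP q (h : R[i] -> 'cV[R[i]]_q) :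
  bounded_at_ioo h <-> forall i, bnd (fun z => h z i 0).
Proof.
split.
  by move=> [M [Y H]] i; exists M, Y => z /H /(_ i); rewrite lecR.
move=> /(_ _)/cid-/all_sig[M] H; have {}H i := cid (H i); have /all_sig[Y {}H] := H.
exists (\sum_i `|M i|), (\sum_i `|Y i|) => z hz i; rewrite lecR.
by apply: le_trans (sum_ge_norm M i); apply: H; apply: le_trans hz; exact: sum_ge_norm.
Qed.

Lemma exp_growth_at_iooP q (h : R[i] -> 'cV[R[i]]_q) :
  exp_growth_at_ioo h <-> forall i, expg (fun z => h z i 0).
Proof.
split.
  by move=> [B [M [Y H]]] i; exists B, M, Y => z /H /(_ i); rewrite lecR.
move=> H; have {}H i := cid (H i); have /all_sig[B {}H] := H.
have {}H i := cid (H i); have /all_sig[M {}H] := H.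
have {}H i := cid (H i); have /all_sig[Y {}H] := H.
exists (\sum_i `|B i|), (\sum_i `|M i|), (\sum_i `|Y i|) => z hz i; rewrite lecR.
have z0 : 0 <= complex.Im z by apply: le_trans hz; apply: sumr_ge0.
apply: (@le_trans _ _ (B i * expR (M i * complex.Im z))).
  by apply: H; apply: le_trans hz; exact: sum_ge_norm.
apply: (@le_trans _ _ ((\sum_i `|B i|) * expR (M i * complex.Im z))).
  by rewrite ler_wpM2r ?expR_ge0 // sum_ge_norm.
by apply: ler_wpM2l; [exact: sumr_ge0|rewrite ler_expR ler_wpM2r // sum_ge_norm].
Qed.

Lemma vanishing_at_iooP q (h : R[i] -> 'cV[R[i]]_q) :
  vanishing_at_ioo h <-> forall i, van (fun z => h z i 0).
Proof.
split.
  by move=> H i e /H[Y HY]; exists Y => z /HY /(_ i); rewrite lecR.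
move=> H e e0; have {}H i := cid (H i e e0); have /all_sig[Y {}H] := H.
exists (\sum_i `|Y i|) => z hz i; rewrite lecR.
by apply: H; apply: le_trans hz; exact: sum_ge_norm.
Qed.

End VectorValued.

(** * Brackets of quasi-modular forms of each regularity *)

Section Preservation.
Variable R : realType.

Definition regular_at (star : regularity) : (R[i] -> R[i]) -> R[i] -> Prop :=
  match star with an | sing => @real_ana R | _ => @holo R end.

Lemma regular_at_sregular star d (F : nat -> R[i] -> R[i]) z :
  (forall r, (r <= d)%N -> regular_at star (F r) z) -> sregular d F z.
Proof.
by case: star; first [exact: holo_sregular|exact: real_ana_sregular].
Qed.

Lemma regularity_on_HP star S m (f : R[i] -> 'cV[R[i]]_m) : singular_set star S ->
  regularity_on_H star S f <->
  forall a i, upper_half_plane a -> (~ S a -> regular_at star (fun z => f z i 0) a) /\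
    (match star with mer | merc => meromorphic_at (fun z => f z i 0) a | _ => True end).
Proof.
move=> HS; rewrite /regularity_on_H /coordwise; split=> H a.
  move=> i a0; have {H} := H a a0; case: star HS => /= HS H; try by split=> // Sa; exact/real_analyticP/H.
  - by move: H => [H1 H2]; split=> // Sa; exact/holomorphicP/H1.
  - by move: H => [H1 H2]; split=> // Sa; exact/holomorphicP/H1.
  - by split=> // _; exact/holomorphicP.
  - by split=> // _; exact/holomorphicP.
  - by split=> // _; exact/holomorphicP.
move=> a0; case: star HS H => /= HS H.
- by move=> Sa i; apply/real_analyticP; exact: (H a i a0).1.
- by move=> Sa i; apply/real_analyticP; exact: (H a i a0).1.
- by split=> [Sa|] i; [apply/holomorphicP; exact: (H a i a0).1|exact: (H a i a0).2].
- by split=> [Sa|] i; [apply/holomorphicP; exact: (H a i a0).1|exact: (H a i a0).2].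
- by move=> i; apply/holomorphicP; apply: (H a i a0).1; rewrite HS.
- by move=> i; apply/holomorphicP; apply: (H a i a0).1; rewrite HS.
- by move=> i; apply/holomorphicP; apply: (H a i a0).1; rewrite HS.
Qed.

Lemma discrete_in_H_near (S : set R[i]) a : discrete_in_H S -> upper_half_plane a ->
  ~ S a -> cnear a (fun z => ~ S z).
Proof.
move=> HS a0 Sa; have := HS a a0; rewrite /limit_point /=.
move=> /existsNP[V /not_implyP[nV HV]].
have {nV} : nbhs (a : R[i]^o) V by [].
rewrite -nbhs_ballE => -[e e0 He].
have [e' e'0 Ee] : exists2 e' : R, 0 < e' & e = e'%:C.
  move: e0 => /=; rewrite ltcE; case: e {He} => x y /= /andP[/eqP -> x0].
  by exists x.
exists e' => // w hw Sw; apply: HV; exists (a + w); split=> //.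
  by apply/eqP => E; apply: Sa; rewrite -E.
by apply: He; rewrite /ball /= Ee opprD addNKr normrN -[`|_|]/((nm _)%:C) ltcR.
Qed.

Lemma singular_near star (S : set R[i]) a : singular_set star S -> upper_half_plane a ->
  ~ S a -> cnear a (fun z => ~ S z).
Proof.
case: star => /= HS a0 Sa; try exact: discrete_in_H_near.
all: by exists 1 => // w _; rewrite HS.
Qed.

Lemma discrete_in_HU (S1 S2 : set R[i]) : discrete_in_H S1 -> discrete_in_H S2 ->
  discrete_in_H (S1 `|` S2).
Proof.
move=> H1 H2 a a0 L; have := H1 a a0; rewrite /limit_point /= => /existsNP[V /not_implyP[nV HV]].
have := H2 a a0; rewrite /limit_point /= => /existsNP[W /not_implyP[nW HW]].
have [y [ya [Sy|Sy] [Vy Wy]]] := L (V `&` W) (filterI nV nW).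
  by apply: HV; exists y.
by apply: HW; exists y.
Qed.

Lemma singular_setU star (S1 S2 : set R[i]) : singular_set star S1 -> singular_set star S2 ->
  singular_set star (S1 `|` S2).
Proof.
by case: star => /= H1 H2; try exact: discrete_in_HU; rewrite H1 H2 setU0.
Qed.

Lemma mobius_near (s : 'M[R]_2) z (P : R[i] -> Prop) : \det s = 1 -> upper_half_plane z ->
  cnear (mobius s z) P -> cnear z (fun w => P (mobius s w)).
Proof.
move=> ds z0 [e e0 He]; have [d d0 Hd] := bigO_cont (tay_lin (tay_mobius 0 ds z0)) e0.
exists d => // w /Hd; rewrite add0r => /He; by rewrite addrC subrK.
Qed.

Section Bracket.
Variables (Gamma : set 'M[R]_2) (m p : nat) (k l : int) (d e n : nat).
Variables (rho : 'M[R]_2 -> 'M[R[i]]_m) (eta : 'M[R]_2 -> 'M[R[i]]_p).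
Variable star : regularity.
Variables (F : nat -> R[i] -> 'cV[R[i]]_m) (G : nat -> R[i] -> 'cV[R[i]]_p).
Variables S1 S2 : set R[i].
Hypothesis detG : forall g, Gamma g -> \det g = 1.
Hypotheses (HS1 : singular_set star S1) (HS2 : singular_set star S2).
Hypothesis regF : forall r, (r <= d)%N -> regularity_on_H star S1 (F r).
Hypothesis regG : forall r, (r <= e)%N -> regularity_on_H star S2 (G r).
Hypothesis lawF : forall g z, Gamma g -> upper_half_plane z -> ~ S1 z -> ~ S1 (mobius g z) ->
  F 0%N (mobius g z) =
  \sum_(r < d.+1) (autj g z ^ (k - r%:Z) * autj' g ^+ r) *: (rho g *m F r z).
Hypothesis lawG : forall g z, Gamma g -> upper_half_plane z -> ~ S2 z -> ~ S2 (mobius g z) ->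
  G 0%N (mobius g z) =
  \sum_(r < e.+1) (autj g z ^ (l - r%:Z) * autj' g ^+ r) *: (eta g *m G r z).

Let B := bracket_family d e n (rcc R (k - d%:Z) (l - e%:Z) n) F G.

Lemma regF_comp i r a : upper_half_plane a -> ~ S1 a -> (r <= d)%N -> regular_at star (comp F i r) a.
Proof.
by move=> a0 Sa rd; have /(regularity_on_HP _ HS1)/(_ a i a0)[/(_ Sa)] := regF rd.
Qed.

Lemma regG_comp i r a : upper_half_plane a -> ~ S2 a -> (r <= e)%N -> regular_at star (comp G i r) a.
Proof.
by move=> a0 Sa rd; have /(regularity_on_HP _ HS2)/(_ a i a0)[/(_ Sa)] := regG rd.
Qed.

Lemma bracket_regular t : regularity_on_H star (S1 `|` S2) (B t).
Proof.
apply/(regularity_on_HP _ (singular_setU HS1 HS2)) => a i a0.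
have -> : (fun z => B t z i 0) = sbr d e n (rcc R (k - d%:Z) (l - e%:Z) n)
    (comp F (mxtens_unindex i).1) (comp G (mxtens_unindex i).2) t.
  by rewrite -comp_bracket_family.
split.
  move=> /not_orP[Sa1 Sa2].
  have HA : diff_algebra (fun h => regular_at star h a).
    by case: (star); first [exact: holo_algebra|exact: real_ana_algebra].
  by apply: (da_sbr HA) => r rd; [exact: regF_comp|exact: regG_comp].
have HM : match star with mer | merc => True | _ => False end -> meromorphic_at
   (sbr d e n (rcc R (k - d%:Z) (l - e%:Z) n)
    (comp F (mxtens_unindex i).1) (comp G (mxtens_unindex i).2) t) a.
  move=> Hs; apply: (da_sbr (mero_algebra a)) => r rd.
    have /(regularity_on_HP _ HS1)/(_ a (mxtens_unindex i).1 a0)[_] := regF rd.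
    by case: (star) Hs.
  have /(regularity_on_HP _ HS2)/(_ a (mxtens_unindex i).2 a0)[_] := regG rd.
  by case: (star) Hs.
by case: (star) HM => // /(_ I).
Qed.

Lemma bracket_transforms g z : Gamma g -> upper_half_plane z ->
  ~ (S1 `|` S2) z -> ~ (S1 `|` S2) (mobius g z) ->
  B 0%N (mobius g z) = \sum_(r < (d + e).+1)
    (autj g z ^ (k + l + (2 * n)%:Z - r%:Z) * autj' g ^+ r) *: (tensor_rep rho eta g *m B r z).
Proof.
move=> Gg z0 Sz Sgz; have dg := detG Gg.
(* Open, and free of singularities at [w] and at its image, so that both families can be
   differentiated at both points. *)
pose U w := [/\ upper_half_plane w, ~ (S1 `|` S2) w & ~ (S1 `|` S2) (mobius g w)].
have HS := singular_setU HS1 HS2.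
apply: (@bracket_law _ g k l d e n m p F G (rho g) (eta g) U dg) => //.
- move=> w [w0 Sw Sgw]; have n1 := upper_near w0; have n2 := singular_near HS w0 Sw.
  have n3 := mobius_near dg w0 (singular_near HS (mobius_upper dg w0) Sgw).
  by apply: cnear_sub (cnear_and n1 (cnear_and n2 n3)) => v [? [? ?]].
- by move=> w [].
- move=> w i [w0 /not_orP[Sw1 Sw2] /not_orP[Sgw1 Sgw2]]; split.
    by apply: (@regular_at_sregular star) => r rd; exact: regF_comp.
  by apply: (@regular_at_sregular star) => r rd; apply: regF_comp => //; exact: mobius_upper.
- move=> w i [w0 /not_orP[Sw1 Sw2] /not_orP[Sgw1 Sgw2]]; split.
    by apply: (@regular_at_sregular star) => r rd; exact: regG_comp.
  by apply: (@regular_at_sregular star) => r rd; apply: regG_comp => //; exact: mobius_upper.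
- by move=> w [w0 /not_orP[? ?] /not_orP[? ?]]; exact: lawF.
- by move=> w [w0 /not_orP[? ?] /not_orP[? ?]]; exact: lawG.
Qed.

Section AtCusp.
Variables (s : 'M[R]_2) (Y : R).
Hypothesis ds : \det s = 1.
Hypothesis Y0 : 0 <= Y.
Hypothesis HF : forall i r z, (r <= d)%N -> high Y z -> holo (comp F i r) (mobius s z).
Hypothesis HG : forall i r z, (r <= e)%N -> high Y z -> holo (comp G i r) (mobius s z).

Lemma high_upper z : high Y z -> upper_half_plane z.
Proof. by rewrite /high /upper_half_plane /= => /(le_lt_trans Y0). Qed.

Lemma tayF i j r z : (r <= d)%N -> high Y z -> tay 4 (iter j (sdl d) (scusp s k d (comp F i)) r) z.
Proof.
apply: (tay_iter_scusp k ds (@high_near R Y)) => w hw; split; first exact: high_upper.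
by move=> q qd; exact: HF.
Qed.

Lemma tayG i j r z : (r <= e)%N -> high Y z -> tay 4 (iter j (sdl e) (scusp s l e (comp G i)) r) z.
Proof.
apply: (tay_iter_scusp l ds (@high_near R Y)) => w hw; split; first exact: high_upper.
by move=> q qd; exact: HG.
Qed.

(** The expansion at the cusp is again a bracket, of the expansions of [F] and [G], so these decide
    its growth. Above height [Y] nothing is singular; [Y] is 0 for forms holomorphic on the upper
    half-plane. *)
Lemma at_cusp_bracket i t z : (t <= d + e)%N -> Y + 1 <= complex.Im z ->
  sbr d e n (rcc R (k - d%:Z) (l - e%:Z) n) (scusp s k d (comp F (mxtens_unindex i).1))
    (scusp s l e (comp G (mxtens_unindex i).2)) t z =
  at_cusp s (k + l + (2 * n)%:Z) (d + e) B t z i 0.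
Proof.
move=> tde hz; rewrite at_cuspE comp_bracket_family.
have hz' : high Y z by rewrite /high; lra.
rewrite (scusp_sbr k l n ds (@high_near R Y)) // => w hw; split; try exact: high_upper.
  by apply: holo_sregular => r rd; exact: HF.
by apply: holo_sregular => r rd; exact: HG.
Qed.

Lemma cusp_growth P i t : growth P ->
  (forall i t, (t <= d)%N -> P (fun z => at_cusp s k d F t z i 0)) ->
  (forall i t, (t <= e)%N -> P (fun z => at_cusp s l e G t z i 0)) -> (t <= d + e)%N ->
  P (fun z => at_cusp s (k + l + (2 * n)%:Z) (d + e) B t z i 0).
Proof.
move=> HP PF PG tde; apply: (gr_ext HP (Y := Y + 1)); first by move=> z hz; exact: at_cusp_bracket.
apply: (gr_sbr HP); [exact: tayF|exact: tayG| |] => r rd.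
  by apply: (gr_ext HP (Y := 0)) (PF (mxtens_unindex i).1 r rd) => z _; rewrite at_cuspE.
by apply: (gr_ext HP (Y := 0)) (PG (mxtens_unindex i).2 r rd) => z _; rewrite at_cuspE.
Qed.

Lemma cusp_vanishing i :
  (forall i t, (t <= d)%N -> bnd (fun z => at_cusp s k d F t z i 0)) ->
  (forall i t, (t <= e)%N -> bnd (fun z => at_cusp s l e G t z i 0)) ->
  (0 < n)%N \/ (forall i, van (fun z => at_cusp s k d F 0 z i 0)) ->
  van (fun z => at_cusp s (k + l + (2 * n)%:Z) (d + e) B 0 z i 0).
Proof.
move=> PF PG Hn; apply: (@van_ext _ (Y + 1)); first by move=> z hz; exact: at_cusp_bracket.
apply: (@van_sbr0 _ Y); [exact: tayF|exact: tayG| | |].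
- move=> r rd; apply: (gr_ext (bnd_growth R) (Y := 0)) (PF (mxtens_unindex i).1 r rd) => z _.
  by rewrite at_cuspE.
- move=> r rd; apply: (gr_ext (bnd_growth R) (Y := 0)) (PG (mxtens_unindex i).2 r rd) => z _.
  by rewrite at_cuspE.
- case: Hn => [|Hv]; [by left|right].
  by apply: (@van_ext _ 0) (Hv (mxtens_unindex i).1) => z _; rewrite at_cuspE.
Qed.

End AtCusp.
End Bracket.

Lemma holo_at_cusp star S m d (F : nat -> R[i] -> 'cV[R[i]]_m) (s : 'M[R]_2) Y :
  match star with an | sing => False | _ => True end -> singular_set star S ->
  (forall r, (r <= d)%N -> regularity_on_H star S (F r)) -> \det s = 1 -> 0 <= Y ->
  (forall z, Y < complex.Im z -> ~ S (mobius s z)) ->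
  forall i r z, (r <= d)%N -> high Y z -> holo (comp F i r) (mobius s z).
Proof.
move=> Hs HS H ds Y0 HY i r z rd hz.
have z0 : upper_half_plane z by exact: le_lt_trans hz.
have /(regularity_on_HP _ HS)/(_ _ i (mobius_upper ds z0))[/(_ (HY _ hz))] := H r rd.
by case: (star) Hs.
Qed.

(** Two regularities serve both claims at once: the components of the bracket are the same, and
    passing from [hol] to [cusp] changes only the condition at the cusps. *)
Lemma bracket_quasimodular (Gamma : set 'M[R]_2) (m p : nat) (k l : int) (d e n : nat)
    (rho : 'M[R]_2 -> 'M[R[i]]_m) (eta : 'M[R]_2 -> 'M[R[i]]_p) (star star' : regularity)
    (f : R[i] -> 'cV[R[i]]_m) (g : R[i] -> 'cV[R[i]]_p) :
  (forall g, Gamma g -> \det g = 1) ->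
  star' = star \/ [/\ star = hol, star' = cusp & (1 <= n)%N] ->
  quasimodular Gamma rho star k d f -> quasimodular Gamma eta star l e g ->
  quasimodular Gamma (tensor_rep rho eta) star' (k + l + (2 * n)%:Z) (d + e)
    (bracket (rc_coef k l d e n) f g).
Proof.
move=> detG Hstar [F [S1 [F0 HS1 regF lawF cuspF]]] [G [S2 [G0 HS2 regG lawG cuspG]]].
pose B := bracket_family d e n (rcc R (k - d%:Z) (l - e%:Z) n) F G.
have HS := singular_setU HS1 HS2.
have RB t := @bracket_regular m p k l d e n star F G S1 S2 HS1 HS2 regF regG t.
have B0 : B 0%N = bracket (rc_coef k l d e n) f g.
  by rewrite -F0 -G0 -(@bracket_family0 _ d e n (rcc R (k - d%:Z) (l - e%:Z) n)) // => r; rewrite rc_coefE.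
exists B, (S1 `|` S2); split=> //.
- by case: Hstar HS => [->|[-> -> _]].
- move=> t _; have := RB t; by case: Hstar => [->|[-> -> _]].
- move=> h z Gh z0 Sz Sgz.
  rewrite -F0 in lawF; rewrite -G0 in lawG.
  rewrite -B0.
  exact: (@bracket_transforms Gamma m p k l d e n rho eta star F G S1 S2).
- move=> s cs; have ds := cs.1; have {cuspF} := cuspF s cs; have {cuspG} := cuspG s cs.
  have Hhol : match star with hol | cusp | wh => True | _ => False end ->
    (forall i r z, (r <= d)%N -> high 0 z -> holo (comp F i r) (mobius s z)) /\
    (forall i r z, (r <= e)%N -> high 0 z -> holo (comp G i r) (mobius s z)).
    move=> Hs; split.
      apply: (@holo_at_cusp star S1) => //; first by case: (star) Hs.
      by move=> z _; move: HS1; case: (star) Hs => //= _ -> [].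
    apply: (@holo_at_cusp star S2) => //; first by case: (star) Hs.
    by move=> z _; move: HS2; case: (star) Hs => //= _ -> [].
  case: Hstar => [->|[Es -> np]].
    case: (star) HS1 HS2 regF regG Hhol => //= HS1' HS2' regF' regG' Hhol cG cF.
    + move: cF cG => [[Y1 HY1] eF] [[Y2 HY2] eG].
      set Y := Num.max 0 (Num.max Y1 Y2).
      have [y0 [y1 y2]] : 0 <= Y /\ Y1 <= Y /\ Y2 <= Y by rewrite !le_max !lexx !orbT.
      split.
        exists Y => z hz [|]; [apply: HY1|apply: HY2]; lra.
      move=> t tde; apply/exp_growth_at_iooP => i.
      apply: (@cusp_growth m p k l d e n F G s Y) => //.
      * apply: (@holo_at_cusp merc S1) => // z hz; apply: HY1; lra.
      * apply: (@holo_at_cusp merc S2) => // z hz; apply: HY2; lra.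
      * exact: expg_growth.
      * by move=> q r rd; exact/(exp_growth_at_iooP _).1/eF.
      * by move=> q r rd; exact/(exp_growth_at_iooP _).1/eG.
    + move=> t tde; apply/bounded_at_iooP => i; have [hF hG] := Hhol I.
      apply: (@cusp_growth m p k l d e n F G s 0) => //.
      * exact: bnd_growth.
      * by move=> q r rd; exact/(bounded_at_iooP _).1/cF.
      * by move=> q r rd; exact/(bounded_at_iooP _).1/cG.
    + move: cF cG => [cF vF] [cG vG]; have [hF hG] := Hhol I.
      have bF q r : (r <= d)%N -> bnd (fun z => at_cusp s k d F r z q 0).
        by move=> rd; exact/(bounded_at_iooP _).1/cF.
      have bG q r : (r <= e)%N -> bnd (fun z => at_cusp s l e G r z q 0).
        by move=> rd; exact/(bounded_at_iooP _).1/cG.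
      split; first move=> t tde; [apply/bounded_at_iooP => i|apply/vanishing_at_iooP => i].
        by apply: (@cusp_growth m p k l d e n F G s 0) => //; exact: bnd_growth.
      apply: (@cusp_vanishing m p k l d e n F G s 0) => //.
      by right; exact/(vanishing_at_iooP _).1.
    + move=> t tde; apply/exp_growth_at_iooP => i; have [hF hG] := Hhol I.
      apply: (@cusp_growth m p k l d e n F G s 0) => //.
      * exact: expg_growth.
      * by move=> q r rd; exact/(exp_growth_at_iooP _).1/cF.
      * by move=> q r rd; exact/(exp_growth_at_iooP _).1/cG.
  subst star => cG cF; have [hF hG] := Hhol I.
  have bF q r : (r <= d)%N -> bnd (fun z => at_cusp s k d F r z q 0).
    by move=> rd; exact/(bounded_at_iooP _).1/cF.
  have bG q r : (r <= e)%N -> bnd (fun z => at_cusp s l e G r z q 0).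
    by move=> rd; exact/(bounded_at_iooP _).1/cG.
  split; first move=> t tde; [apply/bounded_at_iooP => i|apply/vanishing_at_iooP => i].
    by apply: (@cusp_growth m p k l d e n F G s 0) => //; exact: bnd_growth.
  by apply: (@cusp_vanishing m p k l d e n F G s 0) => //; left.
Qed.

End Preservation.

(** * SL_2(Z) and its fundamental domain *)

Section ModularGroup.
Variable R : realType.
Implicit Types (g h : 'M[R]_2) (z w : R[i]).

Definition SL2Z : set 'M[R]_2 :=
  [set g | \det g = 1 /\ forall i j, g i j \is a Num.int].

Lemma mulmx2E g h i j : (g *m h) i j = g i 0 * h 0 j + g i 1 * h 1 j.
Proof.
rewrite mxE !big_ord_recl big_ord0 addr0.
by congr (g i _ * h _ j + g i _ * h _ j); apply/val_inj.
Qed.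

Definition mx2 (a b c d : R) : 'M[R]_2 :=
  \matrix_(i, j) (if i == 0 then if j == 0 then a else b else if j == 0 then c else d).

Lemma mx2E a b c d : (mx2 a b c d 0 0 = a) * (mx2 a b c d 0 1 = b) *
  (mx2 a b c d 1 0 = c) * (mx2 a b c d 1 1 = d).
Proof. by rewrite !mxE. Qed.

Lemma ord2P (P : 'I_2 -> Prop) : P 0 -> P 1 -> forall i, P i.
Proof.
by move=> P0 P1 [[|[|//]] hi]; [have -> : Ordinal hi = 0|have -> : Ordinal hi = 1]; rewrite //; apply/val_inj.
Qed.

Lemma det_mx2 a b c d : \det (mx2 a b c d) = a * d - b * c.
Proof. by rewrite det2 !mx2E. Qed.

Lemma invmx2 g : \det g = 1 -> invmx g = mx2 (g 1 1) (- g 0 1) (- g 1 0) (g 0 0).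
Proof.
move=> dg; have ug : g \in unitmx by rewrite unitmxE dg unitr1.
apply: (can_inj (mulKmx ug)); rewrite mulmxV //.
have := det2 g; rewrite dg => D.
apply/matrixP; apply: ord2P; apply: ord2P; rewrite mulmx2E !mx2E mxE /=.
- by rewrite D; ring.
- by ring.
- by ring.
- by rewrite D; ring.
Qed.

Lemma SL2Z_mx2 a b c d : a \is a Num.int -> b \is a Num.int -> c \is a Num.int ->
  d \is a Num.int -> a * d - b * c = 1 -> SL2Z (mx2 a b c d).
Proof.
move=> ha hb hc hd D; split; first by rewrite det_mx2.
by apply: ord2P; apply: ord2P; rewrite mx2E.
Qed.

Lemma SL2Z_subgroup : SL2_subgroup SL2Z.
Proof.
split.
- by move=> g [].
- by split; [exact: det1|move=> i j; rewrite mxE rpredMn // rpred1].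
- move=> g h [dg ig] [dh ih]; split; first by rewrite det_mulmx dg dh mulr1.
  by move=> i j; rewrite mulmx2E rpredD // rpredM.
- move=> g [dg ig]; rewrite invmx2 //; apply: SL2Z_mx2; rewrite ?rpredN //.
  by have := det2 g; rewrite dg => ->; ring.
Qed.

Lemma int_lt1 (a b : R) : a \is a Num.int -> b \is a Num.int -> `|a - b| < 1 -> a = b.
Proof.
move=> /intrP[m ->] /intrP[n ->]; rewrite -intrB -intr_norm -[1]/(1%:~R) ltr_int => h.
by congr (_%:~R); lia.
Qed.

(** Balls of matrices are taken entrywise, and integers at distance less than 1 are equal. *)
Lemma SL2Z_discrete : SL2Z `<=` isolated SL2Z.
Proof.
move=> g Gg; split; first by rewrite inE.
exists (ball g (1 : R)); first exact: nbhsx_ballx.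
apply/seteqP; split=> [h [[_ /= b] [dh ih]]|h ->] /=; last by split=> //; exact: ballxx.
by apply/matrixP => i j; apply/esym/int_lt1 => //; [exact: Gg.2|exact: b].
Qed.

Lemma autj_mul g h z : \det h = 1 -> upper_half_plane z ->
  autj (g *m h) z = autj g (mobius h z) * autj h z.
Proof.
move=> dh z0; have j0 := autj_neq0 dh z0; rewrite /autj !mulmx2E /mobius.
move: j0; rewrite /autj !rmorphD !rmorphM => j0; field; exact: j0.
Qed.

Lemma mobius_mul g h z : \det g = 1 -> \det h = 1 -> upper_half_plane z ->
  mobius (g *m h) z = mobius g (mobius h z).
Proof.
move=> dg dh z0; have j0 := autj_neq0 dh z0.
have j1 := autj_neq0 dg (mobius_upper dh z0).
have E : ((g *m h) 0 0)%:C * z + ((g *m h) 0 1)%:C =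
    ((g 0 0)%:C * mobius h z + (g 0 1)%:C) * autj h z.
  have M : mobius h z * autj h z = (h 0 0)%:C * z + (h 0 1)%:C by rewrite divfK.
  by rewrite mulrDl -mulrA M !mulmx2E /autj !rmorphD !rmorphM; ring.
rewrite /mobius -/(autj (g *m h) z) -/(autj g (mobius h z)) -/(mobius h z) E autj_mul //.
by rewrite -mulf_div divff // mulr1.
Qed.

Lemma mobius1 z : mobius 1%:M z = z.
Proof. by rewrite /mobius !mxE /= mul1r mul0r addr0 add0r divr1. Qed.

Lemma SL2Z_inv g : SL2Z g -> SL2Z (invmx g).
Proof. by have [_ _ _] := SL2Z_subgroup; apply. Qed.

Lemma SL2Z_mul g h : SL2Z g -> SL2Z h -> SL2Z (g *m h).
Proof. by have [_ _ + _] := SL2Z_subgroup; apply. Qed.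

Lemma mobius_inv g z : \det g = 1 -> upper_half_plane z -> mobius (invmx g) (mobius g z) = z.
Proof.
move=> dg z0; rewrite -mobius_mul ?det_inv ?dg ?invr1 // mulVmx ?mobius1 //.
by rewrite unitmxE dg unitr1.
Qed.

(* Half of the boundary is removed, so that every orbit is met exactly once. *)
Definition fund (x y : R) : Prop :=
  [/\ - 2^-1 <= x, x < 2^-1, 0 < y & 1 < x ^+ 2 + y ^+ 2 \/ (x ^+ 2 + y ^+ 2 = 1 /\ x <= 0)].

(** The form is affine in [x], so it suffices to bound it at [x = 1/2] and [x = -1/2], where it is a
    positive definite integral form. *)
Lemma int_form_ge1 (c d x : R) : c \is a Num.int -> d \is a Num.int -> (c, d) != (0, 0) ->
  - 2^-1 <= x <= 2^-1 -> 1 <= c ^+ 2 + 2 * c * d * x + d ^+ 2.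
Proof.
move=> /intrP[m ->] /intrP[n ->] mn /andP[x1 x2].
have {mn} mn : (m != 0) || (n != 0).
  by rewrite -negb_and; apply: contra mn => /andP[/eqP -> /eqP ->].
have h1 : (1 <= m ^+ 2 + m * n + n ^+ 2)%R by move: mn; rewrite !expr2; nia.
have h2 : (1 <= m ^+ 2 - m * n + n ^+ 2)%R by move: mn; rewrite !expr2; nia.
move: h1 h2; rewrite -!(ler_int R) !intrD !intrN !intrM => h1 h2.
case: (lerP 0 (m%:~R * n%:~R : R)) => mn0.
  have := ler_wpM2l mn0 x1; lra.
have := ler_wnM2l (ltW mn0) x2; lra.
Qed.

Lemma nm_autj_sqr g z : nm (autj g z) ^+ 2 =
  (g 1 0) ^+ 2 * (complex.Re z ^+ 2 + complex.Im z ^+ 2) + 2 * g 1 0 * g 1 1 * complex.Re z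
  + (g 1 1) ^+ 2.
Proof. by rewrite nm_sqr Re_autj Im_autj; ring. Qed.

Lemma fund_norm_ge1 x y : fund x y -> 1 <= x ^+ 2 + y ^+ 2.
Proof. by move=> [_ _ _ [/ltW|[->]]]. Qed.

Lemma SL2Z_row_neq0 g : SL2Z g -> (g 1 0, g 1 1) != (0, 0).
Proof.
move=> [dg _]; apply/eqP => -[c0 d0]; move: dg; rewrite det2 c0 d0 !mulr0 subrr => /esym/eqP.
by rewrite oner_eq0.
Qed.

Lemma fund_autj g z : SL2Z g -> fund (complex.Re z) (complex.Im z) ->
  1 + (g 1 0) ^+ 2 * (complex.Re z ^+ 2 + complex.Im z ^+ 2 - 1) <= nm (autj g z) ^+ 2.
Proof.
move=> Gg Fz; have [x1 x2 _ _] := Fz.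
have := @int_form_ge1 (g 1 0) (g 1 1) (complex.Re z) (Gg.2 _ _) (Gg.2 _ _) (SL2Z_row_neq0 Gg).
rewrite x1 (ltW x2) => /(_ isT); rewrite nm_autj_sqr; lra.
Qed.

(** The factors of [g] at [z] and of its inverse at [w] multiply to 1 and both have modulus at least
    1; so both have modulus 1 and the heights agree. If [c = 0], [g] is a translation by an integer
    of size less than 1; otherwise both points lie on the left half of the unit circle. *)
Lemma fund_unique g z w : SL2Z g -> fund (complex.Re z) (complex.Im z) ->
  fund (complex.Re w) (complex.Im w) -> w = mobius g z -> w = z.
Proof.
move=> Gg Fz Fw E; have dg := Gg.1.
have z0 : upper_half_plane z by have [_ _ ? _] := Fz.
have w0 : upper_half_plane w by have [_ _ ? _] := Fw.
have j0 := autj_neq0 dg z0.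
have hz := fund_autj Gg Fz; have hw := fund_autj (SL2Z_inv Gg) Fw.
have jj : autj (invmx g) w * autj g z = 1.
  rewrite E -autj_mul // mulVmx ?unitmxE ?dg ?unitr1 //.
  by rewrite /autj !mxE /= mul0r add0r.
have N1 : nm (autj (invmx g) w) ^+ 2 * nm (autj g z) ^+ 2 = 1.
  by rewrite -exprMn -nmM jj nm1 expr1n.
have nz := fund_norm_ge1 Fz; have nw := fund_norm_ge1 Fw.
have c20 : 0 <= (g 1 0) ^+ 2 by exact: sqr_ge0.
have ic : (invmx g) 1 0 = - g 1 0 by rewrite invmx2 // mx2E.
rewrite ic sqrrN in hw.
have p1 : 0 <= g 1 0 ^+ 2 * (complex.Re z ^+ 2 + complex.Im z ^+ 2 - 1) by rewrite mulr_ge0 // subr_ge0.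
have p2 : 0 <= g 1 0 ^+ 2 * (complex.Re w ^+ 2 + complex.Im w ^+ 2 - 1) by rewrite mulr_ge0 // subr_ge0.
have A1 : nm (autj g z) ^+ 2 = 1.
  apply/eqP; rewrite eq_le; apply/andP; split; last by lra.
  rewrite -N1 -[leLHS]mul1r ler_wpM2r ?sqr_ge0 //; lra.
have A2 : nm (autj (invmx g) w) ^+ 2 = 1 by move: N1; rewrite A1 mulr1.
have yy : complex.Im w = complex.Im z by rewrite E Im_mobius // A1 divr1.
rewrite A1 in hz; rewrite A2 in hw.
have [x1 x2 y0 Bz] := Fz; have [u1 u2 v0 Bw] := Fw.
suff xx : complex.Re w = complex.Re z by move: xx yy; case: (w) (z) => [a b] [c d] /= -> ->.
case: (eqVneq (g 1 0) 0) => [c0|c0].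
  have := det2 g; rewrite dg c0 mulr0 subr0 => ad.
  have E' : w = (g 0 0 * g 0 0)%:C * z + (g 0 1 * g 0 0)%:C.
    have d0 : g 1 1 != 0 by apply/eqP => d0; move: ad; rewrite d0 mulr0 => /eqP; rewrite oner_eq0.
    have -> : w = ((g 0 0)%:C * z + (g 0 1)%:C) / (g 1 1)%:C by rewrite E /mobius c0 mul0r add0r.
    have -> : (g 1 1)%:C^-1 = (g 0 0)%:C :> R[i].
      by rewrite -fmorphV; congr (_%:C); apply: (mulIf d0); rewrite mulVf // -ad.
    by rewrite !rmorphM /=; ring.
  have a1 : g 0 0 * g 0 0 = 1.
    have : complex.Im w = g 0 0 * g 0 0 * complex.Im z.
      by rewrite E'; case: (z) => a b /=; rewrite mul0r !addr0.
    rewrite yy -{1}[complex.Im z]mul1r => /(mulIf (lt0r_neq0 y0)) <- //.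
  have xw : complex.Re w = complex.Re z + g 0 1 * g 0 0.
    by rewrite E' a1; case: (z) => a b /=; rewrite mul0r subr0 mul1r.
  have : g 0 1 * g 0 0 = 0.
    apply: int_lt1; [by rewrite rpredM //; exact: Gg.2|exact: rpred0|].
    have -> : g 0 1 * g 0 0 - 0 = complex.Re w - complex.Re z by rewrite xw; ring.
    by rewrite ltr_norml; apply/andP; split; lra.
  by rewrite xw => ->; rewrite addr0.
have c2 : 0 < g 1 0 ^+ 2 by rewrite lt_def c20 andbT expf_neq0.
have Nz : complex.Re z ^+ 2 + complex.Im z ^+ 2 = 1.
  have : complex.Re z ^+ 2 + complex.Im z ^+ 2 - 1 <= 0 by rewrite -(pmulr_rle0 _ c2); lra.
  lra.
have Nw : complex.Re w ^+ 2 + complex.Im w ^+ 2 = 1.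
  have : complex.Re w ^+ 2 + complex.Im w ^+ 2 - 1 <= 0 by rewrite -(pmulr_rle0 _ c2); lra.
  lra.
have xz : complex.Re z <= 0 by case: Bz => [|[]//]; rewrite Nz ltxx.
have xw : complex.Re w <= 0 by case: Bw => [|[]//]; rewrite Nw ltxx.
have /eqP : complex.Re w ^+ 2 = complex.Re z ^+ 2 by rewrite yy in Nw; lra.
by rewrite eqf_sqr => /orP[/eqP//|/eqP]; lra.
Qed.

(** The identity has [|c z + d| = 1], and values at most 1 come from finitely many lower rows
    [(c, d)], over which a minimum is taken. The least value gives the greatest height in the
    orbit. *)
Lemma SL2Z_max_Im z : upper_half_plane z -> exists2 g, SL2Z g &
  forall h, SL2Z h -> nm (autj g z) ^+ 2 <= nm (autj h z) ^+ 2.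
Proof.
move=> z0; set x := complex.Re z; set y := complex.Im z.
have y0 : 0 < y by [].
(* [|c z + d| <= 1] implies [|c| <= 1/y] and [|d| <= 1 + |x|/y]; [K] bounds both. *)
pose K := 1 + (1 + `|x|) / y.
have K0 : 0 <= K by rewrite addr_ge0 // divr_ge0 ?addr_ge0 // ltW.
pose B := (Num.trunc K).+1.
have KB : K < B%:R by rewrite -truncn_lt_nat.
pose val (i : 'I_(B + B).+1) : R := (i%:Z - B%:Z)%:~R.
pose I := ('I_(B + B).+1 * 'I_(B + B).+1)%type.
pose P (q : I) := `[< exists2 g, SL2Z g & g 1 0 = val q.1 /\ g 1 1 = val q.2 >].
pose f (q : I) := (val q.1) ^+ 2 * (x ^+ 2 + y ^+ 2) + 2 * val q.1 * val q.2 * x + (val q.2) ^+ 2.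
have inB (c : R) : c \is a Num.int -> `|c| <= K -> exists i, c = val i.
  move=> /intrP[a ->] aK.
  have aB : `|a| < B%:Z by rewrite -(ltr_int R) intr_norm; exact: le_lt_trans aK _.
  have hi : (absz (a + B%:Z)%R < (B + B).+1)%N by lia.
  by exists (Ordinal hi); rewrite /val /=; congr (_%:~R); lia.
have S1 : SL2Z 1%:M by have [_ ? _ _] := SL2Z_subgroup.
have [i0 [E1 E2]] : exists q : I, 0 = val q.1 /\ 1 = val q.2.
  have [i1 E1] := inB 0 (rpred0 _) ltac:(by rewrite normr0).
  have [i2 E2] := inB 1 (rpred1 _) ltac:(rewrite normr1 /K lerDl divr_ge0 ?addr_ge0 // ltW //).
  by exists (i1, i2).
have P0 : P i0 by apply/asboolP; exists 1%:M => //; rewrite -E1 -E2 !mxE.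
case: (arg_minP f P0) => q /asboolP[g Gg [g1 g2]] Hmin.
exists g => // h Gh; rewrite !nm_autj_sqr -/x -/y g1 g2 -/(f q).
case: (lerP (nm (autj h z) ^+ 2) 1) => [hle|hgt]; last first.
  apply: (@le_trans _ _ 1); last by move: (ltW hgt); rewrite nm_autj_sqr.
  by have := Hmin i0 P0; rewrite /f -E1 -E2 => /le_trans; apply; lra.
have n1 : nm (autj h z) <= 1 by rewrite -(@ler_pXn2r _ 2) ?nnegrE ?nm_ge0 // expr1n.
have c1 : `|h 1 0| <= y^-1.
  have := le_trans (nm_Im _) n1; rewrite Im_autj normrM -/y (gtr0_norm y0).
  by rewrite -ler_pdivlMr // mul1r.
have yV : 0 < y^-1 by rewrite invr_gt0.
have c2 : `|h 1 0| * `|x| <= `|x| / y by rewrite mulrC ler_wpM2l.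
have cK : `|h 1 0| <= K by apply: le_trans c1 _; rewrite /K mulrDl mul1r; have := mulr_ge0 (normr_ge0 x) (ltW yV); lra.
have dK : `|h 1 1| <= K.
  have := le_trans (nm_Re _) n1; rewrite Re_autj -/x => hr.
  have : `|h 1 1| <= `|h 1 0 * x + h 1 1| + `|h 1 0 * x|.
    by have := ler_normB (h 1 0 * x + h 1 1) (h 1 0 * x); rewrite addrAC subrr add0r.
  by rewrite normrM /K mulrDl mul1r; lra.
have [i1 F1] := inB _ (Gh.2 _ _) cK; have [i2 F2] := inB _ (Gh.2 _ _) dK.
have := Hmin (i1, i2); rewrite /f /= -F1 -F2; apply.
by apply/asboolP; exists h.
Qed.

Lemma mobius_mx2T n z : mobius (mx2 1 n 0 1) z = z + n%:C.
Proof. by rewrite /mobius !mx2E mul1r mul0r add0r divr1. Qed.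

Lemma mobius_mx2S z : mobius (mx2 0 (-1) 1 0) z = - z^-1.
Proof. by rewrite /mobius !mx2E !mul0r mul1r add0r addr0 rmorphN1 mulN1r. Qed.

Lemma fund_exists z : upper_half_plane z ->
  exists2 g, SL2Z g & fund (complex.Re (mobius g z)) (complex.Im (mobius g z)).
Proof.
move=> z0; have [g Gg Hg] := SL2Z_max_Im z0; have dg := Gg.1.
set w := mobius g z; have w0 : upper_half_plane w by exact: mobius_upper.
have Hw h : SL2Z h -> 1 <= nm (autj h w) ^+ 2.
  move=> Gh; have := Hg _ (SL2Z_mul Gh Gg); rewrite autj_mul // nmM exprMn -/w.
  have : 0 < nm (autj g z) ^+ 2 by rewrite exprn_gt0 // nm_gt0 autj_neq0.
  by move=> p0; rewrite -[X in X <= _ -> _]mul1r ler_pM2r.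
pose n : R := - (Num.floor (complex.Re w + 2^-1))%:~R.
have [n1 n2] : - 2^-1 <= complex.Re w + n /\ complex.Re w + n < 2^-1.
  by have := floor_itv (complex.Re w + 2^-1); rewrite intrD /n => /andP[]; lra.
have ni : n \is a Num.int by rewrite rpredN intr_int.
pose T := mx2 1 n 0 1; pose S := mx2 0 (-1) 1 0.
have GT : SL2Z T by apply: SL2Z_mx2; rewrite ?rpred0 ?rpred1 //; ring.
have GS : SL2Z S by apply: SL2Z_mx2; rewrite ?rpredN ?rpred0 ?rpred1 //; ring.
pose v := w + n%:C.
have vE : v = mobius (T *m g) z by rewrite mobius_mul ?GT.1 // mobius_mx2T.
have Re_v : complex.Re v = complex.Re w + n by rewrite /v; case: (w).
have Im_v : complex.Im v = complex.Im w by rewrite /v; case: (w) => a b /=; rewrite addr0.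
rewrite -Re_v in n1 n2.
have v0 : upper_half_plane v by rewrite /upper_half_plane /= Im_v.
(* Translation followed by inversion has factor [v] at [w], and by minimality its modulus is at
   least 1. *)
have Nv : 1 <= complex.Re v ^+ 2 + complex.Im v ^+ 2.
  have := Hw _ (SL2Z_mul GS GT); rewrite autj_mul ?GT.1 // mobius_mx2T -/v nmM exprMn !nm_autj_sqr !mx2E.
  lra.
case: (ltrP 1 (complex.Re v ^+ 2 + complex.Im v ^+ 2)) => N1.
  by exists (T *m g); [exact: SL2Z_mul|rewrite -vE; split=> //; left].
have {Nv} N1 : complex.Re v ^+ 2 + complex.Im v ^+ 2 = 1 by apply/eqP; rewrite eq_le N1 Nv.
case: (lerP (complex.Re v) 0) => xv.
  by exists (T *m g); [exact: SL2Z_mul|rewrite -vE; split=> //; right].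
exists (S *m (T *m g)); first by do 2 apply: SL2Z_mul => //.
have GTg := SL2Z_mul GT Gg.
rewrite mobius_mul ?GS.1 ?GTg.1 // -vE mobius_mx2S.
(* On the unit circle [-1/v] is the reflection of [v] in the imaginary axis, which moves the point
   to the half of the arc that is kept. *)
have -> : - v^-1 = (- complex.Re v) +i* complex.Im v.
  have v1 : v != 0 by apply/eqP => E; move: v0; rewrite /upper_half_plane /= E ltxx.
  apply: (mulIf v1); rewrite mulNr mulVf //.
  move: N1; case: (v) => a b /= N1; apply/eqP; rewrite eq_complex /=; apply/andP; split; apply/eqP; last by ring.
  by move: N1; rewrite !expr2; lra.
split=> /=; [lra|lra|exact: v0|].
by right; split; [rewrite sqrrN|lra].
Qed.

End ModularGroup.

(** * The modular group is Fuchsian *)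

Section FiniteCovolume.
Variable R : realType.
Local Open Scope ereal_scope.

Definition fund_set : set (R * R) := [set p | fund p.1 p.2].

Lemma fund_set_measurable : measurable fund_set.
Proof.
pose nsq (p : R * R) : R := (p.1 ^+ 2 + p.2 ^+ 2)%R.
have m1 : measurable_fun setT (fst : R * R -> R) by exact: measurable_fst.
have m2 : measurable_fun setT (snd : R * R -> R) by exact: measurable_snd.
have mn : measurable_fun setT nsq.
  by apply: measurable_funD; [exact: (measurable_funX 2 m1)|exact: (measurable_funX 2 m2)].
have pre (f : R * R -> R) (B : set R) : measurable_fun setT f -> measurable B -> measurable (f @^-1` B).
  by move=> mf mB; rewrite -[X in measurable X]setTI; exact: mf.
have -> : fund_set = (fst @^-1` `[(- 2^-1)%R, 2^-1%R[%classic `&` snd @^-1` `]0%R, +oo[%classic)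
   `&` (nsq @^-1` `]1%R, +oo[%classic `|` (nsq @^-1` [set 1%R] `&` fst @^-1` `]-oo, 0%R]%classic)).
  apply/seteqP; split=> [[x y] /=|[x y] /=]; rewrite !in_itv /= !andbT.
    by move=> [-> -> -> [h|[h1 h2]]]; split=> //; [left|right].
  by move=> [[/andP[h1 h2] h3] [h4|[h4 h5]]]; split=> //; [left|right].
apply: measurableI; first by apply: measurableI; apply: pre => //; exact: measurable_itv.
apply: measurableU; first by apply: pre => //; exact: measurable_itv.
by apply: measurableI; apply: pre => //; exact: measurable_itv.
Qed.

Lemma fund_Im x y : @fund R x y -> (2^-1 <= y)%R.
Proof.
move=> F; have N := fund_norm_ge1 F; move: F => [x1 x2 y0 _]; rewrite leNgt; apply/negP => h.
have : (x ^+ 2 <= 4^-1)%R by nra.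
have : (y ^+ 2 < 4^-1)%R by nra.
lra.
Qed.

(** The domain lies in a vertical strip and has [y >= 1/2], where [y^-2 <= 5 / (1 + y^2)]; Tonelli
    reduces the bound to the integral of [1 / (1 + y^2)] over the half-line. *)
Lemma fund_area_finite :
  \int[lebesgue_measure \x lebesgue_measure]_(p in fund_set) (((p.2 : R) ^- 2)%:E) < +oo.
Proof.
(* Equal to [y^-2] on the domain and continuous everywhere, hence measurable. *)
pose cut (y : R) : R := ((Num.max y 2^-1) ^+ 2)^-1%R.
pose a (x : R) : R := \1_(`[(- 2^-1)%R, 2^-1%R]%classic) x.
pose b (y : R) : R := (5 * (oneDsqr y)^-1)%R.
pose b' (y : R) : R := (\1_(`[0%R, +oo[%classic) y * b y)%R.
pose g (p : R * R) : \bar R := (a p.1 * b' p.2)%:E.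
have m1 : measurable_fun setT (fst : R * R -> R) by exact: measurable_fst.
have m2 : measurable_fun setT (snd : R * R -> R) by exact: measurable_snd.
have mcut : measurable_fun setT cut.
  apply: continuous_measurable_fun => y; apply: cvgV.
    by rewrite expf_neq0 // gt_eqF // lt_max invr_gt0 ltr0n orbT.
  have c1 : {for y, continuous (fun y : R => Num.max y 2^-1 : R^o)%R}.
    by apply: (@continuous_max R R id (cst 2^-1%R)) => //; exact: cvg_cst.
  exact: (cvgM c1 c1).
have ma : measurable_fun setT a by apply: measurable_indic; exact: measurable_itv.
have mb : measurable_fun setT b.
  apply: measurable_funM; first exact: measurable_cst.
  by apply: continuous_measurable_fun; exact: continuous_oneDsqrV.
have mb' : measurable_fun setT b'.
  by apply: measurable_funM => //; apply: measurable_indic; exact: measurable_itv.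
have b0 y : (0 <= b y)%R by rewrite mulr_ge0 // invr_ge0 (le_trans ler01) // oneDsqr_ge1.
have b'0 y : (0 <= b' y)%R by rewrite mulr_ge0.
have g0 p : 0 <= g p by rewrite lee_fin mulr_ge0.
have mg : measurable_fun setT g.
  apply/measurable_EFinP; apply: measurable_funM.
    exact: (measurableT_comp ma m1).
  exact: (measurableT_comp mb' m2).
have -> : \int[lebesgue_measure \x lebesgue_measure]_(p in fund_set) (((p.2 : R) ^- 2)%:E) =
    \int[lebesgue_measure \x lebesgue_measure]_(p in fund_set) ((cut p.2)%:E).
  apply: eq_integral => p; rewrite inE => /fund_Im h; congr (_%:E).
  by rewrite /cut max_l.
apply: (@le_lt_trans _ _ (\int[lebesgue_measure \x lebesgue_measure]_(p in fund_set) g p)).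
  apply: ge0_le_integral => //.
  - exact: fund_set_measurable.
  - by move=> p _; rewrite lee_fin invr_ge0 exprn_ge0 // le_max invr_ge0 ler0n orbT.
  - by apply: measurable_funTS; apply/measurable_EFinP; exact: (measurableT_comp mcut m2).
  - exact: measurable_funTS.
  - move=> [x y] Fp; have h := fund_Im Fp; move: Fp => [x1 x2 y0 _]; rewrite /= in x1 x2 y0 h.
    rewrite /g /a /b' lee_fin /= !indicE !mem_set /=; last 2 first.
    + by rewrite in_itv /= ltW.
    + by rewrite in_itv /= x1 ltW.
    rewrite !mul1r /cut max_l // /b /oneDsqr.
    have p1 : (0 < 1 + y ^+ 2)%R by rewrite ltr_pwDl // sqr_ge0.
    have p2 : (0 < y ^+ 2)%R by rewrite exprn_gt0.
    by rewrite ler_pdivlMr // mulrC ler_pdivrMr //; nra.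
apply: (@le_lt_trans _ _ (\int[lebesgue_measure \x lebesgue_measure]_p g p)).
  by apply: ge0_subset_integral => //; exact: fund_set_measurable.
rewrite fubini_tonelli1 //.
have C : \int[lebesgue_measure]_y (b' y)%:E = (5 * (pi / 2))%:E.
  transitivity (\int[lebesgue_measure]_(y in `[0%R, +oo[) (b y)%:E).
    rewrite [RHS]integral_mkcond; apply: eq_integral => y _.
    by rewrite /b' patchE indicE; case: ifP => _; rewrite ?mul1r ?mul0r.
  rewrite /b; under eq_integral do rewrite EFinM.
  rewrite ge0_integralZl ?integral0y_oneDsqr //.
  by apply: measurable_funTS; apply/measurable_EFinP; apply: continuous_measurable_fun; exact: continuous_oneDsqrV.
have FE (x : R) : \int[lebesgue_measure]_y g (x, y) = (5 * (pi / 2))%:E * (a x)%:E.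
  transitivity (\int[lebesgue_measure]_y ((a x)%:E * (b' y)%:E)).
    by apply: eq_integral => y _; rewrite -EFinM.
  rewrite ge0_integralZl //; last 3 first.
  - exact/measurable_EFinP.
  - by move=> y _; rewrite lee_fin.
  - by rewrite lee_fin.
  by rewrite C muleC.
apply: (@le_lt_trans _ _ (\int[lebesgue_measure]_x ((5 * (pi / 2))%:E * (a x)%:E))).
  by rewrite le_eqVlt; apply/orP; left; apply/eqP; apply: eq_integral => x _; exact: FE.
rewrite ge0_integralZl //; last 3 first.
- exact/measurable_EFinP.
- by move=> y _; rewrite lee_fin.
- by rewrite lee_fin mulr_ge0 // divr_ge0 // pi_ge0.
rewrite integral_indic // setIT.
have [x E] : exists x : R, lebesgue_measure (`[(- 2^-1)%R, 2^-1%R]%classic : set R) = x%:E.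
  rewrite lebesgue_measure_itv /=; case: ifP => _; last by exists 0%R.
  by exists (2^-1 - - 2^-1)%R; rewrite EFinB.
apply: (@le_lt_trans _ _ ((5 * (pi / 2))%:E * x%:E)); first by rewrite -E.
by rewrite -EFinM ltry.
Qed.

Lemma SL2Z_fuchsian : fuchsian (@SL2Z R).
Proof.
split; [exact: SL2Z_subgroup|exact: SL2Z_discrete|].
exists fund_set; last exact: fund_area_finite.
split; first exact: fund_set_measurable.
  by move=> p [].
move=> z z0; have [g Gg Fg] := fund_exists z0.
exists (complex.Re (mobius g z), complex.Im (mobius g z)); split.
  by split=> //; exists g => //=; case: (mobius g z).
move=> [x y] [Fp [h Gh /= E]]; have dg := Gg.1; have dh := Gh.1.
have dgi := (SL2Z_inv Gg).1.
have : x +i* y = mobius g z.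
  apply: (@fund_unique _ (h *m invmx g)) => //; first exact: (SL2Z_mul Gh (SL2Z_inv Gg)).
  rewrite mobius_mul //; last exact: mobius_upper.
  by rewrite mobius_inv.
by case: (mobius g z) => u v [-> ->].
Qed.

End FiniteCovolume.

(** * Symmetric powers of the standard representation *)

Section SymmetricPower.
Variable R : realType.
Implicit Types (g h : 'M[R]_2) (z w : R[i]).

Definition veronese (m : nat) z : 'cV[R[i]]_m.+1 := \col_i z ^+ i.

(** The form [(a X + b Y)^i (c X + d Y)^(m-i)] at [Y = 1]; its coefficients are row [i] of the
    action on [Sym^m]. *)
Definition sym_row (m : nat) g (i : nat) : {poly R[i]} :=
  ((g 0 0)%:C *: 'X + (g 0 1)%:C%:P) ^+ i * ((g 1 0)%:C *: 'X + (g 1 1)%:C%:P) ^+ (m - i).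

Definition sym_rep (m : nat) g : 'M[R[i]]_m.+1 := \matrix_(i, l) (sym_row m g i)`_l.

Lemma size_affine (p q : R[i]) : (size (p *: 'X + q%:P)%R <= 2)%N.
Proof.
apply: leq_trans (size_polyD _ _) _; rewrite geq_max; apply/andP; split.
  by apply: leq_trans (size_scale_leq _ _) _; rewrite size_polyX.
by apply: leq_trans (size_polyC_leq1 _) _.
Qed.

Lemma size_expr_affine (p q : R[i]) n : (size ((p *: 'X + q%:P) ^+ n)%R <= n.+1)%N.
Proof.
apply: leq_trans (size_poly_exp_leq _ _) _; rewrite ltnS -[X in (_ <= X)%N]mul1n leq_mul2r.
by apply/orP; right; have := size_affine p q; case: (size _) => [|[|[|]]].
Qed.

Lemma size_sym_row m g i : (i <= m)%N -> (size (sym_row m g i) <= m.+1)%N.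
Proof.
move=> im; apply: leq_trans (size_polyMleq _ _) _.
have := size_expr_affine (g 0 0)%:C (g 0 1)%:C i; have := size_expr_affine (g 1 0)%:C (g 1 1)%:C (m - i).
by move: (size _) (size _) => a b; lia.
Qed.

Lemma sym_rep_veronese m g z : autj g z != 0 ->
  sym_rep m g *m veronese m z = autj g z ^+ m *: veronese m (mobius g z).
Proof.
move=> j0; apply/matrixP => i j; rewrite ord1 !mxE; under eq_bigr do rewrite !mxE.
have im : (i <= m)%N by have := ltn_ord i.
rewrite -(horner_coef_wide _ (size_sym_row g im)) hornerM !horner_exp !hornerE.
have -> : autj g z ^+ m = autj g z ^+ i * autj g z ^+ (m - i) by rewrite -exprD subnKC.
rewrite /mobius -/(autj g z) expr_div_n; field.
by rewrite expf_neq0.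
Qed.

(** The entries of [A v(z)] are polynomials in [z], compared at the points [a + i] with [a] natural.
    Matrix identities on [Sym^m] thus reduce to the cocycle identities for [autj] and [mobius]. *)
Lemma veronese_sep m q (A B : 'M[R[i]]_(q, m.+1)) :
  (forall z, upper_half_plane z -> A *m veronese m z = B *m veronese m z) -> A = B.
Proof.
move=> H; apply/matrixP => i l.
pose P (M : 'M[R[i]]_(q, m.+1)) : {poly R[i]} := \poly_(r < m.+1) M i (inord r).
have PE (M : 'M[R[i]]_(q, m.+1)) z : (P M).[z] = (M *m veronese m z) i 0.
  by rewrite horner_poly mxE; apply: eq_bigr => r _; rewrite !mxE inord_val.
have : P A = P B.
  apply/eqP; rewrite -subr_eq0; apply/negPn/negP => P0.
  pose rs : seq R[i] := [seq ((a%:R : R) +i* 1) | a <- iota 0 (size (P A - P B)).+1].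
  have := max_poly_roots P0 (_ : all (root _) rs) (_ : uniq rs).
  rewrite size_map size_iota ltnNge leqnSn => /(_ _ _)/negP; apply => //.
    apply/allP => x /mapP[a _ ->]; rewrite /root hornerD hornerN !PE H ?subrr //.
    by rewrite /upper_half_plane /= ltr01.
  rewrite map_inj_in_uniq ?iota_uniq // => a b _ _ [] /eqP.
  by rewrite eqr_nat => /eqP.
move=> /(congr1 (fun p : {poly R[i]} => p`_l)); rewrite !coef_poly ltn_ord.
by rewrite inord_val.
Qed.

Lemma sym_rep1 m : sym_rep m 1%:M = 1%:M.
Proof.
apply: veronese_sep => z z0; have d1 : \det (1%:M : 'M[R]_2) = 1 by exact: det1.
rewrite sym_rep_veronese ?autj_neq0 // mobius1 mul1mx.
by rewrite /autj !mxE /= mul0r add0r expr1n scale1r.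
Qed.

Lemma sym_repM m g h : \det g = 1 -> \det h = 1 ->
  sym_rep m (g *m h) = sym_rep m g *m sym_rep m h.
Proof.
move=> dg dh; apply: veronese_sep => z z0.
have dgh : \det (g *m h) = 1 by rewrite det_mulmx dg dh mulr1.
rewrite -mulmxA !sym_rep_veronese ?autj_neq0 // -scalemxAr sym_rep_veronese; last first.
  by apply: autj_neq0 => //; exact: mobius_upper.
by rewrite autj_mul // mobius_mul // scalerA exprMn mulrC.
Qed.

Lemma affine_conj (p q : R) z : p%:C * conjc z + q%:C = conjc (p%:C * z + q%:C).
Proof.
by case: z => a b; apply/eqP; rewrite eq_complex /=; apply/andP; split; apply/eqP; ring.
Qed.

Lemma autj_conj g z : autj g (conjc z) = conjc (autj g z).
Proof. exact: affine_conj. Qed.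

Lemma mobius_conj g z : mobius g (conjc z) = conjc (mobius g z).
Proof. by rewrite /mobius !affine_conj -conjc_inv -rmorphM. Qed.

End SymmetricPower.

(** * Tensors of column vectors *)

Section TensorColumns.
Variable K : comNzRingType.

Lemma tens_col m p q r (A : 'M[K]_(q, m)) (B : 'M[K]_(r, p)) (v : 'cV[K]_m) (u : 'cV[K]_p) :
  (A *t B) *m (v *t u : 'cV[K]_(m * p)) = (A *m v) *t (B *m u) :> 'cV[K]_(q * r).
Proof.
change ((A *t B) *m (v *t u) = (A *m v) *t (B *m u)).
by rewrite tensmx_mul.
Qed.

Lemma tens_colZ m p (a b : K) (v : 'cV[K]_m) (u : 'cV[K]_p) :
  ((a *: v) *t (b *: u) : 'cV[K]_(m * p)) = (a * b) *: (v *t u : 'cV[K]_(m * p)).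
Proof. by apply/matrixP => i j; rewrite !mxE mulrACA. Qed.

End TensorColumns.

(** * A real analytic quasi-modular vector *)

Section Example.
Variable R : realType.
Implicit Types (g h : 'M[R]_2) (z w : R[i]).

Definition imc z : R[i] := (complex.Im z)%:C.

Lemma imc_neq0 z : upper_half_plane z -> imc z != 0.
Proof.
rewrite /upper_half_plane /= => z0; apply/eqP => -[] E.
by move: z0; rewrite E ltxx.
Qed.

Lemma imc_mobius g z : \det g = 1 -> upper_half_plane z ->
  imc (mobius g z) = imc z / (autj g z * conjc (autj g z)).
Proof.
move=> dg z0; rewrite /imc Im_mobius // rmorphM fmorphV /=; congr (_ / _).
by rewrite -sqr_normc rmorphXn.
Qed.

(** The source of positive depth: [conjc j] is [j] plus a multiple of [c = j'], so its [d]-th power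
    expands into the terms of a law of depth [d]. *)
Lemma conj_autj g z : conjc (autj g z) = autj g z + (- (2 * 'i%C * imc z)) * autj' g.
Proof.
have := subcJ (autj g z); rewrite Im_autj rmorphM /= -/(imc z) -/(autj' g) => E.
have -> : conjc (autj g z) = autj g z - (autj g z - conjc (autj g z)) by ring.
by rewrite E; ring.
Qed.

(* The real analytic vector [y^(-d-p) v(z)^m (x) v(conj z)^p], [v(z) = (z, 1)],
   has weight [2d + p - m] and depth [d] for all of [SL_2(R)]. *)
Definition exf (m p d : nat) z : 'cV[R[i]]_(m.+1 * p.+1) :=
  imc z ^- (d + p) *: (veronese m z *t veronese p (conjc z)).

Definition exrep (m p : nat) g : 'M[R[i]]_(m.+1 * p.+1) := sym_rep m g *t sym_rep p g.

(** Since [y] is divided by [j conj(j)], the power [y^(-d-p)] gives [(j conj(j))^(d+p)]; the two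
    Veronese vectors take away [j^m] and [conj(j)^p]. *)
Lemma exf_law m p d g z : \det g = 1 -> upper_half_plane z ->
  exf m p d (mobius g z) =
  (autj g z ^ ((d + p)%:Z - m%:Z) * conjc (autj g z) ^+ d) *: (exrep m p g *m exf m p d z).
Proof.
move=> dg z0; have j0 := autj_neq0 dg z0.
have J0 : conjc (autj g z) != 0 by rewrite conjc_eq0.
have y0 := imc_neq0 z0.
rewrite /exf /exrep -scalemxAr tens_col !sym_rep_veronese ?autj_conj // mobius_conj tens_colZ.
rewrite !scalerA; congr (_ *: _).
set j := autj g z in j0 J0 *; set J := conjc j in J0 *.
have yE : imc (mobius g z) ^- (d + p) = imc z ^- (d + p) * (j ^+ (d + p) * J ^+ (d + p)).
  by rewrite imc_mobius // -/j -/J expr_div_n invf_div exprMn mulrC.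
rewrite yE.
have jE : j ^ ((d + p)%:Z - m%:Z) * j ^+ m = j ^+ (d + p).
  by rewrite [X in _ * X]exprnP -expfzDr // subrK.
rewrite -{}jE !exprD; ring.
Qed.

End Example.

(** * Real analytic functions on the upper half-plane *)

Section Smooth.
Variable R : realType.
Implicit Types (h g u : R[i] -> R[i]) (z w : R[i]).

Definition ana_on_H h : Prop := forall z, upper_half_plane z -> real_ana h z.

Lemma real_ana_near h g a : cnear a (fun w => h w = g w) -> real_ana h a -> real_ana g a.
Proof. by apply: ana_near => w; exact: nm_phi_ReIm. Qed.

Lemma real_ana_id a : real_ana (@id R[i]) a.
Proof.
apply: (@real_ana_near (fun w => phi 2^-1 2^-1 w + 'i%C * phi (- ('i / 2)) ('i / 2) w)).
  exists 1 => // w _; rewrite phi_Re phi_Im.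
  by rewrite {3}[a + w]complexE.
by apply: anaD; [|apply: anaZ]; [apply: ana_phi1|apply: ana_phi2] => w; exact: nm_phi_ReIm.
Qed.

Lemma real_ana_conj a : real_ana (@conjc R) a.
Proof.
apply: (@real_ana_near (fun w => phi 2^-1 2^-1 w + (- 'i%C) * phi (- ('i / 2)) ('i / 2) w)).
  exists 1 => // w _; rewrite phi_Re phi_Im.
  by case: (a + w) => x y; apply/eqP; rewrite eq_complex /=; apply/andP; split; apply/eqP; ring.
by apply: anaD; [|apply: anaZ]; [apply: ana_phi1|apply: ana_phi2] => w; exact: nm_phi_ReIm.
Qed.

Lemma real_anaX h a n : real_ana h a -> real_ana (fun z => h z ^+ n) a.
Proof. by apply: anaX => w; exact: nm_phi_ReIm. Qed.

(** The geometric series of [1/(b + y)] in powers of [y/b], at radius [b / 2], where its absolute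
    sum is at most [2 / b]. *)
Lemma real_ana_imcV a : upper_half_plane a -> real_ana (fun z => (imc z)^-1) a.
Proof.
rewrite /upper_half_plane /=; set b := complex.Im a => b0.
have bC0 : b%:C != 0 by rewrite -nm_gt0 nm_real normr_gt0 lt0r_neq0.
exists (fun i j => if (i == 0)%N then (-1) ^+ j * b%:C ^- j.+1 else 0), (b / 2), (2 / b).
have b20 : 0 < b / 2 by rewrite divr_gt0.
split=> //.
  case=> [|n]; first by rewrite big_ord0 divr_ge0 // ltW.
  rewrite big_ord_recl [X in _ + X]big1 ?addr0; last first.
    by move=> i _; rewrite big1 // => j _; rewrite [nm _]nm0 mul0r.
  rewrite [nat_of_ord _]/= eqxx.
  have S N : \sum_(j < N) nm ((-1) ^+ j * b%:C ^- j.+1) * (b / 2) ^+ (0 + j) = (2 / b) * (1 - 2^-1 ^+ N).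
    elim: N => [|N IH]; first by rewrite big_ord0 subrr mulr0.
    rewrite big_ord_recr /= IH nmM nmX nmV nmX nm_real gtr0_norm // nmN nm1 expr1n mul1r add0n.
    rewrite expr_div_n !exprS -exprVn; field.
    by rewrite expf_neq0 // lt0r_neq0.
  rewrite S ler_piMr ?divr_ge0 // ?ltW //.
move=> w _; rewrite phi_Re phi_Im nm_real => hw.
set y := complex.Im w in hw *.
have by0 : 0 < b + y by move: hw; rewrite ler_norml => /andP[]; lra.
have E : imc (a + w) = b%:C + y%:C by rewrite /imc ReImD rmorphD.
have E0 : b%:C + y%:C != 0 by rewrite -rmorphD -nm_gt0 nm_real normr_gt0 lt0r_neq0.
rewrite E; apply: tends_shift.
apply: (@tends_ext _ (fun n => (b%:C + y%:C)^-1 + (- (b%:C + y%:C)^-1 * (- y%:C / b%:C)) * (- y%:C / b%:C) ^+ n)).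
  move=> n; rewrite /dser big_ord_recl /= [X in _ = _ + X]big1 ?addr0; last first.
    by move=> i _; rewrite big1 // => j _; rewrite !mul0r.
  rewrite -mulrA -exprS; elim: n.+1 => [|N IH]; first by rewrite big_ord0; ring.
  rewrite big_ord_recr /= -IH expr0 mulr1 !exprS !exprMn !exprVn -!(mulN1r y%:C) !exprMn; field.
  by rewrite expf_neq0 // bC0 E0.
rewrite -[X in tends _ X]addr0; apply: tendsD; first exact: tends_cst.
rewrite -[X in tends _ X](mulr0 (- (b%:C + y%:C)^-1 * (- y%:C / b%:C))).
apply: tendsZ; apply: (@tends_0_half _ _ 1) => n; rewrite mul1r nmX.
apply: lerXn2r; rewrite ?nnegrE ?nm_ge0 //.
rewrite nmM nmN nmV !nm_real (gtr0_norm b0) ler_pdivrMr //.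
by apply: le_trans hw _; lra.
Qed.

Lemma ana_on_H_wdiff h j z : ana_on_H h -> upper_half_plane z ->
  wdiff (iter j (@dtau_scalar R) h) z (dtau_scalar (iter j (@dtau_scalar R) h) z).
Proof.
move=> H z0; have : real_ana (iter j (@dtau_scalar R) h) z.
  by elim: j => [|j IH]; [exact: H|exact: (da_dtau (real_ana_algebra z))].
move=> /(ana_wdiff (@nm_phi_Re R) (@nm_phi_Im R) (@nm_phi_ReIm R)).
exact: cnear_at.
Qed.

Lemma dtau_near h g z al : cnear z (fun w => g w = h w) -> wdiff h z al -> dtau_scalar g z = al.
Proof.
move=> E H; apply: wdiff_dtau; apply: wdiff_near H.
by apply: cnear_sub E => w ->.
Qed.

Lemma iter_dtau_eq h g j z : ana_on_H h -> (forall z, upper_half_plane z -> g z = h z) ->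
  upper_half_plane z -> iter j (@dtau_scalar R) g z = iter j (@dtau_scalar R) h z.
Proof.
move=> H E; elim: j z => [|j IH] z z0; first exact: E.
apply: dtau_near (ana_on_H_wdiff j H z0).
exact: cnear_sub (upper_near z0).
Qed.

(** For [d/dtau] an antiholomorphic factor is a constant; the one that occurs is
    [conjc (autj s w) ^+ d]. *)
Lemma iter_dtau_antiholo h b j z : ana_on_H h ->
  (forall z, upper_half_plane z -> wdiff b z 0) ->
  upper_half_plane z ->
  iter j (@dtau_scalar R) (fun w => b w * h w) z = b z * iter j (@dtau_scalar R) h z.
Proof.
move=> H Hb; elim: j z => [|j IH] z z0 //=.
have W := wdiffM (Hb z z0) (ana_on_H_wdiff j H z0); rewrite mul0r add0r in W.
by apply: dtau_near W; apply: cnear_sub (upper_near z0).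
Qed.

Lemma iter_dtau_row m (L : 'rV[R[i]]_m) (f : R[i] -> 'cV[R[i]]_m) j z :
  (forall i, ana_on_H (fun w => f w i 0)) -> upper_half_plane z ->
  iter j (@dtau_scalar R) (fun w => (L *m f w) 0 0) z = (L *m iter j (@dtau R m) f z) 0 0.
Proof.
move=> H; elim: j z => [|j IH] z z0 //=.
have E i : iter j (@dtau_scalar R) (fun w => f w i 0) = fun w => iter j (@dtau R m) f w i 0.
  by elim: j {IH} => [//|j IHj] /=; rewrite IHj; apply/funext => w; rewrite mxE.
have W i := ana_on_H_wdiff j (H i) z0; rewrite mxE.
have := wdiff_sum (index_enum 'I_m) (P := xpredT) (fun i _ => wdiffZ (L 0 i) (W i)).
move=> {}W; rewrite (dtau_near _ W).
  by apply: eq_bigr => i _; rewrite E mxE.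
apply: cnear_sub (upper_near z0) => w w0; rewrite IH // mxE.
by apply: eq_bigr => i _; rewrite E.
Qed.

Lemma ana_on_H_row m (L : 'rV[R[i]]_m) (f : R[i] -> 'cV[R[i]]_m) :
  (forall i, ana_on_H (fun w => f w i 0)) -> ana_on_H (fun w => (L *m f w) 0 0).
Proof.
move=> H z z0; have A := real_ana_algebra z.
apply: (@real_ana_near (fun w => \sum_i L 0 i * f w i 0)).
  by exists 1 => // w _; rewrite mxE.
apply: (da_sum A) => i _; apply: (da_mul A); [exact: (da_cst A)|exact: H].
Qed.

(** Each derivative lowers the order of the zero at [z0] by one; the cofactor [H] records the
    leading value, with the falling factorial of [a]. *)
Lemma iter_dtau_zero h z0 a j : ana_on_H h -> (j <= a)%N ->
  exists2 H, ana_on_H H /\ H z0 = (a ^_ j)%:R * h z0 &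
   forall z, upper_half_plane z ->
     iter j (@dtau_scalar R) (fun w => (w - z0) ^+ a * h w) z = (z - z0) ^+ (a - j) * H z.
Proof.
move=> Hh; elim: j => [|j IH] ja.
  by exists h; [rewrite ffactn0 mul1r|move=> z _; rewrite subn0].
have [H [HH Hz0] E] := IH (ltnW ja).
exists (fun z => (a - j)%:R * H z + (z - z0) * dtau_scalar H z).
  split; last by rewrite subrr mul0r addr0 Hz0 ffactnSr natrM mulrA [_%:R * _%:R in RHS]mulrC.
  move=> z zz; have A := real_ana_algebra z; apply: (da_add A); apply: (da_mul A).
  - exact: (da_cst A).
  - exact: HH.
  - by apply: (da_add A); [exact: real_ana_id|exact: (da_cst A)].
  - by apply: (da_dtau A); exact: HH.
move=> z zz /=.
have W1 : wdiff (fun w => w - z0) z 1.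
  by have := wdiffD (wdiff_id z) (wdiff_cst (- z0) z); rewrite addr0.
have W := wdiffM (wdiffX (a - j) W1) (ana_on_H_wdiff 0 HH zz).
rewrite (dtau_near (h := fun w => (w - z0) ^+ (a - j) * H w) _ W); last first.
  exact: cnear_sub (upper_near zz).
rewrite mulr1 /= subnS.
have -> : (z - z0) ^+ (a - j) = (z - z0) * (z - z0) ^+ (a - j).-1.
  by rewrite -exprS prednK // subn_gt0.
ring.
Qed.

End Smooth.

(** * The recurrence for the coefficients and its solutions *)

Section BracketCoefficients.
Variable R : realType.

Definition bracket_rec (kap lam : int) (n : nat) (c : nat -> R[i]) : Prop :=
  forall a, (a < n)%N ->
    (n - a)%:R * (lam + (n - a.+1)%:Z)%:~R * c a + a.+1%:R * (kap + a%:Z)%:~R * c a.+1 = 0.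

(** Consecutive coefficients share all but one factor of each product;
    [(a + 1) C(n, a + 1) = (n - a) C(n, a)] and the alternating sign do the rest. *)
Lemma rcc_rec kap lam n : bracket_rec kap lam n (rcc R kap lam n).
Proof.
move=> a an; rewrite /rcc.
rewrite (@big_ltn _ _ _ a n) // (@big_ltn _ _ _ (n - a.+1)) //; last by lia.
rewrite (_ : (n - a.+1).+1 = n - a)%N; last by lia.
have B : a.+1%:R * 'C(n, a.+1)%:R = (n - a)%:R * 'C(n, a)%:R :> R[i].
  by rewrite -!natrM mul_bin_left.
rewrite exprS.
transitivity ((-1) ^+ a * (lam + (n - a.+1)%:Z)%:~R * (kap + a%:Z)%:~R *
  \prod_(a.+1 <= j < n) (kap + j%:Z)%:~R * \prod_(n - a <= q < n) (lam + q%:Z)%:~R *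
  ((n - a)%:R * 'C(n, a)%:R - a.+1%:R * 'C(n, a.+1)%:R) : R[i]); first by ring.
by rewrite B subrr mulr0.
Qed.

Section Pivot.
Variables (kap lam : int) (n r0 : nat).
Hypothesis r0n : (r0 <= n)%N.
Hypothesis kap0 : forall j, (r0 <= j < n)%N -> kap + j%:Z != 0.
Hypothesis lam0 : forall q, (n - r0 <= q < n)%N -> lam + q%:Z != 0.

Lemma rcc_pivot_neq0 : rcc R kap lam n r0 != 0.
Proof.
rewrite /rcc !mulf_neq0 ?signr_eq0 ?pnatr_eq0 -?lt0n ?bin_gt0 //.
  by rewrite big_nat_cond; elim/big_ind: _ => [|x y x0 y0|j /andP[h _]]; rewrite ?oner_neq0 ?mulf_neq0 // intr_eq0 kap0.
by rewrite big_nat_cond; elim/big_ind: _ => [|x y x0 y0|j /andP[h _]]; rewrite ?oner_neq0 ?mulf_neq0 // intr_eq0 lam0.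
Qed.

(** From the pivot the recurrence is solved upwards, dividing by [kap + j] with [j >= r0], and
    downwards, dividing by [lam + q] with [q >= n - r0]; these are also the factors of [rcc] at
    [r0]. *)
Lemma bracket_rec_zero c : bracket_rec kap lam n c -> c r0 = 0 ->
  forall r, (r <= n)%N -> c r = 0.
Proof.
move=> H c0.
have up i : (r0 + i <= n)%N -> c (r0 + i)%N = 0.
  elim: i => [|i IH] h; first by rewrite addn0.
  have /eqP := H (r0 + i)%N ltac:(lia); rewrite IH ?mulr0 ?add0r; last by lia.
  rewrite addnS !mulf_eq0 pnatr_eq0 intr_eq0 /= (negbTE (kap0 _)) /=; last by lia.
  by move=> /eqP.
have down i : (i <= r0)%N -> c (r0 - i)%N = 0.
  elim: i => [|i IH] h; first by rewrite subn0.
  have /eqP := H (r0 - i.+1)%N ltac:(lia).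
  rewrite (_ : (r0 - i.+1).+1 = r0 - i)%N ?IH ?mulr0 ?addr0; try lia.
  rewrite !mulf_eq0 pnatr_eq0 intr_eq0 (negbTE (lam0 _)); last by lia.
  by rewrite orbF (_ : (n - (r0 - i.+1))%N == 0%N = false); [move=> /eqP|lia].
move=> r rn; case: (leqP r0 r) => h.
  by have := @up (r - r0)%N; rewrite subnKC //; exact.
by have := @down (r0 - r)%N; rewrite subKn; [apply; lia|lia].
Qed.

Lemma bracket_rec_unique c : bracket_rec kap lam n c ->
  forall r, (r <= n)%N -> c r = c r0 / rcc R kap lam n r0 * rcc R kap lam n r.
Proof.
move=> H r rn; apply/eqP; rewrite -subr_eq0; apply/eqP.
apply: (bracket_rec_zero (c := fun r => c r - c r0 / rcc R kap lam n r0 * rcc R kap lam n r)) => //.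
  move=> a an; have h1 := H a an; have h2 := @rcc_rec kap lam n a an.
  set x := _ / _.
  transitivity (((n - a)%:R * (lam + (n - a.+1)%:Z)%:~R * c a + a.+1%:R * (kap + a%:Z)%:~R * c a.+1)
    - x * ((n - a)%:R * (lam + (n - a.+1)%:Z)%:~R * rcc R kap lam n a
       + a.+1%:R * (kap + a%:Z)%:~R * rcc R kap lam n a.+1)); first by ring.
  by rewrite h1 h2 mulr0 subr0.
by rewrite divfK ?subrr // rcc_pivot_neq0.
Qed.

End Pivot.

(** The factors vanish only at [j = d - k] and [q = e - l]. If the first is outside [[0, n)] the
    pivot 0 works, if the second is, the pivot [n]. Otherwise the pivot is [d - k + 1], which leaves
    [e - l] out of range exactly when [n > d + e - k - l + 1]. *)
Lemma pivot_exists (k l : int) (d e n : nat) :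
  ~ [/\ 0 <= d%:Z - k, 0 <= e%:Z - l, d%:Z - k < n%:Z, e%:Z - l < n%:Z
          & n%:Z <= d%:Z + e%:Z - k - l + 1] ->
  exists r0, [/\ (r0 <= n)%N, forall j, (r0 <= j < n)%N -> k - d%:Z + j%:Z != 0 &
    forall q, (n - r0 <= q < n)%N -> l - e%:Z + q%:Z != 0].
Proof.
move=> N.
case: (boolP ((0 <= d%:Z - k) && (d%:Z - k < n%:Z))) => [/andP[k1 k2]|h1]; last first.
  exists 0%N; split=> // [j|q] /andP[ja jb]; last by lia.
  by apply/eqP => E; move/negP: h1; apply; lia.
case: (boolP ((0 <= e%:Z - l) && (e%:Z - l < n%:Z))) => [/andP[l1 l2]|h2]; last first.
  exists n; split=> // [j|q] /andP[ja jb]; first by lia.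
  by apply/eqP => E; move/negP: h2; apply; lia.
have lt : d%:Z + e%:Z - k - l + 1 < n%:Z.
  by rewrite ltNge; apply/negP => h; apply: N; split.
exists (`|d%:Z - k|%N).+1; split; first by lia.
  by move=> j /andP[ja jb]; apply/eqP => E; lia.
by move=> q /andP[ja jb]; apply/eqP => E; lia.
Qed.

(* The left hand side is the coefficient of [X] that remains in the
   transformation law of the bracket of two functions vanishing at a point to
   the orders [a] and [n - a - 1]. *)
Lemma bracket_defect kap lam n a (c : nat -> R[i]) : (a < n)%N ->
  \sum_(r < n.+1) c r * (cf R kap r a * cf R lam (n - r) (n - a.+1)) =
  (n - a)%:R * (lam + (n - a.+1)%:Z)%:~R * c a + a.+1%:R * (kap + a%:Z)%:~R * c a.+1.
Proof.
(* The first [cf] vanishes for [r < a] and the second for [r > a + 1], so two terms remain. *)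
move=> an; rewrite (bigD1 (inord a)) //= inordK; last by lia.
rewrite (bigD1 (inord a.+1)) /=; last by rewrite -val_eqE /= !inordK; lia.
rewrite inordK; last by lia.
rewrite big1 ?addr0 => [|r /andP[]]; last first.
  rewrite -!val_eqE /= !inordK; try lia.
  move=> h1 h2; have rn := ltn_ord r; case: (ltnP r a) => h; first by rewrite (@cf_small _ kap) // mul0r mulr0.
  by rewrite (@cf_small _ lam) ?mulr0 //; lia.
rewrite (_ : n - a = (n - a.+1).+1)%N; last by lia.
rewrite /cf !binn !binSn !big_nat1 !(@big_geq _ _ _ a a) // !(@big_geq _ _ _ (n - a.+1) (n - a.+1)) //.
ring.
Qed.

End BracketCoefficients.

(** * Test forms and the degree argument *)

Section TestForms.
Variable R : realType.
Implicit Types (g h s : 'M[R]_2) (z w : R[i]).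

Lemma tensmx11 m p : (1%:M : 'M[R[i]]_m) *t (1%:M : 'M[R[i]]_p) = 1%:M.
Proof.
apply/matrixP => i j; rewrite -(mxtens_unindexK i) -(mxtens_unindexK j).
case: (mxtens_unindex i) (mxtens_unindex j) => [i1 i2] [j1 j2].
by rewrite tensmxE !mxE -natrM mulnb (can_eq (@mxtens_indexK m p)).
Qed.

Lemma tensor_representation (Gamma : set 'M[R]_2) m p
    (rho : 'M[R]_2 -> 'M[R[i]]_m) (eta : 'M[R]_2 -> 'M[R[i]]_p) :
  representation Gamma rho -> representation Gamma eta ->
  representation Gamma (tensor_rep rho eta).
Proof.
move=> [r1 rM] [e1 eM]; split; first by rewrite /tensor_rep r1 e1 tensmx11.
by move=> g h Gg Gh; rewrite /tensor_rep rM // eM // tensmx_mul.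
Qed.

Lemma exrep_representation m p : representation (@SL2Z R) (@exrep R m p).
Proof.
have S q : representation (@SL2Z R) (@sym_rep R q).
  by split=> [|g h [dg _] [dh _]]; [exact: sym_rep1|exact: sym_repM].
exact: (tensor_representation (S m) (S p)).
Qed.

Lemma ana_on_H_exf m p d i : ana_on_H (fun w => exf m p d w i 0 : R[i]).
Proof.
move=> z z0; have A := real_ana_algebra z.
apply: (@real_ana_near _ (fun w => (imc w)^-1 ^+ (d + p) *
    (w ^+ (mxtens_unindex i).1 * conjc w ^+ (mxtens_unindex i).2))).
  by exists 1 => // w _; rewrite /exf !mxE exprVn.
apply: (da_mul A); first by apply: real_anaX; exact: real_ana_imcV.
by apply: (da_mul A); apply: real_anaX; [exact: real_ana_id|exact: real_ana_conj].
Qed.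

Lemma real_ana_imc a : real_ana (@imc R) a.
Proof.
apply: (@real_ana_near _ (phi (- ('i / 2)) ('i / 2))).
  by exists 1 => // w _; rewrite phi_Im.
by apply: ana_phi2 => w; exact: nm_phi_ReIm.
Qed.

Lemma exf_quasimodular m p d (k : int) : k = (d + d + p)%:Z - m%:Z ->
  quasimodular (@SL2Z R) (@exrep R m p) an k d (exf m p d).
Proof.
(* The components are read off the binomial expansion of [(j - 2 i y c)^d], the [d]-th power of
   [conjc j]. *)
move=> kE; pose F r z := ('C(d, r)%:R * (- (2 * 'i%C * imc z)) ^+ r) *: exf m p d z : 'cV[R[i]]_(m.+1 * p.+1).
exists F, set0; split.
- by apply/funext => z; rewrite /F bin0 expr0 mulr1 scale1r.
- by [].
- move=> r rd a a0 _ i; apply/real_analyticP.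
  have A := real_ana_algebra a.
  apply: (@real_ana_near _ (fun w => ('C(d, r)%:R * (- (2 * 'i%C) * imc w) ^+ r) * exf m p d w i 0)).
    by exists 1 => // w _; rewrite /F !mxE mulNr.
  apply: (da_mul A); last exact: ana_on_H_exf.
  apply: (da_mul A); first exact: (da_cst A).
  by apply: real_anaX; apply: (da_mul A); [exact: (da_cst A)|exact: real_ana_imc].
- move=> g z [dg _] z0 _ _; have j0 := autj_neq0 dg z0.
  rewrite exf_law // conj_autj exprDn mulr_sumr scaler_suml; apply: eq_bigr => r _.
  rewrite /F -(scalemxAr ('C(d, r)%:R * _)) scalerA; congr (_ *: _).
  have -> : autj g z ^ (k - r%:Z) = autj g z ^ ((d + p)%:Z - m%:Z) * autj g z ^+ (d - r).
    rewrite [X in _ * X]exprnP -expfzDr //; congr (_ ^ _).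
    by have := ltn_ord r; lia.
  by rewrite exprMn mulrnAr -mulr_natr; ring.
- by [].
Qed.

(** The coefficients of [(X - z0)^a] on [Sym^m] and coordinate 0 on the conjugate factor: applied to
    [exf] this functional gives a scalar function with a zero of exact order [a] at [z0]. *)
Definition exrow (m p a : nat) z0 : 'rV[R[i]]_(m.+1 * p.+1) :=
  (\row_(i < m.+1) (('X - z0%:P) ^+ a)`_i) *t (delta_mx 0 0 : 'rV[R[i]]_p.+1).

Lemma exrow_exf m p d a z0 z : (a <= m)%N ->
  (exrow m p a z0 *m exf m p d z) 0 0 = (z - z0) ^+ a * imc z ^- (d + p).
Proof.
move=> am; rewrite /exf -scalemxAr mxE mulrC; congr (_ * _).
have := congr1 (fun M : 'cV[R[i]]_(1 * 1) => M 0 0) (tens_col (\row_(i < m.+1) (('X - z0%:P) ^+ a)`_i)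
  (delta_mx 0 0 : 'rV[R[i]]_p.+1) (veronese m z) (veronese p (conjc z))).
rewrite /exrow => ->; rewrite mxE !ord1 -rowE !mxE expr0 mulr1; under eq_bigr do rewrite !mxE.
rewrite -horner_coef_wide; first by rewrite !hornerE.
by rewrite size_exp_XsubC.
Qed.

Section Slash.
Variables (q : nat) (rho : 'M[R]_2 -> 'M[R[i]]_q) (kap : int) (d : nat) (f : R[i] -> 'cV[R[i]]_q).
Hypothesis anaf : forall i, ana_on_H (fun w => f w i 0).
Hypothesis lawf : forall g z, \det g = 1 -> upper_half_plane z ->
  f (mobius g z) = (autj g z ^ kap * conjc (autj g z) ^+ d) *: (rho g *m f z).

Lemma iter_sdl_depth0 r (F : nat -> R[i] -> R[i]) :
  iter r (sdl 0) F 0%N = iter r (@dtau_scalar R) (F 0%N).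
Proof. by elim: r => [|r IH]; rewrite ?iterS -?IH. Qed.

Lemma autj_inv g z : \det g = 1 -> upper_half_plane z ->
  autj (invmx g) (mobius g z) = (autj g z)^-1.
Proof.
move=> dg z0; have j0 := autj_neq0 dg z0; apply: (mulIf j0); rewrite mulVf //.
rewrite -autj_mul // mulVmx ?unitmxE ?dg ?unitr1 //.
by rewrite /autj !mxE /= mul0r add0r.
Qed.

(** With [s] the inverse of [g], the slash of [u] by [s] in weight [kap] and depth 0 is [v] times an
    antiholomorphic factor. Hence [iter_scusp] expands the derivatives of [v] at [mobius g z] in
    those of [u] at [z]. *)
Lemma row_iter_dtau (L : 'rV[R[i]]_q) g z r : \det g = 1 -> upper_half_plane z ->
  (L *m rho (invmx g) *m iter r (@dtau R q) f (mobius g z)) 0 0 =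
  conjc (autj g z) ^+ d * autj g z ^ (kap + (2 * r)%:Z) *
   \sum_(j < r.+1) cf R kap r j * (autj' g / autj g z) ^+ (r - j) *
     iter j (@dtau_scalar R) (fun w => (L *m f w) 0 0) z.
Proof.
move=> dg z0; set s := invmx g; have ds : \det s = 1 by rewrite det_inv dg invr1.
pose u w := (L *m f w) 0 0; pose v w := (L *m rho s *m f w) 0 0.
have gz0 := mobius_upper dg z0; have j0 := autj_neq0 dg z0.
have au : ana_on_H u := ana_on_H_row L anaf.
have av : ana_on_H v := ana_on_H_row (L *m rho s) anaf.
rewrite -iter_dtau_row // -/v.
have SE w : upper_half_plane w -> scusp s kap 0 (fun=> u) 0 w = conjc (autj s w) ^+ d * v w.
  move=> w0; have js0 := autj_neq0 ds w0.
  rewrite /scusp big_ord1 bin0 expr0 !mul1r !add0r /u lawf // -scalemxAr mulmxA mxE -/(v w).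
  by rewrite !mulrA -expfzDr // addNr expr0z mul1r.
have W w : upper_half_plane w -> wdiff (fun w => conjc (autj s w) ^+ d) w 0.
  move=> w0; have H : wdiff (fun w => conjc (autj s w)) w 0.
    have := wdiffD (wdiffZ (s 1 0)%:C (wdiff_conj w)) (wdiff_cst (s 1 1)%:C w).
    by rewrite mulr0 addr0; apply: wdiff_ext => w'; rewrite affine_conj.
  by have := wdiffX d H; rewrite mulr0 mul0r.
have aS : ana_on_H (fun w => conjc (autj s w) ^+ d * v w).
  move=> w w0; have A := real_ana_algebra w; apply: (da_mul A); last exact: av.
  apply: real_anaX; apply: (@real_ana_near _ (fun w => (s 1 0)%:C * conjc w + (s 1 1)%:C)).
    by exists 1 => // w' _; rewrite affine_conj.
  by apply: (da_add A); [apply: (da_mul A); [|exact: real_ana_conj]|]; exact: (da_cst A).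
have := iter_dtau_antiholo r av W gz0.
rewrite -(iter_dtau_eq r aS SE gz0) -(iter_sdl_depth0 r (scusp s kap 0 (fun=> u))).
have Ureg w : upper_half_plane w -> upper_half_plane w /\ sregular 0 (fun=> u) (mobius s w).
  by move=> w0; split=> //; apply: real_ana_sregular => _ _; apply: au; exact: mobius_upper.
rewrite (iter_scusp kap ds (@upper_near R) Ureg r (leqnn 0) gz0).
rewrite autj_inv // fmorphV exprVn => E.
have J0 : conjc (autj g z) ^+ d != 0 by rewrite expf_neq0 // conjc_eq0.
rewrite -[LHS](mulVKf J0) -E -mulrA; congr (_ * _); rewrite mulr_sumr subr0.
apply: eq_bigr => j _.
have jr : (j <= r)%N by have := ltn_ord j.
rewrite /tcusp /scusp big_ord1 bin0 expr0 !mul1r !add0r (iter_sdl_depth0 j (fun=> u)).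
rewrite /s mobius_inv // -/u autj_inv // exprz_inv opprK.
have -> : xj (invmx g) (mobius g z) = autj' g * autj g z.
  by rewrite /xj autj_inv // invrK /autj' invmx2 // mx2E rmorphN opprK.
have -> : autj g z ^ (kap + (2 * r)%:Z) = autj g z ^ (kap + (2 * j)%:Z) * (autj g z ^+ (r - j) * autj g z ^+ (r - j)).
  rewrite -exprD [X in _ * X]exprnP -expfzDr //; congr (_ ^ _); lia.
rewrite expr_div_n exprMn; field.
by rewrite expf_neq0.
Qed.

End Slash.

(** The term of indices [j, i] carries [X^(n-j-i)], and only [j >= a], [i >= b] with [a + b = n - 1]
    matter; so [(a, b)] alone reaches degree 1 and all other terms are constant. *)
Lemma bracket_expansion kap lam n a b (c : nat -> R[i]) (u v : nat -> R[i]) : (a + b).+1 = n ->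
  (forall j, (j < a)%N -> u j = 0) -> (forall i, (i < b)%N -> v i = 0) ->
  exists w0, forall X : R[i],
  \sum_(r < n.+1) c r * (\sum_(j < r.+1) cf R kap r j * X ^+ (r - j) * u j) *
    (\sum_(i < (n - r).+1) cf R lam (n - r) i * X ^+ (n - r - i) * v i) =
  (\sum_(r < n.+1) c r * (cf R kap r a * cf R lam (n - r) b)) * (u a * v b) * X + w0.
Proof.
move=> abn Hu Hv.
exists (\sum_(r < n.+1) \sum_(j < n.+1) \sum_(i < n.+1)
  c r * (if (j + i == n)%N then cf R kap r j * cf R lam (n - r) i * (u j * v i) else 0)) => X.
rewrite -mulrA mulr_suml -big_split; apply: eq_bigr => r _ /=.
have rn : (r <= n)%N by have := ltn_ord r.
rewrite (cf_sum_widen _ _ _ rn) (cf_sum_widen _ _ _ (leq_subr r n)).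
have an : (a < n.+1)%N by lia.
have bn : (b < n.+1)%N by lia.
have -> : c r * (cf R kap r a * cf R lam (n - r) b) * (u a * v b * X) =
   \sum_(j < n.+1) \sum_(i < n.+1) c r * (if (j == a :> nat) && (i == b :> nat) then
       cf R kap r j * cf R lam (n - r) i * (u j * v i) * X else 0).
  rewrite (bigD1 (Ordinal an)) //= (bigD1 (Ordinal bn)) //= !eqxx /=.
  rewrite big1 => [|i]; last by rewrite -val_eqE /= => /negbTE ->; rewrite mulr0.
  rewrite big1 => [|j]; last first.
    by rewrite -val_eqE /= => /negbTE ->; rewrite big1 // => i _; rewrite mulr0.
  ring.
rewrite -mulrA mulr_suml mulr_sumr -big_split; apply: eq_bigr => j _ /=.
rewrite mulr_sumr mulr_sumr -big_split; apply: eq_bigr => i _ /=.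
rewrite -mulrDr; congr (_ * _).
case: (ltnP r j) => h1; first by rewrite (@cf_small _ kap) // !mul0r !if_same addr0.
case: (ltnP (n - r) i) => h2; first by rewrite (@cf_small _ lam) // !(mul0r, mulr0) !if_same addr0.
case: (ltnP j a) => h3; first by rewrite Hu // !(mul0r, mulr0) !if_same addr0.
case: (ltnP i b) => h4; first by rewrite Hv // !(mul0r, mulr0) !if_same addr0.
have : (j + i == n)%N || ((j == a :> nat) && (i == b :> nat)) by lia.
case/orP => [h|/andP[ja ib]].
  rewrite h ifF; last by lia.
  have -> : (r - j = 0)%N by lia.
  have -> : (n - r - i = 0)%N by lia.
  by rewrite !expr0; ring.
rewrite ja ib /= ifF; last by lia.
have : ((r - j = 0 /\ n - r - i = 1) \/ (r - j = 1 /\ n - r - i = 0))%N by lia.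
by case=> -[-> ->]; rewrite expr0 expr1; ring.
Qed.

Lemma coef_affineX (al : R[i]) D : ((al *: 'X + 1%:P) ^+ D)`_D = al ^+ D.
Proof.
elim: D => [|D IH]; first by rewrite !expr0 coefC.
rewrite exprS mulrDl coefD -scalerAl coefZ coefXM /= IH coefCM.
by rewrite (nth_default _ (size_expr_affine al 1 D)) mulr0 addr0 exprS.
Qed.

(** The left side is a polynomial whose coefficient in degree [D + 1] is [al^D w1], the right side
    has degree at most [D], and they agree at infinitely many points. *)
Lemma degree_obstruction (al w1 w0 : R[i]) (be : nat -> R[i]) D (x : nat -> R[i]) :
  al != 0 -> injective x ->
  (forall t, (1 + al * x t) ^+ D * (w1 * x t + w0) = \sum_(r < D.+1) be r * x t ^+ r) -> w1 = 0.
Proof.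
move=> al0 xi H.
pose P : {poly R[i]} := (al *: 'X + 1%:P) ^+ D * (w1 *: 'X + w0%:P) - \poly_(r < D.+1) be r.
have P0 : P = 0.
  apply/eqP/negPn/negP => P0.
  pose rs := [seq x t | t <- iota 0 (size P).+1].
  have := max_poly_roots P0 (_ : all (root _) rs) (_ : uniq rs).
  rewrite size_map size_iota ltnNge leqnSn => /(_ _ _)/negP; apply => //.
    apply/allP => y /mapP[t _ ->]; rewrite /root /P hornerD hornerN hornerM horner_exp !hornerE.
    by rewrite horner_poly (addrC _ 1) H subrr.
  by rewrite map_inj_uniq ?iota_uniq.
have := congr1 (fun p : {poly R[i]} => p`_D.+1) P0.
rewrite /P coefB coef_poly ltnn subr0 coef0 mulrDr coefD -scalerAr coefZ coefMX /= coef_affineX.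
rewrite coefMC (nth_default _ (size_expr_affine al 1 D)) mul0r addr0 => /eqP.
by rewrite mulf_eq0 (negbTE (expf_neq0 _ al0)) orbF => /eqP.
Qed.

End TestForms.

(** * Uniqueness up to a scalar *)

Section Uniqueness.
Variable R : realType.
Variables (k l : int) (d e n : nat) (c : 'rV[R[i]]_n.+1).
Hypothesis Hc : preserves_quasimodularity k l d e c.

(** Two test forms are paired with functionals that produce zeros of order [a] and [n - a - 1] at
    the point [i]. The law of their bracket there is a polynomial identity in [X], whose top
    coefficient is the recurrence up to nonzero factors. *)
Lemma preserves_bracket_rec :
  bracket_rec (k - d%:Z) (l - e%:Z) n (fun r => c 0 (inord r)).
Proof.
move=> a ltan; set b := (n - a.+1)%N.
pose z0 : R[i] := 'i%C; have z00 : upper_half_plane z0 by rewrite /upper_half_plane /= ltr01.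
(* [m1 >= n] leaves room for zeros of order up to [n], and [m1 >= |k - 2d|] makes the weight
   equation [k = 2d + p1 - m1] solvable with [p1 >= 0]. *)
pose m1 := (n + absz (k - (2 * d)%:Z)%R)%N; pose p1 := absz (m1%:Z + k - (2 * d)%:Z)%R.
pose m2 := (n + absz (l - (2 * e)%:Z)%R)%N; pose p2 := absz (m2%:Z + l - (2 * e)%:Z)%R.
pose f : R[i] -> _ := exf m1 p1 d; pose g : R[i] -> _ := exf m2 p2 e.
have kE : k = (d + d + p1)%:Z - m1%:Z by rewrite /p1 /m1; lia.
have lE : l = (e + e + p2)%:Z - m2%:Z by rewrite /p2 /m2; lia.
have rf := @exrep_representation R m1 p1; have rg := @exrep_representation R m2 p2.
have [B [S [B0 S0 _ law _]]] := @Hc _ _ _ _ _ an _ _ (@SL2Z_fuchsian R) rf rg I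
  (exf_quasimodular R kE) (exf_quasimodular R lE).
rewrite /= in S0; rewrite {}S0 in law.
pose L := exrow m1 p1 a z0; pose M := exrow m2 p2 b z0.
pose u j := iter j (@dtau_scalar R) (fun w => (L *m f w) 0 0) z0.
pose v j := iter j (@dtau_scalar R) (fun w => (M *m g w) 0 0) z0.
have imcX q : ana_on_H (fun w : R[i] => imc w ^- q).
  move=> z zz; apply: (@real_ana_near _ (fun w => (imc w)^-1 ^+ q)).
    by exists 1 => // w _; rewrite exprVn.
  by apply: real_anaX; exact: real_ana_imcV.
have uE q (h : R[i] -> R[i]) a' : (forall w, h w = (w - z0) ^+ a' * imc w ^- q) ->
    (forall j, (j < a')%N -> iter j (@dtau_scalar R) h z0 = 0) /\ iter a' (@dtau_scalar R) h z0 != 0.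
  move=> /funext ->; split=> [j ja|].
    have [H _ ->] := iter_dtau_zero z0 (imcX q) (ltnW ja); last by [].
    by rewrite subrr expr0n subn_eq0 leqNgt ja mul0r.
  have [H [_ Hz] ->] := iter_dtau_zero z0 (imcX q) (leqnn a'); last by [].
  by rewrite subnn mul1r Hz ffactnn mulf_neq0 ?invr_eq0 ?expf_neq0 ?imc_neq0 // pnatr_eq0 -lt0n fact_gt0.
have [ua ua0] : (forall j, (j < a)%N -> u j = 0) /\ u a != 0.
  by apply: (uE (d + p1)%N) => w; rewrite exrow_exf // /m1; lia.
have [vb vb0] : (forall j, (j < b)%N -> v j = 0) /\ v b != 0.
  by apply: (uE (e + p2)%N) => w; rewrite exrow_exf // /m2 /b; lia.
have abn : (a + b).+1 = n by rewrite /b; lia.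
have [w0 Hw] := bracket_expansion (k - d%:Z) (l - e%:Z) (fun r => c 0 (inord r))
  abn ua vb.
have := bracket_defect (k - d%:Z) (l - e%:Z) (fun r => c 0 (inord r)) ltan; rewrite -/b => <-.
pose w1 := \sum_(r < n.+1) c 0 (inord r) * (cf R (k - d%:Z) r a * cf R (l - e%:Z) (n - r) b).
rewrite -/w1; have {}Hw X := Hw X; rewrite -/w1 in Hw.
(* Lower unipotent matrices: [c = t] and [j = t z0 + 1], so [x t = t / (t z0 + 1)] takes infinitely
   many values. *)
pose ga (t : nat) : 'M[R]_2 := mx2 1 0 t%:R 1.
have Gga t : SL2Z (ga t) by apply: SL2Z_mx2; rewrite ?rpred0 ?rpred1 ?rpred_nat // mulr1 mul0r subr0.
have dga t : \det (ga t) = 1 := (Gga t).1.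
pose x t : R[i] := autj' (ga t) / autj (ga t) z0.
have lawf h z : \det h = 1 -> upper_half_plane z -> f (mobius h z) =
    (autj h z ^ (k - d%:Z) * conjc (autj h z) ^+ d) *: (exrep m1 p1 h *m f z).
  by have -> : k - d%:Z = (d + p1)%:Z - m1%:Z; [lia|exact: exf_law].
have lawg h z : \det h = 1 -> upper_half_plane z -> g (mobius h z) =
    (autj h z ^ (l - e%:Z) * conjc (autj h z) ^+ e) *: (exrep m2 p2 h *m g z).
  by have -> : l - e%:Z = (e + p2)%:Z - m2%:Z; [lia|exact: exf_law].
pose LM : 'rV[R[i]]_(m1.+1 * p1.+1 * (m2.+1 * p2.+1)) := L *t M.
(* [LM] and the representation at the inverse matrix are applied to the law at [z0], which leaves
   scalars. After division by powers of [j], the side of the bracket retains the power [d + e] of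
   [conjc j / j = 1 - 2 i y X]. *)
have key t : (1 + (- (2 * 'i%C * imc z0)) * x t) ^+ (d + e) * (w1 * (u a * v b) * x t + w0) =
    \sum_(r < (d + e).+1) (LM *m B r z0) 0 0 * x t ^+ r.
  have j0 := autj_neq0 (dga t) z00; set j := autj (ga t) z0 in j0.
  set s := invmx (ga t).
  have rep := tensor_representation rf rg.
  have E := congr1 (fun N => (LM *m tensor_rep (exrep m1 p1) (exrep m2 p2) s *m N) 0 0)
    (law (ga t) z0 (Gga t) z00 (@id False) (@id False)).
  have El : (LM *m tensor_rep (exrep m1 p1) (exrep m2 p2) s *m bracket c f g (mobius (ga t) z0)) 0 0 =
     conjc j ^+ (d + e) * j ^ (k - d%:Z + (l - e%:Z) + (2 * n)%:Z) * (w1 * (u a * v b) * x t + w0).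
    rewrite -Hw mulr_sumr /bracket mulmx_sumr summxE; apply: eq_bigr => r _.
    have rn : (r <= n)%N by have := ltn_ord r.
    rewrite inord_val -scalemxAr mxE.
    have T := tens_col (L *m exrep m1 p1 s) (M *m exrep m2 p2 s)
      (iter r (@dtau R _) f (mobius (ga t) z0)) (iter (n - r) (@dtau R _) g (mobius (ga t) z0)).
    have {}T := congr1 (fun N : 'cV[R[i]]_(1 * 1) => N 0 0) T.
    rewrite -(tensmx_mul L M) [RHS]mxE !(ord1 (mxtens_unindex _).1) !(ord1 (mxtens_unindex _).2) in T.
    rewrite (row_iter_dtau (@ana_on_H_exf R m1 p1 d) lawf L r (dga t) z00) in T.
    rewrite (row_iter_dtau (@ana_on_H_exf R m2 p2 e) lawg M (n - r) (dga t) z00) in T.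
    rewrite [X in _ * X]T -/j -/(x t).
    have -> : j ^ (k - d%:Z + (l - e%:Z) + (2 * n)%:Z) =
        j ^ (k - d%:Z + (2 * r)%:Z) * j ^ (l - e%:Z + (2 * (n - r))%:Z).
      by rewrite -expfzDr //; congr (_ ^ _); lia.
    rewrite exprD; ring.
  have Er : (LM *m tensor_rep (exrep m1 p1) (exrep m2 p2) s *m
      (\sum_(r < (d + e).+1) (j ^ (k + l + (2 * n)%:Z - r%:Z) * autj' (ga t) ^+ r) *:
         (tensor_rep (exrep m1 p1) (exrep m2 p2) (ga t) *m B r z0))) 0 0 =
     j ^+ (d + e) * j ^ (k - d%:Z + (l - e%:Z) + (2 * n)%:Z) *
       \sum_(r < (d + e).+1) (LM *m B r z0) 0 0 * x t ^+ r.
    rewrite mulmx_sumr summxE mulr_sumr; apply: eq_bigr => r _.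
    rewrite -scalemxAr mxE -!mulmxA (mulmxA (tensor_rep _ _ s)).
    rewrite -rep.2 //; last exact: SL2Z_inv.
    rewrite /s mulVmx ?unitmxE ?dga ?unitr1 // rep.1 mul1mx.
    rewrite /x expr_div_n -/j.
    have -> : j ^+ (d + e) * j ^ (k - d%:Z + (l - e%:Z) + (2 * n)%:Z) =
        j ^ (k + l + (2 * n)%:Z - r%:Z) * j ^+ r.
      by rewrite !exprnP -!expfzDr //; congr (_ ^ _); lia.
    field; by rewrite expf_neq0.
  rewrite El Er in E.
  have jk0 : j ^+ (d + e) * j ^ (k - d%:Z + (l - e%:Z) + (2 * n)%:Z) != 0.
    by rewrite mulf_neq0 ?expf_neq0 // expfz_neq0.
  apply: (mulfI jk0); rewrite -E.
  have -> : conjc j = j * (1 + (- (2 * 'i%C * imc z0)) * x t).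
    by rewrite conj_autj -/j /x -/j; field.
  by rewrite exprMn; ring.
have al0 : - (2 * 'i%C * imc z0) != 0.
  rewrite oppr_eq0 !mulf_neq0 ?imc_neq0 ?pnatr_eq0 //.
  by rewrite eq_complex /= oner_eq0 andbF.
have xinj : injective x.
  move=> t t' /eqP; have j0 := autj_neq0 (dga t) z00; have j'0 := autj_neq0 (dga t') z00.
  rewrite /x eqr_div // /autj' /autj !mx2E !rmorph_nat rmorph1 => /eqP E.
  apply/eqP; rewrite -(eqr_nat R[i]) -subr_eq0; apply/eqP.
  transitivity (t%:R * (t'%:R * z0 + 1) - t'%:R * (t%:R * z0 + 1)); first by ring.
  by rewrite E subrr.
have /eqP := degree_obstruction (be := fun r => (LM *m B r z0) 0 0) al0 xinj key.
by rewrite mulf_eq0 (negbTE (mulf_neq0 ua0 vb0)) orbF => /eqP.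
Qed.

End Uniqueness.
Theorem theorem1p2 (R : realType) (k l : int) (d e n : nat)
    (not_excluded :
      ~ [/\ 0 <= d%:Z - k, 0 <= e%:Z - l, d%:Z - k < n%:Z, e%:Z - l < n%:Z
          & n%:Z <= d%:Z + e%:Z - k - l + 1]) :
  [/\ rc_coef k l d e n != 0 :> 'rV[R[i]]_n.+1,
      preserves_quasimodularity k l d e (rc_coef k l d e n : 'rV[R[i]]_n.+1),
      forall c : 'rV[R[i]]_n.+1,
        c != 0 -> preserves_quasimodularity k l d e c ->
        exists2 a : R[i], a != 0 & c = a *: rc_coef k l d e n
    & forall (Gamma : set 'M[R]_2) (m p : nat)
        (rho : 'M[R]_2 -> 'M[R[i]]_m) (eta : 'M[R]_2 -> 'M[R[i]]_p)
        (f : R[i] -> 'cV[R[i]]_m) (g : R[i] -> 'cV[R[i]]_p),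
      fuchsian Gamma -> has_cusps Gamma -> (1 <= n)%N ->
      representation Gamma rho -> representation Gamma eta ->
      quasimodular Gamma rho hol k d f -> quasimodular Gamma eta hol l e g ->
      quasimodular Gamma (tensor_rep rho eta) cusp (k + l + (2 * n)%:Z) (d + e)
        (bracket (rc_coef k l d e n) f g)].
Proof.
have [r0 [r0n kap0 lam0]] := pivot_exists not_excluded.
have pv0 := @rcc_pivot_neq0 R _ _ _ _ r0n kap0 lam0.
split.
- apply/eqP => /matrixP/(_ 0 (inord r0)); rewrite rc_coefE inordK // [RHS]mxE => E.
  by rewrite E eqxx in pv0.
- move=> Gamma m p rho eta star f g [[dets _ _ _] _ _] _ _ _ Hf Hg.
  by apply: bracket_quasimodular Hf Hg => //; left.
- move=> c c0 Hc; have rec := preserves_bracket_rec Hc.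
  have cE := bracket_rec_unique r0n kap0 lam0 rec.
  set a := _ / _ in cE; have {}cE : c = a *: rc_coef k l d e n.
    apply/rowP => r; rewrite mxE rc_coefE -cE ?inord_val //.
    by have := ltn_ord r.
  exists a => //; apply: contraNneq c0 => a0.
  by rewrite cE a0 scale0r.
- move=> Gamma m p rho eta f g [[dets _ _ _] _ _] _ n1 _ _ Hf Hg.
  by apply: bracket_quasimodular Hf Hg => //; right.
Qed.
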